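(* Assume $\gamma^\#_+>0>\gamma^\#_-$. Let $\zeta_2>\zeta_1>0$ and suppose $G(s)=g(s)/d$ satisfies: $G$ is continuous on $[0,\infty)$, positive for $s>0$, with right derivative $G'(0+)>1$; $G([\zeta_1,\zeta_2])\subseteq[\zeta_1,\zeta_2]$ and $G([0,\infty))\subseteq[0,\zeta_2]$; $\min_{s\in[\zeta_1,\zeta_2]}G(s)=G(\zeta_1)$ and $G(s)>s$ for $s\in(0,\zeta_1]$. Assume also $g(s)\leq g'(0)s$ for all $s\geq0$. Then for every $c\in\left((-\infty,c_*^-]\cup[c_*^+,+\infty)\right)\setminus\{0\}$ the lattice equation (LE) has at least one semi-wavefront $w_j(t)=\phi_c(j+ct)$ with $\phi_c\leq\zeta_2$. Moreover, if $c\leq c_*^-$ then $\phi_c(+\infty)=0$ and $\liminf_{s\to-\infty}\phi_c(s)>\zeta_1$; if $c\geq c_*^+$ then $\phi_c(-\infty)=0$ and $\liminf_{s\to+\infty}\phi_c(s)>\zeta_1$; and if $G(s)=s$ has only the two solutions $0,\kappa$ in $[0,\infty)$ with $\kappa$ globally attracting for $G:(0,\zeta_2]\to(0,\zeta_2]$, then $\phi_c$ converges to $\kappa$ at the end of $\mathbb{R}$ where it does not vanish.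
   Context: Let $D>0$, $d>0$, $r\geq0$, and $\beta:\mathbb{Z}\to[0,\infty)$ with $\sum_{k\in\mathbb{Z}}\beta(k)=1$. Let $g:[0,\infty)\to[0,\infty)$ be continuous with $g(0)=0$ and finite derivative $g'(0)$. Lattice equation (LE): $w_j'(t)=D[w_{j+1}(t)-2w_j(t)+w_{j-1}(t)]-dw_j(t)+\sum_{k\in\mathbb{Z}}\beta(j-k)g(w_k(t-r))$, $j\in\mathbb{Z}$. A semi-wavefront is a solution $w_j(t)=\phi(j+ct)$ with $\phi$ positive, bounded, and $\phi(-\infty)=0$ or $\phi(+\infty)=0$; equivalently $\phi$ is a positive bounded solution of $c\phi'(x)=D[\phi(x+1)+\phi(x-1)-2\phi(x)]-d\phi(x)+\sum_{k}\beta(k)g(\phi(x-k-cr))$. Let $\gamma^\#_-\leq0\leq\gamma^\#_+$ (extended reals) be such that $\sum_k\beta(k)e^{-zk}$ converges for $z\in(\gamma^\#_-,\gamma^\#_+)$ and diverges for $z>\gamma^\#_+$ and for $z<\gamma^\#_-$. Let $\tilde\chi(z,c)=d+2D+cz-D(e^z+e^{-z})-g'(0)e^{-crz}\sum_{k}\beta(k)e^{-kz}$ for $z\in(\gamma^\#_-,\gamma^\#_+)$ with $d+2D+cz>0$. Critical speeds: $c_*^+=\inf\{c:\tilde\chi(z,c)=0$ for some such $z>0\}$, $c_*^-=\sup\{c:\tilde\chi(z,c)=0$ for some such $z<0\}$ (these are real numbers with $c_*^-<c_*^+$ under the hypotheses). ''Globally attracting'' means iterates of every $s\in(0,\zeta_2]$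 under $G$ converge to $\kappa$. *)

(* Defs.v *)
From Stdlib Require Import Reals ZArith.
From Coquelicot Require Import Coquelicot.
Open Scope R_scope.

(* Sums over Z: sum_{k in Z} f k, split as sum_{k>=0} + sum_{k<0}.
   (All sums used below have nonnegative terms, so this is the usual sum.) *)
Definition is_sumZ (f : Z -> R) (l : R) : Prop :=
  exists l1 l2,
    is_series (fun n : nat => f (Z.of_nat n)) l1 /\
    is_series (fun n : nat => f (- Z.of_nat n - 1)%Z) l2 /\
    l = l1 + l2.

Definition ex_sumZ (f : Z -> R) : Prop := exists l, is_sumZ f l.

Definition SeriesZ (f : Z -> R) : R :=
  Series (fun n : nat => f (Z.of_nat n)) + Series (fun n : nat => f (- Z.of_nat n - 1)%Z).

Definition beta_exp (beta : Z -> R) (z : R) : Z -> R :=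
  fun k => beta k * exp (- z * IZR k).

Definition abscissae (beta : Z -> R) (gm gp : Rbar) : Prop :=
  Rbar_le gm (Finite 0) /\ Rbar_le (Finite 0) gp /\
  (forall z : R, Rbar_lt gm (Finite z) -> Rbar_lt (Finite z) gp -> ex_sumZ (beta_exp beta z)) /\
  (forall z : R, Rbar_lt gp (Finite z) -> ~ ex_sumZ (beta_exp beta z)) /\
  (forall z : R, Rbar_lt (Finite z) gm -> ~ ex_sumZ (beta_exp beta z)).

(* tilde chi(z,c); g0 stands for g'(0) *)
Definition chi (D d r g0 : R) (beta : Z -> R) (z c : R) : R :=
  d + 2 * D + c * z - D * (exp z + exp (- z))
  - g0 * exp (- c * r * z) * SeriesZ (beta_exp beta z).

Definition chi_dom (D d : R) (gm gp : Rbar) (z c : R) : Prop :=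
  Rbar_lt gm (Finite z) /\ Rbar_lt (Finite z) gp /\ 0 < d + 2 * D + c * z.

Definition cstar_plus (D d r g0 : R) (beta : Z -> R) (gm gp : Rbar) : Rbar :=
  Glb_Rbar (fun c => exists z, 0 < z /\ chi_dom D d gm gp z c /\ chi D d r g0 beta z c = 0).

Definition cstar_minus (D d r g0 : R) (beta : Z -> R) (gm gp : Rbar) : Rbar :=
  Lub_Rbar (fun c => exists z, z < 0 /\ chi_dom D d gm gp z c /\ chi D d r g0 beta z c = 0).

Definition LE_solution (D d r : R) (beta : Z -> R) (g : R -> R) (w : Z -> R -> R) : Prop :=
  forall (j : Z) (t : R), exists S : R,
    is_sumZ (fun k => beta (j - k)%Z * g (w k (t - r))) S /\
    is_derive (w j) t
      (D * (w (j + 1)%Z t - 2 * w j t + w (j - 1)%Z t) - d * w j t + S).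

Definition semi_wavefront (D d r : R) (beta : Z -> R) (g : R -> R) (c : R) (phi : R -> R) : Prop :=
  (forall x, 0 < phi x) /\
  (exists M, forall x, phi x <= M) /\
  (is_lim phi m_infty (Finite 0) \/ is_lim phi p_infty (Finite 0)) /\
  LE_solution D d r beta g (fun j t => phi (IZR j + c * t)).

Definition liminf_m_infty_gt (phi : R -> R) (a : R) : Prop :=
  exists eta M, a < eta /\ forall s, s <= M -> eta <= phi s.
Definition liminf_p_infty_gt (phi : R -> R) (a : R) : Prop :=
  exists eta M, a < eta /\ forall s, M <= s -> eta <= phi s.

(* Main.v *)
(* By the reflection x -> -x it suffices to treat c >= c_*^+, where c is a limit of speeds c_n
   with chi(lam_n, c_n) > 0 for some lam_n > 0. As g(s) <= g0 s, the function e^(lam_n x) is then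
   a strict upper solution, and Schauder's theorem yields a profile phi_n <= e^(lam_n x) of the
   equation perturbed by a small source that is bounded below on [0, oo). The source keeps phi_n
   away from 0 at +oo, and G(s) > s on (0, zeta1] pushes it beyond zeta1 there, so no lower
   solution is needed. Translate phi_n so that 0 is the first point where it reaches a small
   level th, and let n -> oo: the limit phi solves the unperturbed equation, phi(0) >= th, and
   phi <= th on the left half line. Since g(s) > d s for small s, integrating the equation shows
   that phi is integrable at -oo, hence vanishes there. If phi were not bounded away from 0 at
   +oo, a further translation limit would be a positive profile that stays small on a right half
   line; a Lyapunov functional with a slowly varying exponential weight excludes this, because
   - chi(., c), convex and almost nonpositive somewhere on (0, oo), is bounded below by a positive
   constant on (-oo, 0]. *)
Require Import Defs.
From Stdlib Require Import Reals ZArith.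
From Coquelicot Require Import Coquelicot.
From Stdlib Require Import Lra Lia Classical ClassicalEpsilon List.
From mathcomp Require all_boot.
From mathcomp.classical Require filter.
Open Scope R_scope.

(** * A cubical Kuhn lemma *)

(** The critical speed is approached by larger ones because no strict upper solution need exist
    there: for [lam > 0] the function [chi] strictly increases with the speed, and this gain pays
    for the source. The condition [c <> 0] gives compactness: the equation bounds [c * phi'], hence
    a Lipschitz constant of order [1 / |c|], uniform along the approximation.

    In the estimates the convolution is cut to finitely many shifts. As [g] is first composed with
    [clip zeta2], it is bounded by [d * zeta2], and the cut costs at most [d * zeta2] times the
    missing mass of [beta], whatever the profile. So the Lyapunov functional has finitely many
    windows, and the bound from convexity only has to keep a positive margin after the cut.

    For the convergence to [kappa], let [m] and [M] be the lower and upper limits of the profile.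
    Then [G v <= m] and [G u >= M] for some [u], [v] in [[m, M]]. Global attraction excludes
    2-cycles of [G], and this forces [m = M = kappa].

    Schauder's theorem is derived from a cubical labelling lemma, which rests on a Stokes formula
    mod 2. *)

Section Kuhn.

Import all_boot.
Local Open Scope nat_scope.
Local Set Implicit Arguments.
Local Unset Strict Implicit.

Context (n : nat).

Definition pt := {ffun 'I_n -> nat}.

Definition upd (q : pt) (j : 'I_n) (t : nat) : pt :=
  [ffun i => if i == j then t else q i].

Definition inc (q : pt) (j : 'I_n) : pt := upd q j (q j).+1.

Lemma upd_comm (q : pt) j k s t : j != k ->
  upd (upd q j s) k t = upd (upd q k t) j s.
Proof.
move=> jk; apply/ffunP=> i; rewrite !ffunE.
by have [->|//] := eqVneq i k; rewrite eq_sym (negbTE jk).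
Qed.

Lemma inc_comm (q : pt) j k : inc (inc q j) k = inc (inc q k) j.
Proof.
have [->//|jk] := eqVneq j k.
apply/ffunP=> i; rewrite !ffunE (eq_sym k j) (negbTE jk).
by have [->|//] := eqVneq i k; rewrite eq_sym (negbTE jk).
Qed.

Lemma inc_upd_eq (q : pt) j t : inc (upd q j t) j = upd q j t.+1.
Proof. by apply/ffunP=> i; rewrite !ffunE eqxx; case: eqP. Qed.

(** The pairs [(j, k)] and [(k, j)] are distinct off the diagonal and contribute equal terms, which
    cancel mod 2. *)
Lemma xor_sym_eq0 (J : {set 'I_n}) (f : 'I_n -> 'I_n -> bool) :
  (forall j k, f j k = f k j) ->
  \big[addb/false]_(j in J) \big[addb/false]_(k in J :\ j) f j k = false.
Proof.
move=> fC; rewrite pair_big_dep /=.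
rewrite (bigID (fun p : 'I_n * 'I_n => p.1 < p.2)) /=.
rewrite [X in _ (+) X](reindex_inj (h := fun p => (p.2, p.1))) /=; last by move=> [a b] [a' b'] [-> ->].
set X := \big[_/_]_(_ | _) _; set Y := \big[_/_]_(_ | _) _.
suff -> : Y = X by rewrite addbb.
apply: eq_big => [[a b]|[a b] _] /=; last by rewrite fC.
rewrite !inE -leqNgt leq_eqVlt eq_sym.
case: (ltngtP a b) => [ab|ab|/val_inj ->]; rewrite ?andbF ?andbT ?eqxx ?orbF //=;
  rewrite ?orbT ?andbT; case: (a \in J); case: (b \in J) => //=; rewrite ?andbF //.
Qed.

(* The cup product (mod 2) of the coboundaries of the labels [L i], [i] in [s],
   evaluated on the cube at [q] spanned by the directions in [J]. *)
Fixpoint cup (L : 'I_n -> pt -> bool) (s : seq 'I_n) (q : pt) (J : {set 'I_n}) :=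
  if s is i :: s' then
    \big[addb/false]_(j in J)
      ((L i (inc q j) (+) L i q) && cup L s' (inc q j) (J :\ j))
  else true.

Context (L : 'I_n -> pt -> bool).

Lemma setD1C (J : {set 'I_n}) j k : J :\ j :\ k = J :\ k :\ j.
Proof. by rewrite setDDl setUC -setDDl. Qed.

(** A product of coboundaries is a cocycle: the front and the back faces of a cube have the same
    sum. The induction is the Leibniz rule, whose leftover double sums are symmetric in the two
    directions and vanish mod 2. *)
Lemma cup_closed s q (J : {set 'I_n}) :
  \big[addb/false]_(j in J) cup L s (inc q j) (J :\ j)
    = \big[addb/false]_(j in J) cup L s q (J :\ j).
Proof.
elim: s q J => [|i s IH] q J //=.
pose S2 (f : 'I_n -> 'I_n -> bool) :=
  \big[addb/false]_(j in J) \big[addb/false]_(k in J :\ j) f j k.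
have S2D f g : S2 (fun j k => f j k (+) g j k) = S2 f (+) S2 g.
  by rewrite -big_split /=; apply: eq_bigr => j _; rewrite big_split.
have S2C f : S2 f = S2 (fun j k => f k j).
  rewrite /S2 (exchange_big_dep (mem J)) /=; last by move=> j k _; rewrite !inE => /andP[].
  by apply: eq_bigr => j jJ; apply: eq_bigl => k; rewrite !inE jJ andbT andbC eq_sym.
transitivity (S2 (fun j k => (L i (inc (inc q j) k) && cup L s (inc (inc q j) k) (J :\ j :\ k))
                     (+) (L i (inc q j) && cup L s (inc (inc q j) k) (J :\ j :\ k)))).
  by apply: eq_bigr => j _; apply: eq_bigr => k _; rewrite andb_addl.
(* Both moves have been made in the first summand, and moves commute, so its sum is symmetric and
   vanishes. *)
rewrite S2D {1}/S2 xor_sym_eq0 ?addFb; last by move=> j k; rewrite inc_comm setD1C.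
transitivity (S2 (fun j k => L i (inc q j) && cup L s (inc q j) (J :\ j :\ k))).
  by apply: eq_bigr => j _; rewrite -!big_distrr /= IH.
transitivity (S2 (fun j k => (L i (inc q k) && cup L s (inc q k) (J :\ j :\ k))
                     (+) (L i q && cup L s (inc q k) (J :\ j :\ k)))); last first.
  by apply: eq_bigr => j _; apply: eq_bigr => k _; rewrite andb_addl.
(* For fixed [j] the induction hypothesis moves the points [inc q k] back to [q], where the sum
   becomes symmetric. *)
rewrite S2D [X in _ = _ (+) X](_ : _ = false) ?addbF; last first.
  rewrite -[RHS](xor_sym_eq0 J (f := fun j k => L i q && cup L s q (J :\ j :\ k))); last first.
    by move=> j k; rewrite setD1C.
  by apply: eq_bigr => j _; rewrite -!big_distrr /= IH.
by rewrite S2C; apply: eq_bigr => j _; apply: eq_bigr => k _; rewrite setD1C.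
Qed.

(** The cube lies in a face on which the label [k] is constant, so one factor of the product, the
    coboundary of this label, vanishes. *)
Lemma cup_const s (q : pt) (J : {set 'I_n}) k t b : k \in s -> k \notin J -> q k = t ->
  (forall q' : pt, q' k = t -> L k q' = b) -> cup L s q J = false.
Proof.
elim: s q J => [//|i s IH] q J; rewrite inE => kis kJ qk Lb /=.
apply: big1 => j jJ; have jk : k != j by apply: contraNneq kJ => ->.
have iqk : inc q j k = t by rewrite !ffunE (negbTE jk).
case/orP: kis => [/eqP <-|ks]; first by rewrite !Lb // addbb.
by rewrite (IH (inc q j)) ?andbF // !inE negb_and kJ orbT.
Qed.

(** A nonzero sum has a nonzero term. Such a term is a monotone path along edges of the cube on
    which each label of [s] changes at its own edge, so both of its values occur at corners. *)
Lemma cup_corners s q (J : {set 'I_n}) : cup L s q J -> forall i, i \in s ->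
  exists r r' : pt, [/\ forall k, q k <= r k <= q k + (k \in J),
    forall k, q k <= r' k <= q k + (k \in J), L i r & ~~ L i r'].
Proof.
elim: s q J => [//|i s IH] q J /= H.
have [j /andP[jJ /andP[HL Hc]]] : exists j, (j \in J) &&
    ((L i (inc q j) (+) L i q) && cup L s (inc q j) (J :\ j)).
  apply/existsP; apply: contraTT H => /existsPn H.
  by rewrite big1 // => j jJ; apply/negbTE; move: (H j); rewrite jJ.
move=> k; rewrite inE => /orP[/eqP ->|ks].
  have A m : q m <= inc q j m <= q m + (m \in J).
    rewrite !ffunE; case: eqP => [->|_]; first by rewrite jJ addn1 leqnSn leqnn.
    by rewrite leqnn leq_addr.
  have B m : q m <= q m <= q m + (m \in J) by rewrite leqnn leq_addr.
  case E : (L i q); rewrite E in HL.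
    by exists q, (inc q j); split=> //; rewrite addbT in HL.
  by exists (inc q j), q; split=> //; rewrite ?E // addbF in HL *.
have [r [r' [A B C D]]] := IH _ _ Hc k ks.
suff W (x : pt) : (forall m, inc q j m <= x m <= inc q j m + (m \in J :\ j)) ->
    forall m, q m <= x m <= q m + (m \in J).
  by exists r, r'; split=> //; apply: W.
move=> X m; move: (X m); rewrite !ffunE !inE.
case: eqP => [->|_] //=; rewrite jJ addn0 addn1 => /andP[x1 x2].
by rewrite x2 (leq_trans _ x1).
Qed.

Context (p : nat).

Fixpoint gsum (s : seq 'I_n) (f : pt -> bool) (q : pt) :=
  if s is j :: s' then \big[addb/false]_(t < p) gsum s' f (upd q j t) else f q.

Lemma eq_gsum s f g : f =1 g -> gsum s f =1 gsum s g.
Proof. by move=> fg; elim: s => [|j s IH] q //=; apply: eq_bigr => t _; rewrite IH. Qed.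

Lemma gsum_sum s (J : {set 'I_n}) (f : 'I_n -> pt -> bool) q :
  gsum s (fun q => \big[addb/false]_(k in J) f k q) q
    = \big[addb/false]_(k in J) gsum s (f k) q.
Proof.
by elim: s q => [|j s IH] q //=; rewrite exchange_big; apply: eq_bigr => t _; rewrite IH.
Qed.

Lemma gsum_upd s f q j t : j \notin s ->
  gsum s f (upd q j t) = gsum s (fun q => f (upd q j t)) q.
Proof.
elim: s q => [//|k s IH] q; rewrite inE negb_or => /andP[jk js] /=.
by apply: eq_bigr => u _; rewrite upd_comm // IH.
Qed.

Lemma gsumD s f g q : gsum s (fun q => f q (+) g q) q = gsum s f q (+) gsum s g q.
Proof.
by elim: s q => [|j s IH] q //=; rewrite -big_split /=; apply: eq_bigr => t _; rewrite IH.
Qed.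

Lemma gsum_telescope s j (f : pt -> bool) q : uniq s -> j \in s ->
  gsum s (fun q => f (inc q j) (+) f q) q
    = gsum (rem j s) (fun q => f (upd q j p) (+) f (upd q j 0)) q.
Proof.
elim: s q => [//|k s IH] q /= /andP[ks us].
have [kj|kj] := eqVneq k j; last first.
  by rewrite inE eq_sym (negbTE kj) /= => js; apply: eq_bigr => t _; rewrite IH.
rewrite kj in ks *; move=> _.
transitivity (\big[addb/false]_(t < p)
  (gsum s (fun q => f (upd q j t.+1)) q (+) gsum s (fun q => f (upd q j t)) q)).
  apply: eq_bigr => t _; rewrite gsum_upd // gsumD; congr (_ (+) _).
  by apply: eq_gsum => q'; rewrite inc_upd_eq.
rewrite -(big_mkord predT (fun t => gsum s (fun q => f (upd q j t.+1)) q
   (+) gsum s (fun q => f (upd q j t)) q)).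
rewrite gsumD; elim: (p) => [|m IHm]; first by rewrite big_geq // addbb.
rewrite big_nat_recr //= IHm.
by case: (gsum _ _ _); case: (gsum _ _ _); case: (gsum _ _ _).
Qed.

Lemma gsum_witness s f q : uniq s -> gsum s f q ->
  exists2 q' : pt, (forall i, i \in s -> q' i < p) & f q'.
Proof.
elim: s q f => [|j s IH] q f /=; first by exists q.
case/andP=> js us H.
have [t Ht] : exists t : 'I_p, gsum s f (upd q j t).
  by apply/existsP; apply: contraTT H => /existsPn H; rewrite big1 // => t _; apply/negbTE.
move: Ht; rewrite gsum_upd // => /IH-/(_ us) [q' q'lt fq'].
exists (upd q' j t) => // i; rewrite inE !ffunE.
by case: eqP => //= _ /q'lt.
Qed.

(** Stokes' formula and induction on the dimension. Since the product of the remaining factors is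
    closed, the whole product is a coboundary, whose sum telescopes to the boundary of the grid. On
    the two faces of a direction other than [j] a label is constant and the product vanishes. On the
    faces of direction [j] the label is 0 and 1, so one copy of the lower-dimensional sum remains;
    in dimension 0 the sum is 1. *)
Lemma cup_stokes s q : uniq s -> 0 < p ->
  (forall i (q' : pt), q' i = 0 -> L i q' = false) ->
  (forall i (q' : pt), q' i = p -> L i q' = true) ->
  gsum s (fun q => cup L s q [set x in s]) q = true.
Proof.
move=> us p0 L0 Lp; elim: s q us => [//|j s IH] q us.
have /andP[js us'] := us.
set J := [set x in j :: s].
have Js : J :\ j = [set x in s].
  apply/setP=> x; rewrite !inE; case: eqP => [->|] //=.
  by rewrite (negbTE js).
pose H k q := L j q && cup L s q (J :\ k).
have -> : gsum (j :: s) (fun q => cup L (j :: s) q J) q =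
    gsum (j :: s) (fun q => \big[addb/false]_(k in J) (H k (inc q k) (+) H k q)) q.
  apply: eq_gsum => q'; rewrite /= big_split /=.
  have -> : \big[addb/false]_(k in J) H k q' =
      \big[addb/false]_(k in J) (L j q' && cup L s (inc q' k) (J :\ k)).
    by rewrite -!big_distrr /= -cup_closed.
  by rewrite -big_split /=; apply: eq_bigr => k _; rewrite -andb_addl.
rewrite gsum_sum (bigD1 j) /=; last by rewrite !inE eqxx.
have -> : \big[addb/false]_(k in J | k != j)
    gsum (j :: s) (fun q => H k (inc q k) (+) H k q) q = false.
  apply: big1 => k /andP[]; rewrite !inE => kjs kj.
  have ks : k \in s by rewrite (negbTE kj) in kjs.
  rewrite (gsum_telescope (H k)) //.
  rewrite (eq_gsum _ (g := fun=> false)).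
    elim: (rem _ _) (q) => //= a l IHl q'; exact: big1.
  move=> q'; rewrite /H.
  have kJ : k \notin J :\ k by rewrite !inE eqxx.
  rewrite (cup_const (k := k) (t := p) (b := true)) ?ffunE ?eqxx //; last by move=> ? /Lp.
  rewrite (cup_const (k := k) (t := 0) (b := false)) ?ffunE ?eqxx ?andbF //.
  by move=> ? /L0.
rewrite addbF -[RHS](IH (upd q j p)) // -/(gsum (j :: s) _ q) gsum_telescope ?inE ?eqxx //.
rewrite /= eqxx gsum_upd //; apply: eq_gsum => q'.
by rewrite /H Js Lp ?L0 ?ffunE ?eqxx // addbF.
Qed.

(** The number of cubes with nonzero product is odd, so there is one, and its corners carry both
    labels in every direction. *)
Lemma kuhn_cube : 0 < p ->
  (forall i (q' : pt), q' i = 0 -> L i q' = false) ->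
  (forall i (q' : pt), q' i = p -> L i q' = true) ->
  exists2 q : pt, (forall i, q i < p) &
  forall i, exists r r' : pt, [/\ forall k, q k <= r k <= (q k).+1,
    forall k, q k <= r' k <= (q k).+1, L i r & ~~ L i r'].
Proof.
move=> p0 L0 Lp.
have := cup_stokes [ffun=> 0] (enum_uniq 'I_n) p0 L0 Lp.
case/gsum_witness => [|q qlt Hq]; first exact: enum_uniq.
exists q => [i|i]; first by rewrite qlt ?mem_enum.
have [|r [r' [A B C D]]] := cup_corners Hq (i := i); first by rewrite mem_enum.
exists r, r'; split=> // k; [move: (A k)|move: (B k)]; case/andP=> -> /leq_trans -> //;
  by case: (_ \in _); rewrite ?addn1 ?addn0 ?leqnSn.
Qed.

End Kuhn.

Section KuhnNat.

Import all_boot.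
Local Open Scope nat_scope.

(** The same statement with points as functions on [nat], the interface to the analysis; coordinates
    beyond [n] are filled with 0. *)
Lemma kuhn_nat (n p : nat) (L : nat -> (nat -> nat) -> bool) :
  (0 < p)%coq_nat ->
  (forall i q, (i < n)%coq_nat -> q i = 0 -> L i q = false) ->
  (forall i q, (i < n)%coq_nat -> q i = p -> L i q = true) ->
  exists q : nat -> nat, (forall i, (i < n)%coq_nat -> (q i < p)%coq_nat) /\
  forall i, (i < n)%coq_nat -> exists r r' : nat -> nat,
    (forall k, (k < n)%coq_nat -> (q k <= r k)%coq_nat /\ (r k <= S (q k))%coq_nat) /\
    (forall k, (k < n)%coq_nat -> (q k <= r' k)%coq_nat /\ (r' k <= S (q k))%coq_nat) /\
    L i r = true /\ L i r' = false.
Proof.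
move=> /ltP p0 L0 Lp.
pose ext (q : pt n) (i : nat) := if insub i is Some j then q j else 0.
have extE q (i : 'I_n) : ext q i = q i by rewrite /ext valK.
have [i q' q0|i q' qp|q qlt Hq] :=
    @kuhn_cube n (fun i q => L i (ext q)) p p0.
- by apply: L0; [apply/ltP | rewrite extE].
- by apply: Lp; [apply/ltP | rewrite extE].
exists (ext q); split=> [i /ltP lin|i /ltP lin].
  by apply/ltP; rewrite -[i]/(val (Ordinal lin)) extE.
have [r [r' [A B C /negbTE D]]] := Hq (Ordinal lin).
exists (ext r), (ext r'); split=> [k /ltP lkn|]; last split=> [k /ltP lkn|//].
  by rewrite -[k]/(val (Ordinal lkn)) !extE; case/andP: (A (Ordinal lkn)) => /leP ? /leP ?.
by rewrite -[k]/(val (Ordinal lkn)) !extE; case/andP: (B (Ordinal lkn)) => /leP ? /leP ?.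
Qed.

End KuhnNat.

(** * Approximate fixed points of continuous maps of a cube *)

Section ApproxFixpoint.

Context (n : nat) (f : (nat -> R) -> nat -> R).

Definition in_box (v : nat -> R) := forall j, (j < n)%nat -> 0 <= v j <= 1.

(* Label the grid point [v] in direction [i] by whether [f] moves it downwards;
   a cell carrying both labels in every direction is almost fixed. *)
Lemma approx_fixpoint :
  (forall v, in_box v -> in_box (f v)) ->
  (forall eps, 0 < eps -> exists del, 0 < del /\ forall v v',
     in_box v -> in_box v' -> (forall j, (j < n)%nat -> Rabs (v j - v' j) <= del) ->
     forall i, (i < n)%nat -> Rabs (f v i - f v' i) <= eps) ->
  forall eps, 0 < eps -> exists v, in_box v /\
    forall i, (i < n)%nat -> Rabs (f v i - v i) <= eps.
Proof.
intros Hbox Hcont eps Heps.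
destruct (Hcont (eps / 2)) as [del [Hdel Hf]]; [lra|].
(* The mesh serves twice: [del] controls the variation of [f] over a cell, [eps / 2] that of the
   point itself. *)
set (del' := Rmin del (eps / 2)).
assert (Hdel' : 0 < del') by (unfold del'; apply Rmin_pos; lra).
destruct (nfloor_ex (/ del')) as [p0 [_ Hp0]].
{ left; apply Rinv_0_lt_compat; exact Hdel'. }
set (p := S p0).
assert (Hp : 0 < INR p) by (apply lt_0_INR; unfold p; lia).
assert (Hpd : / INR p <= del').
{ rewrite <- (Rinv_inv del'); apply Rinv_le_contravar.
  apply Rinv_0_lt_compat; lra. unfold p; rewrite S_INR; lra. }
set (g := fun (q : nat -> nat) j => Rmin 1 (INR (q j) / INR p)).
assert (Hg : forall q, in_box (g q)).
{ intros q j _; unfold g; split; [|apply Rmin_l].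
  apply Rmin_glb; [lra|]. apply Rdiv_le_0_compat; [apply pos_INR|exact Hp]. }
(* Coordinate 0 is labelled before any comparison, so that the boundary condition also holds where
   [f] fixes the face. *)
set (L := fun i q => match Nat.eq_dec (q i) 0 with
   | left _ => false
   | right _ => if Rle_dec (f (g q) i) (g q i) then true else false end).
destruct (kuhn_nat n p L) as [q [Hq Hc]].
- unfold p; lia.
- intros i q _ E; unfold L; destruct (Nat.eq_dec _ _); [reflexivity|lia].
- intros i q Hi E; unfold L; destruct (Nat.eq_dec _ _); [unfold p in *; lia|].
  destruct (Rle_dec _ _) as [_|N]; [reflexivity|exfalso; apply N].
  unfold g at 2; rewrite E.
  replace (INR p / INR p) with 1 by (field; lra).
  rewrite Rmin_left by lra. apply (Hbox _ (Hg q) i Hi).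
- assert (Hclose : forall r, (forall k, (k < n)%nat -> (q k <= r k)%nat /\ (r k <= S (q k))%nat) ->
    forall k, (k < n)%nat -> g q k <= g r k <= g q k + del').
  { intros r Hr k Hk; destruct (Hr k Hk) as [H1 H2]; specialize (Hq k Hk); unfold g.
    apply le_INR in H1; apply le_INR in H2; rewrite S_INR in H2.
    assert (INR (q k) / INR p <= INR (r k) / INR p)
      by (apply Rmult_le_compat_r; [left; apply Rinv_0_lt_compat|]; lra).
    assert (INR (r k) / INR p <= INR (q k) / INR p + / INR p).
    { apply Rle_trans with ((INR (q k) + 1) / INR p); [|right; field; lra].
      apply Rmult_le_compat_r; [left; apply Rinv_0_lt_compat|]; lra. }
    split.
    + apply Rle_min_compat_l; lra.
    + unfold Rmin; repeat destruct (Rle_dec _ _); lra. }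
  exists (g q); split; [apply Hg|]; intros i Hi.
  destruct (Hc i Hi) as [r [r' [Hr [Hr' [HL HL']]]]].
  assert (C1 := Hclose r Hr); assert (C2 := Hclose r' Hr').
  assert (del' <= del) by apply Rmin_l; assert (del' <= eps / 2) by apply Rmin_r.
  assert (F1 : Rabs (f (g q) i - f (g r) i) <= eps / 2).
  { apply Hf; auto. intros j Hj; specialize (C1 j Hj); apply Rabs_le; lra. }
  assert (F2 : Rabs (f (g q) i - f (g r') i) <= eps / 2).
  { apply Hf; auto. intros j Hj; specialize (C2 j Hj); apply Rabs_le; lra. }
  specialize (C1 i Hi); specialize (C2 i Hi).
  assert (U : f (g r) i <= g r i).
  { unfold L in HL; destruct (Nat.eq_dec _ _); [discriminate|].
    destruct (Rle_dec _ _); [assumption|discriminate]. }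
  assert (V : g r' i <= f (g r') i).
  { unfold L in HL'; destruct (Nat.eq_dec _ _) as [E|_].
    - unfold g at 1; rewrite E; simpl INR; unfold Rdiv; rewrite Rmult_0_l.
      rewrite Rmin_right by lra. apply (Hbox _ (Hg r') i Hi).
    - destruct (Rle_dec _ _); [discriminate|lra]. }
  apply Rabs_le_between in F1; apply Rabs_le_between in F2.
  apply Rabs_le; lra.
Qed.

End ApproxFixpoint.

(** * Limits along an ultrafilter *)

(** A free ultrafilter on [nat]: [uf_tail] makes its limits extend ordinary ones, and [uf_dec] makes
    every bounded sequence converge. *)
Record ultrafilter (U : (nat -> Prop) -> Prop) : Prop := {
  uf_mono : forall P Q : nat -> Prop, (forall n, P n -> Q n) -> U P -> U Q;
  uf_and : forall P Q, U P -> U Q -> U (fun n => P n /\ Q n);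
  uf_tail : forall N, U (fun n => (N <= n)%nat);
  uf_ex : forall P, U P -> exists n, P n;
  uf_dec : forall P, U P \/ U (fun n => ~ P n) }.

Section UltrafilterExists.

Import all_boot classical_sets filter.

Lemma ultrafilter_exists : exists U, ultrafilter U.
Proof.
pose F : set_system nat := fun P => exists N, forall n, (N <= n)%coq_nat -> P n.
have FP : ProperFilter F.
  split=> [[N] /(_ N (le_n N)) //|]; split.
  - by exists 0%N.
  - move=> P Q [N HN] [M HM]; exists (maxn N M) => n /leP; rewrite geq_max => /andP[/leP ? /leP ?].
    by split; [exact: HN|exact: HM].
  - by move=> P Q PQ [N HN]; exists N => n /HN /PQ.
have [U [UU FU]] := ultraFilterLemma FP.
exists U; split.
- by move=> P Q PQ; apply: filterS.
- by move=> P Q; apply: filterI.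
- by move=> N; apply: FU; exists N.
- by move=> P; exact: filter_ex.
- by move=> P; exact: in_ultra_setVsetC.
Qed.

End UltrafilterExists.

Lemma functional_choice_nat (A : Type) (P : nat -> A -> Prop) :
  (forall n, exists a, P n a) -> exists f, forall n, P n (f n).
Proof.
intros H; exists (fun n => proj1_sig (constructive_indefinite_description _ (H n))).
intros n; apply (proj2_sig (constructive_indefinite_description _ (H n))).
Qed.

Section Ulim.

Context (U : (nat -> Prop) -> Prop) (HU : ultrafilter U).

Lemma uf_all (P : nat -> Prop) : (forall n, P n) -> U P.
Proof.
intros HP; apply (uf_mono U HU (fun n => (0 <= n)%nat)); [auto|apply (uf_tail U HU)].
Qed.

Lemma uf_contra (P Q : nat -> Prop) : (forall n, P n -> ~ Q n) -> U P -> U Q -> False.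
Proof.
intros H HP HQ; destruct (uf_ex U HU _ (uf_and U HU _ _ HP HQ)) as [n [p q]].
exact (H n p q).
Qed.

Lemma uf_forall_lt (P : nat -> nat -> Prop) m :
  (forall i, (i < m)%nat -> U (P i)) -> U (fun n => forall i, (i < m)%nat -> P i n).
Proof.
induction m as [|m IH]; intros H.
- apply uf_all; intros; lia.
- apply (uf_mono U HU (fun n => (forall i, (i < m)%nat -> P i n) /\ P m n)).
  + intros n [H1 H2] i Hi; destruct (Nat.eq_dec i m) as [->|]; [exact H2|apply H1; lia].
  + apply (uf_and U HU); [apply IH; intros; apply H; lia|apply H; lia].
Qed.

Definition is_ulim (u : nat -> R) (l : R) :=
  forall eps, 0 < eps -> U (fun n => Rabs (u n - l) <= eps).

(** The limit is the supremum of the numbers that lie below [u n] for almost all [n]; [uf_dec] turns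
    the failure of a bound into the opposite bound for almost all [n]. *)
Lemma ulim_exists (u : nat -> R) (a b : R) :
  (forall n, a <= u n <= b) -> exists l, is_ulim u l.
Proof.
intros Hu.
destruct (completeness (fun x => U (fun n => x <= u n))) as [l [Hub Hlub]].
- exists b; intros x Hx; destruct (uf_ex U HU _ Hx) as [n Hn]; specialize (Hu n); lra.
- exists a; apply uf_all; intros n; apply Hu.
- exists l; intros eps Heps.
  assert (H1 : U (fun n => l - eps <= u n)).
  { destruct (uf_dec U HU (fun n => l - eps <= u n)) as [|N]; [assumption|exfalso].
    assert (l <= l - eps); [|lra].
    apply Hlub; intros x Hx; apply Rnot_lt_le; intros Hlt.
    apply (uf_contra _ _ (fun n p q => p (Rle_trans _ _ _ (Rlt_le _ _ Hlt) q)) N Hx). }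
  assert (H2 : U (fun n => u n <= l + eps)).
  { destruct (uf_dec U HU (fun n => u n <= l + eps)) as [|N]; [assumption|exfalso].
    assert (l + eps <= l); [|lra].
    apply Hub; apply (uf_mono U HU _ _ (fun n p => Rlt_le _ _ (Rnot_le_lt _ _ p)) N). }
  apply (uf_mono U HU _ _ (fun n p => proj2 (Rabs_le_between' _ _ _) p)
    (uf_and U HU _ _ H1 H2)).
Qed.

Lemma is_ulim_le (u v : nat -> R) a b :
  is_ulim u a -> is_ulim v b -> U (fun n => u n <= v n) -> a <= b.
Proof.
intros Hu Hv Huv; apply Rnot_lt_le; intros Hlt.
assert (H := uf_and U HU _ _ Huv (uf_and U HU _ _ (Hu ((a - b) / 3) ltac:(lra)) (Hv ((a - b) / 3) ltac:(lra)))).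
destruct (uf_ex U HU _ H) as [n [H1 [H2 H3]]].
apply Rabs_le_between in H2; apply Rabs_le_between in H3; lra.
Qed.

Lemma is_ulim_const a : is_ulim (fun _ => a) a.
Proof.
intros eps Heps; apply uf_all; intros _; rewrite Rminus_eq_0, Rabs_R0; lra.
Qed.

Lemma is_ulim_seq (u : nat -> R) l : is_lim_seq u (Finite l) -> is_ulim u l.
Proof.
intros H eps Heps.
apply is_lim_seq_spec in H; destruct (H (mkposreal eps Heps)) as [N HN].
apply (uf_mono U HU _ _ (fun n p => Rlt_le _ _ (HN n p)) (uf_tail U HU N)).
Qed.

Definition is_ulim_loc (f : nat -> R -> R) (g : R -> R) :=
  forall A eps, 0 < eps -> U (fun n => forall x, Rabs x <= A -> Rabs (f n x - g x) <= eps).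

Lemma is_ulim_loc_pt f g x : is_ulim_loc f g -> is_ulim (fun n => f n x) (g x).
Proof.
intros H eps Heps.
apply (uf_mono U HU _ _ (fun n p => p x (Rle_refl _)) (H (Rabs x) eps Heps)).
Qed.

Lemma grid_near (A h x : R) : 0 < h -> - A <= x <= A ->
  forall m : nat, 2 * A / h <= INR m ->
  exists i, (i < S m)%nat /\ 0 <= x - (- A + INR i * h) <= h.
Proof.
intros Hh Hx m Hm.
destruct (nfloor_ex ((x + A) / h)) as [i [H1 H2]].
{ apply Rdiv_le_0_compat; lra. }
assert (E : (x + A) / h * h = x + A) by (field; lra).
apply (Rmult_le_compat_r h) in H1; [|lra].
apply (Rmult_lt_compat_r h) in H2; [|lra].
exists i; split; [|lra].
apply INR_lt; apply Rle_lt_trans with ((x + A) / h).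
- apply Rmult_le_reg_r with h; lra.
- apply Rle_lt_trans with (2 * A / h); [|rewrite S_INR; lra].
  apply Rmult_le_compat_r; [left; apply Rinv_0_lt_compat|]; lra.
Qed.

(* An Arzela-Ascoli theorem; the limit along an ultrafilter spares the diagonal extraction. *)
Lemma equilip_ulim (f : nat -> R -> R) (a b L : R) :
  (forall n x, a <= f n x <= b) ->
  (forall n x y, Rabs (f n x - f n y) <= L * Rabs (x - y)) ->
  exists g, is_ulim_loc f g /\ (forall x, a <= g x <= b) /\
    forall x y, Rabs (g x - g y) <= L * Rabs (x - y).
Proof.
intros Hb HL.
assert (E : exists g, forall x, is_ulim (fun n => f n x) (g x)).
{ exists (fun x => epsilon (inhabits 0) (fun l => is_ulim (fun n => f n x) l)).
  intros x; apply epsilon_spec; apply (ulim_exists _ a b); intros n; apply Hb. }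
destruct E as [g Hg]; exists g.
assert (HL0 : 0 <= L).
{ specialize (HL O 0 1); replace (0 - 1) with (-(1)) in HL by ring.
  rewrite Rabs_Ropp, Rabs_R1 in HL; assert (H := Rabs_pos (f O 0 - f O 1)); lra. }
assert (HgL : forall x y, Rabs (g x - g y) <= L * Rabs (x - y)).
{ intros x y; apply Rnot_lt_le; intros Hlt.
  set (e := (Rabs (g x - g y) - L * Rabs (x - y)) / 3).
  assert (He : 0 < e) by (unfold e; lra).
  destruct (uf_ex U HU _ (uf_and U HU _ _ (Hg x e He) (Hg y e He))) as [n [H1 H2]].
  specialize (HL n x y).
  assert (Rabs (g x - g y) <= Rabs (f n x - g x) + Rabs (f n x - f n y) + Rabs (f n y - g y)).
  { replace (g x - g y) with (- (f n x - g x) + (f n x - f n y) + (f n y - g y)) by ring.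
    eapply Rle_trans; [apply Rabs_triang|].
    apply Rplus_le_compat_r; eapply Rle_trans; [apply Rabs_triang|].
    rewrite Rabs_Ropp; lra. }
  unfold e in *; lra. }
split; [|split; [|exact HgL]].
- intros A eps Heps.
  destruct (Rle_lt_dec A 0) as [HA|HA].
  { apply (uf_mono U HU (fun n => Rabs (f n 0 - g 0) <= eps)); [|apply Hg, Heps].
    intros n Hn x Hx; replace x with 0; [exact Hn|].
    assert (H := Rabs_pos x); destruct (Req_dec x 0) as [|N]; [auto|].
    apply Rabs_pos_lt in N; lra. }
  set (h := eps / (3 * (L + 1))).
  assert (Hh : 0 < h) by (apply Rdiv_lt_0_compat; lra).
  assert (HLh : L * h <= eps / 3).
  { unfold h; apply Rmult_le_reg_r with (3 * (L + 1)); [lra|].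
    replace (L * (eps / (3 * (L + 1))) * (3 * (L + 1))) with (L * eps) by (field; lra).
    nra. }
  destruct (nfloor_ex (2 * A / h)) as [m0 [_ Hm]]; [apply Rdiv_le_0_compat; lra|].
  (* An ultrafilter only admits finite intersections, so closeness is required on a grid of mesh
     [h]; the Lipschitz bounds of [f n] and [g] fill the gaps. *)
  apply (uf_mono U HU (fun n => forall i, (i < S (S m0))%nat ->
    Rabs (f n (- A + INR i * h) - g (- A + INR i * h)) <= eps / 3)).
  + intros n Hn x Hx; apply Rabs_le_between in Hx.
    destruct (grid_near A h x Hh Hx (S m0)) as [i [Hi Hxi]]; [rewrite S_INR; lra|].
    specialize (Hn i Hi); set (y := - A + INR i * h) in *.
    assert (H1 := HL n x y); assert (H2 := HgL x y).
    rewrite (Rabs_pos_eq (x - y)) in H1, H2 by lra.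
    assert (L * (x - y) <= L * h) by (apply Rmult_le_compat_l; lra).
    apply Rabs_le_between in H1; apply Rabs_le_between in H2; apply Rabs_le_between in Hn.
    apply Rabs_le; lra.
  + apply (uf_forall_lt (fun i n => Rabs (f n (- A + INR i * h) - g (- A + INR i * h)) <= eps / 3)).
    intros i _; apply Hg; lra.
- intros x; split.
  + apply (is_ulim_le (fun _ => a) (fun n => f n x)); [apply is_ulim_const|apply Hg|].
    apply uf_all; intros n; apply Hb.
  + apply (is_ulim_le (fun n => f n x) (fun _ => b)); [apply Hg|apply is_ulim_const|].
    apply uf_all; intros n; apply Hb.
Qed.

End Ulim.

(** * A Schauder fixed point theorem *)

Fixpoint lsum {A : Type} (l : list A) (f : A -> R) : R :=
  match l with nil => 0 | a :: l' => f a + lsum l' f end.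

Section Lsum.

Context {A : Type}.
Implicit Types (l : list A) (f g : A -> R).

Lemma lsum_ext l f g : (forall a, f a = g a) -> lsum l f = lsum l g.
Proof. intros H; induction l; simpl; [reflexivity|rewrite H, IHl; reflexivity]. Qed.

Lemma lsum_le l f g : (forall a, In a l -> f a <= g a) -> lsum l f <= lsum l g.
Proof.
induction l as [|a l IH]; simpl; intros H; [lra|].
apply Rplus_le_compat; [apply H; auto|apply IH; auto].
Qed.

Lemma lsum_zero l : lsum l (fun _ => 0) = 0.
Proof. induction l; simpl; [reflexivity|rewrite IHl; ring]. Qed.

Lemma lsum_nonneg l f : (forall a, In a l -> 0 <= f a) -> 0 <= lsum l f.
Proof. intros H; rewrite <- (lsum_zero l); apply lsum_le; exact H. Qed.

Lemma lsum_plus l f g : lsum l (fun a => f a + g a) = lsum l f + lsum l g.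
Proof. induction l; simpl; [ring|rewrite IHl; ring]. Qed.

Lemma lsum_scal l c f : lsum l (fun a => c * f a) = c * lsum l f.
Proof. induction l; simpl; [ring|rewrite IHl; ring]. Qed.

Lemma lsum_minus l f g : lsum l (fun a => f a - g a) = lsum l f - lsum l g.
Proof. induction l; simpl; [ring|rewrite IHl; ring]. Qed.

Lemma lsum_abs l f : Rabs (lsum l f) <= lsum l (fun a => Rabs (f a)).
Proof.
induction l; simpl; [rewrite Rabs_R0; lra|].
eapply Rle_trans; [apply Rabs_triang|lra].
Qed.

Lemma lsum_mem_le l f a : (forall a, In a l -> 0 <= f a) -> In a l -> f a <= lsum l f.
Proof.
induction l as [|b l IH]; simpl; [tauto|]; intros H [->|Ha].
- assert (H0 : 0 <= lsum l f) by (apply lsum_nonneg; auto); lra.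
- assert (H0 : 0 <= f b) by auto; assert (f a <= lsum l f) by auto; lra.
Qed.

Lemma lsum_continuous l (f : A -> R -> R) x :
  (forall a, In a l -> continuous (f a) x) -> continuous (fun x => lsum l (fun a => f a x)) x.
Proof.
induction l as [|a l IH]; simpl; intros H; [apply continuous_const|].
apply (continuous_plus (f a) (fun x => lsum l (fun a => f a x))); auto.
Qed.

Lemma lsum_derive l (f : A -> R -> R) (f' : A -> R) x :
  (forall a, In a l -> is_derive (f a) x (f' a)) ->
  is_derive (fun x => lsum l (fun a => f a x)) x (lsum l f').
Proof.
induction l as [|a l IH]; simpl; intros H; [apply (is_derive_const (V := R_NormedModule))|].
apply (is_derive_plus (f a) (fun x => lsum l (fun a => f a x))); auto.
Qed.

End Lsum.

Lemma continuous_Rabs_comp (f : R -> R) x : continuous f x -> continuous (fun x => Rabs (f x)) x.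
Proof. intros H; apply (continuous_comp f Rabs); [exact H|apply continuous_Rabs]. Qed.

Lemma continuous_Rmax (f g : R -> R) x : continuous f x -> continuous g x ->
  continuous (fun x => Rmax (f x) (g x)) x.
Proof.
intros Hf Hg.
assert (E : forall y : R, (f y + g y + Rabs (f y - g y)) * / 2 = Rmax (f y) (g y)).
{ intros y; unfold Rmax; destruct (Rle_dec _ _);
  [rewrite Rabs_left1 by lra|rewrite Rabs_pos_eq by lra]; field. }
apply (continuous_ext _ _ _ E).
apply (continuous_mult (fun x => f x + g x + Rabs (f x - g x)) (fun _ => / 2));
  [|apply continuous_const].
apply (continuous_plus (fun x => f x + g x) (fun x => Rabs (f x - g x)));
  [apply (continuous_plus f g); assumption|].
apply continuous_Rabs_comp; apply (continuous_minus f g); assumption.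
Qed.

Lemma continuous_Rmin (f g : R -> R) x : continuous f x -> continuous g x ->
  continuous (fun x => Rmin (f x) (g x)) x.
Proof.
intros Hf Hg.
apply (continuous_ext (fun x => - Rmax (- f x) (- g x))).
{ intros y; rewrite <- Ropp_Rmin, Ropp_involutive; reflexivity. }
apply (continuous_opp (V := R_NormedModule) (fun x => Rmax (- f x) (- g x))).
apply (continuous_Rmax (fun x => - f x) (fun x => - g x)).
- apply (continuous_opp (V := R_NormedModule) f), Hf.
- apply (continuous_opp (V := R_NormedModule) g), Hg.
Qed.

Lemma continuous_Rdiv (f g : R -> R) x : continuous f x -> continuous g x -> g x <> 0 ->
  continuous (fun x => f x / g x) x.
Proof.
intros Hf Hg H0; apply (continuous_mult f (fun x => / g x)); [exact Hf|].
apply (continuous_comp g Rinv); [exact Hg|apply continuous_Rinv; exact H0].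
Qed.

Definition clip (b x : R) := Rmin b (Rmax 0 x).

Lemma clip_bounds b x : 0 <= b -> 0 <= clip b x <= b.
Proof. intros Hb; unfold clip, Rmin, Rmax; repeat destruct (Rle_dec _ _); lra. Qed.

Lemma clip_id b x : 0 <= x <= b -> clip b x = x.
Proof. intros Hb; unfold clip, Rmin, Rmax; repeat destruct (Rle_dec _ _); lra. Qed.

Lemma clip_lip b x y : Rabs (clip b x - clip b y) <= Rabs (x - y).
Proof.
unfold clip, Rmin, Rmax; repeat destruct (Rle_dec _ _); unfold Rabs;
repeat destruct (Rcase_abs _); lra.
Qed.

Lemma Rabs_bound_0 e : (forall eps, 0 < eps -> e <= eps) -> e <= 0.
Proof.
intros H; apply Rnot_lt_le; intros He; specialize (H (e / 2) ltac:(lra)); lra.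
Qed.

Lemma Rdiv_minus_l a b c : a / c - b / c = (a - b) / c.
Proof. unfold Rdiv; ring. Qed.

Section Schauder.

Context (Bd L : R) (b : R -> R) (T : (R -> R) -> R -> R).
Context (HBd : 0 < Bd) (HL : 0 <= L).
Context (Hb : forall x, 0 <= b x <= Bd) (Hbc : forall x, continuous b x).

(** The convex set on which [T] acts. The Lipschitz bound is asked of the images under [T] instead,
    so that the grid interpolants below belong to the set. *)
Definition below_cont (phi : R -> R) :=
  (forall x, continuous phi x) /\ forall x, 0 <= phi x <= b x.

Context (HTb : forall phi, below_cont phi -> forall x, 0 <= T phi x <= b x).
Context (HTL : forall phi, below_cont phi ->
  forall x y, Rabs (T phi x - T phi y) <= L * Rabs (x - y)).
Context (HTc : forall X eps, 0 < eps -> exists A del, 0 < del /\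
  forall phi phi', below_cont phi -> below_cont phi' ->
  (forall y, Rabs y <= A -> Rabs (phi y - phi' y) <= del) ->
  forall x, Rabs x <= X -> Rabs (T phi x - T phi' x) <= eps).

Lemma lip_continuous (f : R -> R) K : (forall x y, Rabs (f x - f y) <= K * Rabs (x - y)) ->
  forall x, continuous f x.
Proof.
intros H x; apply continuity_pt_filterlim, continuity_pt_locally; intros eps.
assert (HK : 0 < Rabs K + 1) by (assert (Hk := Rabs_pos K); lra).
assert (Hd : 0 < eps / (Rabs K + 1)) by (apply Rdiv_lt_0_compat; [apply cond_pos|lra]).
exists (mkposreal _ Hd); intros y Hy; unfold ball in Hy; simpl in Hy.
unfold AbsRing_ball, abs, minus, plus, opp in Hy; simpl in Hy.
apply Rle_lt_trans with (1 := H y x).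
assert (H1 := Rle_abs K); assert (H2 := Rabs_pos (y - x)); unfold Rminus in *.
apply Rle_lt_trans with (Rabs K * Rabs (y + - x)); [nra|].
apply Rle_lt_trans with ((Rabs K + 1) * Rabs (y + - x)); [nra|].
apply Rlt_le_trans with ((Rabs K + 1) * (eps / (Rabs K + 1))); [nra|right; field; lra].
Qed.

Lemma below_T phi : below_cont phi -> below_cont (T phi).
Proof.
intros H; split; [apply (lip_continuous _ L), HTL, H|apply HTb, H].
Qed.

Section Grid.

Context (A h : R) (m : nat) (Hh : 0 < h) (Hm : 2 * A / h <= INR m).

Definition node (i : nat) : R := - A + INR i * h.
Definition hat (i : nat) (y : R) : R := Rmax 0 (2 * h - Rabs (y - node i)).
(** Interpolation of the values [Bd * v i] at the nodes by a partition of unity, cut at [b]. On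
    [[-A, A]] the hats sum to at least [h]; elsewhere [Rmax h] keeps the denominator away from 0. *)
Definition interp (v : nat -> R) (y : R) : R :=
  clip (b y) (lsum (seq 0 (S m)) (fun i => Bd * v i * hat i y)
              / Rmax h (lsum (seq 0 (S m)) (fun i => hat i y))).

Lemma hat_nonneg i y : 0 <= hat i y.
Proof. apply Rmax_l. Qed.

Lemma hat_continuous i y : continuous (hat i) y.
Proof.
apply (continuous_Rmax (fun _ => 0) (fun y => 2 * h - Rabs (y - node i)));
  [apply continuous_const|].
apply (continuous_minus (fun _ => 2 * h) (fun y => Rabs (y - node i)));
  [apply continuous_const|].
apply continuous_Rabs_comp.
apply (continuous_minus (fun y => y) (fun _ => node i));
  [apply continuous_id|apply continuous_const].
Qed.

Lemma interp_below v : below_cont (interp v).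
Proof.
split; [|intros x; apply clip_bounds; apply Hb].
intros x; apply (continuous_Rmin b); [apply Hbc|].
apply (continuous_Rmax (fun _ => 0)); [apply continuous_const|].
apply continuous_Rdiv.
- apply (lsum_continuous _ (fun i y => Bd * v i * hat i y)).
  intros i _; apply (continuous_mult (fun _ => Bd * v i) (hat i));
    [apply continuous_const|apply hat_continuous].
- apply (continuous_Rmax (fun _ => h)); [apply continuous_const|].
  apply lsum_continuous; intros; apply hat_continuous.
- assert (H := Rmax_l h (lsum (seq 0 (S m)) (fun i => hat i x))); lra.
Qed.

Lemma interp_lip v v' e : 0 <= e ->
  (forall j, (j < S m)%nat -> Rabs (v j - v' j) <= e) ->
  forall y, Rabs (interp v y - interp v' y) <= Bd * e.
Proof.
intros He H y; unfold interp; eapply Rle_trans; [apply clip_lip|].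
set (s := lsum (seq 0 (S m)) (fun i => hat i y)).
assert (Hs : 0 < Rmax h s) by (assert (X := Rmax_l h s); lra).
rewrite Rdiv_minus_l, <- lsum_minus.
unfold Rdiv; rewrite Rabs_mult, (Rabs_pos_eq (/ Rmax h s))
  by (left; apply Rinv_0_lt_compat; exact Hs).
apply Rmult_le_reg_r with (Rmax h s); [exact Hs|].
rewrite Rmult_assoc, Rinv_l, Rmult_1_r by lra.
apply Rle_trans with (Bd * e * s); [|apply Rmult_le_compat_l; [nra|apply Rmax_r]].
eapply Rle_trans; [apply lsum_abs|].
unfold s; rewrite <- lsum_scal; apply lsum_le; intros i Hi; apply in_seq in Hi.
replace (Bd * v i * hat i y - Bd * v' i * hat i y)
  with (Bd * (v i - v' i) * hat i y) by ring.
rewrite !Rabs_mult, (Rabs_pos_eq Bd), (Rabs_pos_eq (hat i y)) by (try apply hat_nonneg; lra).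
apply Rmult_le_compat_r; [apply hat_nonneg|].
apply Rmult_le_compat_l; [lra|apply H; lia].
Qed.

(** Clipping does not increase the distance to [phi], which already lies between 0 and [b]. Before
    clipping the value is an average over nodes at distance less than [2 * h]. *)
Lemma interp_approx v phi e : 0 <= e -> below_cont phi ->
  (forall x y, Rabs (phi x - phi y) <= L * Rabs (x - y)) ->
  (forall i, (i < S m)%nat -> Rabs (phi (node i) - Bd * v i) <= e) ->
  forall y, Rabs y <= A -> Rabs (interp v y - phi y) <= e + L * (2 * h).
Proof.
intros He Hphi HphiL Hv y Hy; unfold interp.
rewrite <- (clip_id (b y) (phi y)) at 1 by apply Hphi.
eapply Rle_trans; [apply clip_lip|].
set (s := lsum (seq 0 (S m)) (fun i => hat i y)).
assert (Hs : h <= s).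
{ apply Rabs_le_between in Hy.
  destruct (grid_near A h y Hh Hy m Hm) as [i [Hi Hyi]].
  apply Rle_trans with (hat i y).
  - unfold hat, node; rewrite Rabs_pos_eq by lra; eapply Rle_trans; [|apply Rmax_r]; lra.
  - unfold s; apply (lsum_mem_le _ (fun i => hat i y)); [intros; apply hat_nonneg|].
    apply in_seq; lia. }
rewrite Rmax_right by exact Hs.
replace (lsum (seq 0 (S m)) (fun i => Bd * v i * hat i y) / s - phi y)
  with ((lsum (seq 0 (S m)) (fun i => Bd * v i * hat i y) - phi y * s) / s) by (field; lra).
unfold s at 1; rewrite <- lsum_scal, <- lsum_minus.
unfold Rdiv; rewrite Rabs_mult, (Rabs_pos_eq (/ s)) by (left; apply Rinv_0_lt_compat; lra).
apply Rmult_le_reg_r with s; [lra|].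
rewrite Rmult_assoc, Rinv_l, Rmult_1_r by lra.
eapply Rle_trans; [apply lsum_abs|].
unfold s; rewrite <- lsum_scal; apply lsum_le; intros i Hi; apply in_seq in Hi.
replace (Bd * v i * hat i y - phi y * hat i y) with ((Bd * v i - phi y) * hat i y) by ring.
rewrite Rabs_mult, (Rabs_pos_eq (hat i y)) by apply hat_nonneg.
destruct (Rle_lt_dec (2 * h) (Rabs (y - node i))) as [Hf|Hf].
{ unfold hat; rewrite Rmax_left by lra; lra. }
apply Rmult_le_compat_r; [apply hat_nonneg|].
specialize (Hv i ltac:(lia)); assert (H1 := HphiL (node i) y).
rewrite Rabs_minus_sym in Hf.
assert (L * Rabs (node i - y) <= L * (2 * h)) by (apply Rmult_le_compat_l; lra).
apply Rabs_le_between in Hv; apply Rabs_le_between in H1; apply Rabs_le; lra.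
Qed.

End Grid.

(** The cube is that of the node values, and [v] is sent to the values of [T (interp v)]. From an
    almost fixed [v] the function returned is [T (interp v)] rather than [interp v], since it has
    the Lipschitz bound; it is close to [interp v] on [[-A, A]], so [T] almost fixes it. *)
Lemma approx_fixed_function X eps : 0 < eps -> exists phi, below_cont phi /\
  (forall x y, Rabs (phi x - phi y) <= L * Rabs (x - y)) /\
  forall x, Rabs x <= X -> Rabs (T phi x - phi x) <= eps.
Proof.
intros Heps.
destruct (HTc X eps Heps) as [A0 [del [Hdel Hcl]]].
set (A := Rmax A0 1).
assert (HA : 0 < A) by (unfold A; assert (H := Rmax_r A0 1); lra).
set (h := del / (4 * (L + 1))).
assert (Hh : 0 < h) by (apply Rdiv_lt_0_compat; lra).
assert (HLh : L * (2 * h) <= del / 2).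
{ unfold h; apply Rmult_le_reg_r with (4 * (L + 1)); [lra|].
  replace (L * (2 * (del / (4 * (L + 1)))) * (4 * (L + 1))) with (2 * L * del) by (field; lra).
  nra. }
destruct (nfloor_ex (2 * A / h)) as [m0 [_ Hm]]; [apply Rdiv_le_0_compat; lra|].
assert (Hm' : 2 * A / h <= INR (S m0)) by (rewrite S_INR; lra).
set (m := S m0) in *.
destruct (approx_fixpoint (S m) (fun v i => T (interp A h m v) (node A h i) / Bd))
  with (eps := del / (2 * Bd)) as [v [Hv1 Hv2]].
- intros v Hv j Hj.
  assert (H := HTb _ (interp_below A h m Hh v) (node A h j)); specialize (Hb (node A h j)).
  split; [apply Rdiv_le_0_compat; lra|].
  apply Rmult_le_reg_r with Bd; [lra|]; unfold Rdiv; rewrite Rmult_assoc, Rinv_l; lra.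
- intros e He.
  destruct (HTc (A + INR (S m) * h) (e * Bd)) as [A' [d' [Hd' Hc']]]; [nra|].
  exists (d' / Bd); split; [apply Rdiv_lt_0_compat; lra|].
  intros v v' _ _ Hvv i Hi.
  rewrite Rdiv_minus_l; unfold Rdiv; rewrite Rabs_mult, (Rabs_pos_eq (/ Bd))
    by (left; apply Rinv_0_lt_compat; lra).
  apply Rmult_le_reg_r with Bd; [lra|]; rewrite Rmult_assoc, Rinv_l, Rmult_1_r by lra.
  apply Hc'; try apply interp_below; try assumption.
  + intros y _; eapply Rle_trans; [apply (interp_lip A h m Hh v v' (d' / Bd)); auto|].
    * apply Rdiv_le_0_compat; lra.
    * right; field; lra.
  + unfold node; apply Rabs_le.
    assert (0 <= INR i) by apply pos_INR; assert (INR i <= INR (S m)) by (apply le_INR; lia).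
    split; nra.
- apply Rdiv_lt_0_compat; lra.
- set (phi := T (interp A h m v)).
  assert (HK : below_cont (interp A h m v)) by (apply interp_below; exact Hh).
  assert (HphiL : forall x y, Rabs (phi x - phi y) <= L * Rabs (x - y)) by (apply HTL, HK).
  exists phi; split; [apply below_T, HK|split; [exact HphiL|]].
  intros x Hx; unfold phi at 2; apply Hcl; [apply below_T, HK|exact HK| |exact Hx].
  intros y Hy; rewrite Rabs_minus_sym.
  eapply Rle_trans; [apply (interp_approx A h m Hh Hm' v phi (del / 2))|]; try lra.
  + apply below_T, HK.
  + exact HphiL.
  + intros i Hi; specialize (Hv2 i Hi); cbv beta in Hv2; fold phi in Hv2.
    replace (phi (node A h i) - Bd * v i)
      with (Bd * (phi (node A h i) / Bd - v i)) by (field; lra).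
    rewrite Rabs_mult, (Rabs_pos_eq Bd) by lra.
    apply Rle_trans with (Bd * (del / (2 * Bd))); [apply Rmult_le_compat_l; lra|].
    right; field; lra.
  + apply Rle_trans with A; [|lra]; apply Rle_trans with A0; [exact Hy|apply Rmax_l].
Qed.

(** Almost fixed functions on the intervals [[-n, n]] share the Lipschitz constant [L], so they have
    a locally uniform limit; the continuity of [T] makes it a fixed point. *)
Lemma schauder_fixpoint : exists phi, below_cont phi /\ forall x, T phi x = phi x.
Proof.
destruct ultrafilter_exists as [U HU].
destruct (functional_choice_nat _ (fun n phi => below_cont phi /\
  (forall x y, Rabs (phi x - phi y) <= L * Rabs (x - y)) /\
  forall x, Rabs x <= INR n -> Rabs (T phi x - phi x) <= / (INR n + 1))) as [f Hf].
{ intros n; apply approx_fixed_function, Rinv_0_lt_compat; assert (H := pos_INR n); lra. }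
destruct (equilip_ulim U HU f 0 Bd L) as [phi [Hlim [_ HphiL]]].
{ intros n x; destruct (Hf n) as [[_ H] _]; specialize (H x); specialize (Hb x); lra. }
{ intros n; apply (Hf n). }
assert (HK : below_cont phi).
{ split; [apply (lip_continuous _ L), HphiL|]; intros x; split.
  - apply (is_ulim_le U HU (fun _ => 0) (fun n => f n x)).
    + apply is_ulim_const, HU.
    + apply is_ulim_loc_pt; assumption.
    + apply uf_all; [exact HU|]; intros n; apply (Hf n).
  - apply (is_ulim_le U HU (fun n => f n x) (fun _ => b x)).
    + apply is_ulim_loc_pt; assumption.
    + apply is_ulim_const, HU.
    + apply uf_all; [exact HU|]; intros n; apply (Hf n). }
exists phi; split; [exact HK|]; intros x.
apply Rminus_diag_uniq, Rabs_eq_0, Rle_antisym; [|apply Rabs_pos].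
apply Rabs_bound_0; intros eps Heps.
destruct (HTc (Rabs x) (eps / 3)) as [A [del [Hdel Hcl]]]; [lra|].
destruct (nfloor_ex (Rmax (Rabs x) (3 / eps))) as [N [_ HN]].
{ eapply Rle_trans; [apply Rabs_pos|apply Rmax_l]. }
destruct (uf_ex U HU _ (uf_and U HU _ _ (uf_tail U HU (S N))
  (uf_and U HU _ _ (Hlim A del Hdel) (Hlim (Rabs x) (eps / 3) ltac:(lra)))))
  as [n [H1 [H2 H3]]].
destruct (Hf n) as [K1 [_ K3]].
apply le_INR in H1; rewrite S_INR in H1.
assert (M1 := Rmax_l (Rabs x) (3 / eps)); assert (M2 := Rmax_r (Rabs x) (3 / eps)).
assert (E1 := K3 x ltac:(lra)).
assert (E2 := Hcl _ _ K1 HK H2 x (Rle_refl _)).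
assert (E3 := H3 x (Rle_refl _)).
assert (E4 : / (INR n + 1) <= eps / 3).
{ replace (eps / 3) with (/ (3 / eps)) by (field; lra).
  apply Rinv_le_contravar; [apply Rdiv_lt_0_compat|]; lra. }
apply Rabs_le_between in E1; apply Rabs_le_between in E2; apply Rabs_le_between in E3.
apply Rabs_le; lra.
Qed.

End Schauder.

(** * Sums over the integers *)

(** The integers from [- N - 1] to [N], so that both halves of [is_sumZ] contribute the same number
    of terms. *)
Fixpoint zl (N : nat) : list Z :=
  match N with
  | O => (0 :: -1 :: nil)%Z
  | S n => (Z.of_nat (S n) :: (- Z.of_nat (S n) - 1) :: zl n)%Z
  end.

Lemma zl_bound N k : In k (zl N) -> Rabs (IZR k) <= INR N + 1.
Proof.
revert k; induction N as [|N IH]; intros k.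
- simpl; intros [<-|[<-|[]]]; apply Rabs_le; simpl; lra.
- rewrite S_INR; intros [<-|[<-|H]].
  + rewrite <- INR_IZR_INZ, S_INR, Rabs_pos_eq; [lra|].
    assert (X := pos_INR N); lra.
  + rewrite minus_IZR, opp_IZR, <- INR_IZR_INZ, S_INR.
    assert (X := pos_INR N); apply Rabs_le; lra.
  + apply IH in H; lra.
Qed.

Lemma lsum_zl N f : lsum (zl N) f =
  sum_n (fun n => f (Z.of_nat n)) N + sum_n (fun n => f (- Z.of_nat n - 1)%Z) N.
Proof.
induction N as [|N IH].
- simpl; rewrite !sum_O; simpl; ring.
- rewrite !sum_Sn; unfold plus; cbn [zl lsum AbelianMonoid.plus]; rewrite IH; simpl; ring.
Qed.

Lemma is_sumZ_lim f l : is_sumZ f l -> is_lim_seq (fun N => lsum (zl N) f) (Finite l).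
Proof.
intros [l1 [l2 [H1 [H2 ->]]]].
apply (is_lim_seq_ext (fun N => sum_n (fun n => f (Z.of_nat n)) N
  + sum_n (fun n => f (- Z.of_nat n - 1)%Z) N)).
{ intros n; symmetry; apply lsum_zl. }
apply (is_lim_seq_plus' _ _ l1 l2); [exact H1|exact H2].
Qed.

Lemma is_sumZ_unique f l l' : is_sumZ f l -> is_sumZ f l' -> l = l'.
Proof.
intros H H'; apply is_sumZ_lim in H; apply is_sumZ_lim in H'.
assert (E := is_lim_seq_unique _ _ H); rewrite (is_lim_seq_unique _ _ H') in E.
injection E; auto.
Qed.

Lemma is_sumZ_SeriesZ f l : is_sumZ f l -> SeriesZ f = l.
Proof.
intros [l1 [l2 [H1 [H2 ->]]]]; unfold SeriesZ.
rewrite (is_series_unique _ _ H1), (is_series_unique _ _ H2); reflexivity.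
Qed.

Lemma is_sumZ_ext f g l : (forall k, f k = g k) -> is_sumZ f l -> is_sumZ g l.
Proof.
intros E [l1 [l2 [H1 [H2 ->]]]]; exists l1, l2; split; [|split; [|reflexivity]].
- apply (is_series_ext (fun n => f (Z.of_nat n))); [intros; apply E|exact H1].
- apply (is_series_ext (fun n => f (- Z.of_nat n - 1)%Z)); [intros; apply E|exact H2].
Qed.

Lemma is_sumZ_minus f g l l' : is_sumZ f l -> is_sumZ g l' ->
  is_sumZ (fun k => f k - g k) (l - l').
Proof.
intros [l1 [l2 [H1 [H2 ->]]]] [l1' [l2' [H1' [H2' ->]]]].
exists (l1 - l1'), (l2 - l2'); split; [|split; [|ring]].
- apply (is_series_minus (V := R_NormedModule) _ _ _ _ H1 H1').
- apply (is_series_minus (V := R_NormedModule) _ _ _ _ H2 H2').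
Qed.

Lemma is_sumZ_scal f l c : is_sumZ f l -> is_sumZ (fun k => c * f k) (c * l).
Proof.
intros [l1 [l2 [H1 [H2 ->]]]].
exists (c * l1), (c * l2); split; [|split; [|ring]].
- apply (is_series_scal (V := R_NormedModule) c _ _ H1).
- apply (is_series_scal (V := R_NormedModule) c _ _ H2).
Qed.

Lemma is_sumZ_flip f l : is_sumZ f l -> is_sumZ (fun k => f (- k - 1)%Z) l.
Proof.
intros [l1 [l2 [H1 [H2 ->]]]]; exists l2, l1; split; [exact H2|split; [|ring]].
apply (is_series_ext (fun n => f (Z.of_nat n))); [|exact H1].
intros n; f_equal; lia.
Qed.

Lemma Rplus_minus_r_r (a b : R) : a - b + b = a.
Proof. ring. Qed.

Lemma is_sumZ_shift1 f l : is_sumZ f l -> is_sumZ (fun k => f (k + 1)%Z) l.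
Proof.
intros [l1 [l2 [H1 [H2 ->]]]]; exists (l1 - f 0%Z), (f 0%Z + l2).
split; [|split; [|ring]].
- apply (is_series_ext (fun n => f (Z.of_nat (S n)))); [intros; f_equal; lia|].
  apply (is_series_incr_1 (fun n => f (Z.of_nat n))).
  replace (plus _ _) with l1; [exact H1|symmetry; apply Rplus_minus_r_r].
- apply (is_series_ext (fun n => f (- Z.of_nat n)%Z)); [intros; f_equal; lia|].
  apply is_series_decr_1.
  replace (plus _ _) with l2; [|symmetry; apply Rplus_minus_l].
  apply (is_series_ext (fun n => f (- Z.of_nat n - 1)%Z)); [intros; f_equal; lia|exact H2].
Qed.

Lemma is_sumZ_shift_nat f l (n : nat) : is_sumZ f l -> is_sumZ (fun k => f (k + Z.of_nat n)%Z) l.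
Proof.
intros H; induction n as [|n IH].
- apply (is_sumZ_ext f); [intros; f_equal; lia|exact H].
- apply is_sumZ_shift1 in IH; revert IH; apply is_sumZ_ext; intros k; f_equal; lia.
Qed.

(** As [j - k = (- k - 1) + (j + 1)], the reflection is a flip, which exchanges the two halves,
    composed with a shift; the sign of [j + 1] decides which comes first. *)
Lemma is_sumZ_reflect f l j : is_sumZ f l -> is_sumZ (fun k => f (j - k)%Z) l.
Proof.
intros H.
destruct (Z_le_gt_dec 0 (j + 1)) as [Hj|Hj].
- apply (is_sumZ_shift_nat _ _ (Z.to_nat (j + 1))), is_sumZ_flip in H.
  revert H; apply is_sumZ_ext; intros k; f_equal; lia.
- apply is_sumZ_flip, (is_sumZ_shift_nat _ _ (Z.to_nat (- j - 1))) in H.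
  revert H; apply is_sumZ_ext; intros k; f_equal; lia.
Qed.

Lemma sum_n_incr (a : nat -> R) n m : (forall k, 0 <= a k) -> (n <= m)%nat ->
  sum_n a n <= sum_n a m.
Proof.
intros Ha Hnm; induction Hnm as [|m _ IH]; [lra|].
rewrite sum_Sn; unfold plus; simpl; specialize (Ha (S m)); lra.
Qed.

Lemma lsum_zl_incr f n m : (forall k, 0 <= f k) -> (n <= m)%nat ->
  lsum (zl n) f <= lsum (zl m) f.
Proof.
intros Hf Hnm; rewrite !lsum_zl; apply Rplus_le_compat; apply sum_n_incr; auto.
Qed.

Lemma lsum_zl_le_sum f l N : (forall k, 0 <= f k) -> is_sumZ f l -> lsum (zl N) f <= l.
Proof.
intros Hf H; apply is_sumZ_lim in H.
assert (X := is_lim_seq_le_loc (fun _ => lsum (zl N) f) (fun n => lsum (zl n) f)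
  (Finite (lsum (zl N) f)) (Finite l)); simpl in X; apply X; [|apply is_lim_seq_const|exact H].
exists N; intros n Hn; apply lsum_zl_incr; assumption.
Qed.

Lemma lsum_zl_near_sum f l eps : is_sumZ f l -> 0 < eps ->
  exists N0, forall N, (N0 <= N)%nat -> l - eps < lsum (zl N) f.
Proof.
intros H Heps; apply is_sumZ_lim, is_lim_seq_spec in H.
destruct (H (mkposreal eps Heps)) as [N0 HN]; exists N0; intros N HNN.
specialize (HN N HNN); apply Rabs_lt_between in HN; simpl in HN; lra.
Qed.

(** The upper bound is the lower bound by partial sums applied to the nonnegative terms
    [C * beta k - f k]. *)
Lemma is_sumZ_dominated beta f C : is_sumZ beta 1 -> (forall k, 0 <= f k <= C * beta k) ->
  exists s, is_sumZ f s /\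
  forall N, lsum (zl N) f <= s <= lsum (zl N) f + C * (1 - lsum (zl N) beta).
Proof.
intros Hb Hf.
assert (Hs : ex_sumZ f).
{ destruct Hb as [l1 [l2 [H1 [H2 _]]]].
  destruct (ex_series_le (V := R_CompleteNormedModule) (fun n => f (Z.of_nat n)) (fun n => C * beta (Z.of_nat n))) as [s1 E1].
  { intros n; unfold norm; simpl; unfold abs; simpl; rewrite Rabs_pos_eq; apply Hf. }
  { exists (C * l1); apply (is_series_scal (V := R_NormedModule) C _ _ H1). }
  destruct (ex_series_le (V := R_CompleteNormedModule) (fun n => f (- Z.of_nat n - 1)%Z)
     (fun n => C * beta (- Z.of_nat n - 1)%Z)) as [s2 E2].
  { intros n; unfold norm; simpl; unfold abs; simpl; rewrite Rabs_pos_eq; apply Hf. }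
  { exists (C * l2); apply (is_series_scal (V := R_NormedModule) C _ _ H2). }
  exists (s1 + s2), s1, s2; auto. }
destruct Hs as [s Hs]; exists s; split; [exact Hs|]; intros N; split.
- apply lsum_zl_le_sum; [intros; apply Hf|exact Hs].
- assert (H := lsum_zl_le_sum (fun k => C * beta k - f k) (C * 1 - s) N).
  rewrite lsum_minus, lsum_scal in H.
  assert (X : C * lsum (zl N) beta - lsum (zl N) f <= C * 1 - s); [|lra].
  apply H; [intros k; specialize (Hf k); lra|].
  apply is_sumZ_minus; [apply is_sumZ_scal, Hb|exact Hs].
Qed.

(** * Mean value estimates and primitives *)

Lemma is_derive_continuous (f : R -> R) x l : is_derive f x l -> continuous f x.
Proof.
intros H; apply (ex_derive_continuous (K := R_AbsRing) (V := R_NormedModule) f); exists l; exact H.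
Qed.

Lemma incr_bound (f f' : R -> R) a b m : a <= b ->
  (forall x, a <= x <= b -> is_derive f x (f' x)) ->
  (forall x, a <= x <= b -> m <= f' x) -> m * (b - a) <= f b - f a.
Proof.
intros Hab Hf Hm.
destruct (MVT_gen f a b f') as [x [Hx E]]; rewrite ?Rmin_left, ?Rmax_right in * by lra.
- intros x Hx; apply Hf; lra.
- intros x Hx; apply continuity_pt_filterlim.
  apply (is_derive_continuous f x (f' x)), Hf; lra.
- rewrite E; apply Rmult_le_compat_r; [lra|apply Hm; lra].
Qed.

Lemma decr_bound (f f' : R -> R) a b m : a <= b ->
  (forall x, a <= x <= b -> is_derive f x (f' x)) ->
  (forall x, a <= x <= b -> f' x <= m) -> f b - f a <= m * (b - a).
Proof.
intros Hab Hf Hm.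
assert (H := incr_bound (fun x => - f x) (fun x => - f' x) a b (- m) Hab).
assert (X : - m * (b - a) <= - f b - - f a); [|lra].
apply H.
- intros x Hx; apply (is_derive_opp (V := R_NormedModule) f), Hf, Hx.
- intros x Hx; specialize (Hm x Hx); lra.
Qed.

Lemma abs_bound (f f' : R -> R) a b m : 0 <= m ->
  (forall x, Rmin a b <= x <= Rmax a b -> is_derive f x (f' x)) ->
  (forall x, Rmin a b <= x <= Rmax a b -> Rabs (f' x) <= m) ->
  Rabs (f b - f a) <= m * Rabs (b - a).
Proof.
intros Hm Hf Hb.
destruct (MVT_gen f a b f') as [x [Hx E]].
- intros x Hx; apply Hf; lra.
- intros x Hx; apply continuity_pt_filterlim.
  apply (is_derive_continuous f x (f' x)), Hf; lra.
- rewrite E, Rabs_mult; apply Rmult_le_compat_r; [apply Rabs_pos|apply Hb; lra].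
Qed.

Lemma continuous_shift (f : R -> R) a x : (forall x, continuous f x) ->
  continuous (fun y => f (y + a)) x.
Proof.
intros Hf; apply (continuous_comp (fun y => y + a) f); [|apply Hf].
apply (continuous_plus (fun y => y) (fun _ => a)); [apply continuous_id|apply continuous_const].
Qed.

Lemma is_derive_shift (f : R -> R) a x l : is_derive f (x + a) l ->
  is_derive (fun y => f (y + a)) x l.
Proof.
intros H.
replace l with (scal 1 l) by (unfold scal; simpl; unfold mult; simpl; ring).
apply (is_derive_comp f (fun y => y + a)); [exact H|].
auto_derive; [auto|ring].
Qed.

Lemma translate_derive (f : R -> R) (a x : R) : ex_derive f (x + a) ->
  ex_derive (fun y : R => f (y + a)) x /\ Derive (fun y : R => f (y + a)) x = Derive f (x + a).
Proof.
intros H; assert (E := is_derive_shift f a x _ (Derive_correct _ _ H)).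
split; [eexists; exact E|apply is_derive_unique, E].
Qed.

Lemma RInt_point_R (f : R -> R) a : RInt f a a = 0.
Proof. apply (RInt_point (V := R_CompleteNormedModule)). Qed.

Lemma derive_primitive (h : R -> R) a x : (forall y, continuous h y) ->
  is_derive (fun x => RInt h a x) x (h x).
Proof.
intros H; apply (is_derive_RInt h (fun x => RInt h a x) a x); [|apply H].
apply filter_forall; intros z; apply (RInt_correct (V := R_CompleteNormedModule)).
apply (ex_RInt_continuous (V := R_CompleteNormedModule)); intros; apply H.
Qed.

Lemma unif_continuous (g : R -> R) :
  (forall om, 0 < om -> exists del, 0 < del /\
     forall s s', Rabs (s - s') <= del -> Rabs (g s - g s') <= om) ->
  forall x, continuous g x.
Proof.
intros H x; apply continuity_pt_filterlim, continuity_pt_locally; intros eps.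
destruct (H (eps / 2)) as [del [Hdel Hg]]; [destruct eps; simpl; lra|].
exists (mkposreal del Hdel); intros y Hy; unfold ball in Hy; simpl in Hy.
unfold AbsRing_ball, abs, minus, plus, opp in Hy; simpl in Hy.
assert (X := Hg y x ltac:(unfold Rminus; lra)); destruct eps; simpl in *; lra.
Qed.

(** * Critical speeds *)

Lemma exp_ge_1_plus x : 1 + x <= exp x.
Proof.
destruct (Req_dec x 0) as [->|H]; [rewrite exp_0; lra|left; apply exp_ineq1; exact H].
Qed.

Lemma exp_le x y : x <= y -> exp x <= exp y.
Proof.
intros [H| ->]; [left; apply exp_increasing, H|right; reflexivity].
Qed.

(* [1 <= t e^(lam a) + (1 - t) e^(-z a)] for [t = z / (lam + z)]. *)
Lemma exp_convex lam z a : 0 < lam -> 0 <= z ->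
  lam + z <= z * exp (- lam * a) + lam * exp (z * a).
Proof.
intros Hlam Hz.
assert (H1 := exp_ge_1_plus (- lam * a)); assert (H2 := exp_ge_1_plus (z * a)); nra.
Qed.

Section Speed.

Context (D d r g0 : R) (beta : Z -> R).
Context (HD : 0 < D) (Hd : 0 < d) (Hr : 0 <= r) (Hg0 : d < g0).
Context (Hbeta : forall k, 0 <= beta k).

Notation mu := (d + 2 * D).
Notation Chi := (chi D d r g0 beta).

(** The factor by which the linearised right-hand side multiplies [exp (lam * x)]: it is
    [mu + c * lam - chi (lam, c)] with the series cut at [N], which can only lower it. *)
Definition lin_rate (c lam : R) (N : nat) : R := D * (exp lam + exp (- lam))
  + g0 * lsum (zl N) (fun k => beta k * exp (- lam * (IZR k + c * r))).

(* [- chi (lam, c) <= (g0 - d) / 2] for some [lam > 0], with the series truncated. *)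
Definition supercritical (c : R) : Prop := exists lam, 0 < lam /\
  forall N, lin_rate c lam N - mu - c * lam <= (g0 - d) / 2.

(* [c] is at least the infimum of the speeds [c'] with a positive zero of [chi (., c')]. *)
Definition above_critical (c : R) : Prop := forall eps, 0 < eps -> exists c' lam,
  c' < c + eps /\ 0 < lam /\ ex_sumZ (beta_exp beta lam) /\ Chi lam c' = 0.

Lemma SeriesZ_nonneg lam : ex_sumZ (beta_exp beta lam) -> 0 <= SeriesZ (beta_exp beta lam).
Proof.
intros [s Hs]; rewrite (is_sumZ_SeriesZ _ _ Hs).
apply Rle_trans with (lsum (zl 0) (beta_exp beta lam)).
- apply lsum_nonneg; intros k _; apply Rmult_le_pos; [apply Hbeta|left; apply exp_pos].
- apply lsum_zl_le_sum; [|exact Hs].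
  intros k; apply Rmult_le_pos; [apply Hbeta|left; apply exp_pos].
Qed.

Lemma lin_rate_chi c lam N : ex_sumZ (beta_exp beta lam) ->
  lin_rate c lam N <= mu + c * lam - Chi lam c.
Proof.
intros [s Hs]; unfold lin_rate, chi; rewrite (is_sumZ_SeriesZ _ _ Hs).
assert (H : lsum (zl N) (beta_exp beta lam) <= s).
{ apply lsum_zl_le_sum; [|exact Hs].
  intros k; apply Rmult_le_pos; [apply Hbeta|left; apply exp_pos]. }
assert (E : lsum (zl N) (fun k => beta k * exp (- lam * (IZR k + c * r)))
  = exp (- c * r * lam) * lsum (zl N) (beta_exp beta lam)).
{ rewrite <- lsum_scal; apply lsum_ext; intros k; unfold beta_exp.
  replace (exp (- lam * (IZR k + c * r))) with (exp (- c * r * lam) * exp (- lam * IZR k))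
    by (rewrite <- exp_plus; f_equal; ring); ring. }
rewrite E; assert (X := exp_pos (- c * r * lam)).
assert (g0 * exp (- c * r * lam) * lsum (zl N) (beta_exp beta lam) <= g0 * exp (- c * r * lam) * s)
  by (apply Rmult_le_compat_l; [apply Rmult_le_pos; lra|exact H]).
lra.
Qed.

(** The linear term gains [(c' - c) * lam], and the delayed term, which enters with a minus sign,
    decreases as the speed grows. *)
Lemma chi_incr c c' lam : 0 < lam -> c <= c' -> ex_sumZ (beta_exp beta lam) ->
  Chi lam c + (c' - c) * lam <= Chi lam c'.
Proof.
intros Hlam Hcc Hs; apply SeriesZ_nonneg in Hs; unfold chi.
assert (exp (- c' * r * lam) <= exp (- c * r * lam)).
{ apply exp_le; assert (0 <= (c' - c) * (r * lam)) by (apply Rmult_le_pos; [lra|apply Rmult_le_pos; lra]); lra. }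
assert (g0 * exp (- c' * r * lam) * SeriesZ (beta_exp beta lam)
  <= g0 * exp (- c * r * lam) * SeriesZ (beta_exp beta lam)); [|lra].
apply Rmult_le_compat_r; [exact Hs|apply Rmult_le_compat_l; lra].
Qed.

Lemma exp_small u : 0 <= u <= 1 / 2 -> exp u - 1 <= 2 * u.
Proof.
intros Hu; assert (H := exp_ge_1_plus (- u)); rewrite exp_Ropp in H.
assert (Hp := exp_pos u).
apply (Rmult_le_compat_l (exp u)) in H; [|lra].
rewrite Rinv_r in H by lra; nra.
Qed.

(* Zeros [lam] of [chi (., c')] stay bounded for bounded [c'], so that lowering [c'] to [c]
   costs little. *)
Lemma chi_near_zero c del : above_critical c -> 0 < del ->
  exists lam, 0 < lam /\ ex_sumZ (beta_exp beta lam) /\ - del <= Chi lam c.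
Proof.
intros Hc Hdel.
assert (HC := Rabs_pos c).
(* At a zero [D * exp lam <= mu + c' * lam], whereas [lam ^ 2 / 4 <= exp lam]; this bounds [lam] by
   [4 * (mu + Rabs c + 1) / D] as soon as it exceeds 1. *)
set (Lam := 1 + 4 * (mu + Rabs c + 1) / D).
assert (HLam1 : 0 < 4 * (mu + Rabs c + 1) / D) by (apply Rdiv_lt_0_compat; lra).
assert (HLam : 1 < Lam) by (unfold Lam; lra).
set (C := Lam + (mu + (Rabs c + 1) * Lam) * (2 * (r * Lam))).
assert (HrL : 0 <= r * Lam) by (apply Rmult_le_pos; lra).
assert (HcL : 0 <= (Rabs c + 1) * Lam) by (apply Rmult_le_pos; lra).
assert (HCp : 1 < C) by (unfold C; nra).
set (eps := Rmin 1 (Rmin (1 / (2 * (r * Lam + 1))) (del / C))).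
assert (He0 : 0 < eps) by (repeat apply Rmin_pos; try apply Rdiv_lt_0_compat; lra).
assert (He1 : eps <= 1) by apply Rmin_l.
assert (He2 : eps * (r * Lam) <= 1 / 2).
{ assert (X : eps <= 1 / (2 * (r * Lam + 1))) by (eapply Rle_trans; [apply Rmin_r|apply Rmin_l]).
  apply (Rmult_le_compat_r (2 * (r * Lam + 1))) in X; [|lra].
  replace (1 / (2 * (r * Lam + 1)) * (2 * (r * Lam + 1))) with 1 in X by (field; lra); lra. }
assert (He3 : eps * C <= del).
{ assert (X : eps <= del / C) by (eapply Rle_trans; [apply Rmin_r|apply Rmin_r]).
  apply (Rmult_le_compat_r C) in X; [|lra].
  replace (del / C * C) with del in X by (field; lra); exact X. }
destruct (Hc eps He0) as [c' [lam [Hc' [Hlam [Hs Hchi]]]]].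
exists lam; split; [exact Hlam|split; [exact Hs|]].
destruct (Rle_lt_dec c' c) as [Hle|Hlt].
{ assert (H := chi_incr c' c lam Hlam Hle Hs).
  assert (0 <= (c - c') * lam) by (apply Rmult_le_pos; lra); lra. }
assert (Hcabs := Rle_abs c).
assert (HS := SeriesZ_nonneg lam Hs).
unfold chi in Hchi |- *.
set (Ser := SeriesZ (beta_exp beta lam)) in *.
set (A := g0 * exp (- c' * r * lam) * Ser) in *.
assert (HA : 0 <= A).
{ apply Rmult_le_pos; [apply Rmult_le_pos; [lra|left; apply exp_pos]|exact HS]. }
assert (Hcl : c' * lam <= (Rabs c + 1) * lam) by (apply Rmult_le_compat_r; lra).
assert (He' := exp_pos (- lam)).
assert (HlamL : lam <= Lam).
{ destruct (Rle_lt_dec lam 1) as [|Hl1]; [lra|].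
  assert (E : exp lam = exp (lam / 2) * exp (lam / 2)) by (rewrite <- exp_plus; f_equal; field).
  assert (X := exp_ge_1_plus (lam / 2)).
  assert (Hsq : lam * lam / 4 <= exp lam) by (rewrite E; nra).
  assert (H1 : D * (lam * lam / 4) <= mu + (Rabs c + 1) * lam) by nra.
  assert (H2 : D * lam <= 4 * (mu + Rabs c + 1)).
  { apply Rmult_le_reg_r with lam; [lra|].
    assert (mu * 1 <= mu * lam) by (apply Rmult_le_compat_l; lra); lra. }
  unfold Lam; apply Rle_trans with (4 * (mu + Rabs c + 1) / D); [|lra].
  apply Rmult_le_reg_r with D; [lra|]; unfold Rdiv; rewrite Rmult_assoc, Rinv_l; lra. }
assert (HA2 : A <= mu + (Rabs c + 1) * Lam).
{ assert ((Rabs c + 1) * lam <= (Rabs c + 1) * Lam) by (apply Rmult_le_compat_l; lra).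
  assert (Hp := exp_pos lam); nra. }
assert (Hrl : 0 <= r * lam <= r * Lam) by (split; [apply Rmult_le_pos|apply Rmult_le_compat_l]; lra).
assert (Hu : 0 <= (c' - c) * (r * lam) <= eps * (r * Lam)) by (split; [apply Rmult_le_pos; lra|apply Rmult_le_compat; lra]).
assert (Hexp := exp_small ((c' - c) * (r * lam)) ltac:(lra)).
assert (E : g0 * exp (- c * r * lam) * Ser = A * exp ((c' - c) * (r * lam))).
{ unfold A; replace (exp (- c * r * lam)) with (exp (- c' * r * lam) * exp ((c' - c) * (r * lam)))
    by (rewrite <- exp_plus; f_equal; ring); ring. }
rewrite E.
assert (H1 : A * (exp ((c' - c) * (r * lam)) - 1) <= (mu + (Rabs c + 1) * Lam) * (2 * (eps * (r * Lam)))).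
{ assert (X := exp_ge_1_plus ((c' - c) * (r * lam))); apply Rmult_le_compat; lra. }
assert (H2 : (c' - c) * lam <= eps * Lam) by (apply Rmult_le_compat; lra).
unfold C in He3; lra.
Qed.

Lemma above_critical_supercritical c : above_critical c -> supercritical c.
Proof.
intros Hc; destruct (chi_near_zero c ((g0 - d) / 2) Hc) as [lam [Hlam [Hs Hchi]]]; [lra|].
exists lam; split; [exact Hlam|]; intros N.
assert (H := lin_rate_chi c lam N Hs); lra.
Qed.

(** Take a zero of [chi] at a speed [c1 < c + eta / 2] and a speed beyond both [c] and [c1]:
    monotonicity makes [chi] positive there. *)
Lemma above_critical_strict c eta : above_critical c -> 0 < eta -> exists c' lam,
  c < c' < c + eta /\ 0 < lam /\ forall N, lin_rate c' lam N < mu + c' * lam.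
Proof.
intros Hc Heta; destruct (Hc (eta / 2)) as [c1 [lam [Hc1 [Hlam [Hs Hchi]]]]]; [lra|].
exists (Rmax c c1 + eta / 4), lam.
assert (M1 := Rmax_l c c1); assert (M2 := Rmax_r c c1).
assert (M3 : Rmax c c1 < c + eta / 2) by (apply Rmax_lub_lt; lra).
split; [lra|split; [exact Hlam|]]; intros N.
eapply Rle_lt_trans; [apply lin_rate_chi, Hs|].
assert (H := chi_incr c1 (Rmax c c1 + eta / 4) lam Hlam ltac:(lra) Hs).
assert (0 < (Rmax c c1 + eta / 4 - c1) * lam) by (apply Rmult_lt_0_compat; lra); lra.
Qed.

End Speed.

(** * A Lyapunov functional for linear inequalities *)

(** Along the characteristic [x - c * s] the function [exp (- (mu * s)) * (phi - K)] is
    nonincreasing in [s], so [phi x - K >= - exp (- (mu * S)) * K]. The choice of [S] makes this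
    error at most [e], and [Rabs c * S] covers both signs of [c]. *)
Lemma relax_lower c mu K X (phi : R -> R) : 0 < mu -> 0 <= K ->
  (forall x, 0 <= phi x) -> (forall x, ex_derive phi x) ->
  (forall x, X <= x -> mu * K <= c * Derive phi x + mu * phi x) ->
  forall e, 0 < e -> exists X', forall x, X' <= x -> K - e <= phi x.
Proof.
intros Hmu HK Hpos Hder Hineq e He.
set (S := K / (e * mu)).
assert (HS : 0 <= S) by (apply Rdiv_le_0_compat; nra).
exists (X + Rabs c * S); intros x Hx.
set (h := fun s => exp (- (mu * s)) * (phi (x - c * s) - K)).
assert (H : h S - h 0 <= 0 * (S - 0)).
{ apply (decr_bound h (fun s => - exp (- (mu * s)) *
    (c * Derive phi (x - c * s) + mu * phi (x - c * s) - mu * K))); [exact HS| |].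
  - intros s Hs; unfold h.
    auto_derive; [apply Hder|].
    change (fun x0 : R => phi x0) with phi; unfold Rminus; ring.
  - intros s Hs.
    assert (Hc := Rle_abs c); assert (Hc' := Rle_abs (- c)); rewrite Rabs_Ropp in Hc'.
    assert (Hxs : X <= x - c * s) by nra.
    specialize (Hineq _ Hxs); assert (Hp := exp_pos (- (mu * s))); nra. }
unfold h in H; rewrite Rmult_0_l, Rmult_0_r, Ropp_0, exp_0, Rmult_0_r, Rminus_0_r in H.
assert (Hp := Hpos (x - c * S)).
assert (HE := exp_pos (- (mu * S))).
assert (HKE : exp (- (mu * S)) * K <= e).
{ rewrite exp_Ropp; assert (X1 := exp_ge_1_plus (mu * S)).
  assert (mu * S * e = K) by (unfold S; field; lra).
  apply Rmult_le_reg_l with (exp (mu * S)); [apply exp_pos|].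
  rewrite <- Rmult_assoc, Rinv_r, Rmult_1_l by (assert (Z := exp_pos (mu * S)); lra).
  nra. }
nra.
Qed.

Section Lyapunov.

Context (c mu B L : R) (l : list (R * R)) (psi : R -> R).
Context (HB : 0 < B) (HL : 0 <= L).
Context (Hl : forall p, In p l -> 0 <= fst p).
Context (Hpsi : forall x, 0 <= psi x <= B) (Hder : forall x, ex_derive psi x).
Context (HpsiL : forall x y, Rabs (psi x - psi y) <= L * Rabs (x - y)).
Context (Hineq : forall x, 0 <= x ->
  lsum l (fun p => fst p * psi (x - snd p)) <= c * Derive psi x + mu * psi x).

(** The total mass of the windows of the functional below, when the integrand is 1. *)
Definition moment : R := lsum l (fun p => fst p * Rabs (snd p)).

Lemma moment_nonneg : 0 <= moment.
Proof.
apply lsum_nonneg; intros p Hp; apply Rmult_le_pos; [auto|apply Rabs_pos].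
Qed.

Section Weight.

Context (w w' : R -> R) (W kappa : R) (Hkappa : 0 < kappa).
Context (Hw : forall x, 0 < w x <= W) (Hw1 : forall x, 0 <= x -> 1 <= w x).
Context (Hwd : forall x, is_derive w x (w' x)).
Context (Hadj : forall x, 0 <= x ->
  kappa * w x <= c * w' x - mu * w x + lsum l (fun p => fst p * w (x + snd p))).

Definition prim (a x : R) : R := RInt (fun y => w (y + a) * psi y) 0 x.

(* Since [(int_{x-a}^x w(y+a) psi(y) dy)' = w(x+a) psi(x) - w(x) psi(x-a)], adding these
   windows to [c w psi] turns the shifts of [psi] into shifts of the weight. *)
Definition lyap (x : R) : R :=
  c * (w x * psi x) + lsum l (fun p => fst p * (prim (snd p) x - prim (snd p) (x - snd p))).

Lemma psi_continuous (x : R) : continuous psi x.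
Proof. apply (lip_continuous psi L HpsiL). Qed.

Lemma prim_derive (a x : R) : is_derive (prim a) x (w (x + a) * psi x).
Proof.
apply (derive_primitive (fun y => w (y + a) * psi y)); intros y.
apply (continuous_mult (fun y => w (y + a)) psi); [|apply psi_continuous].
apply continuous_shift; intros z; apply (is_derive_continuous w z (w' z)), Hwd.
Qed.

Lemma lyap_derive (x : R) : is_derive lyap x
  (c * (w' x * psi x + w x * Derive psi x)
   + lsum l (fun p => fst p * (w (x + snd p) * psi x - w x * psi (x - snd p)))).
Proof.
apply (is_derive_plus (V := R_NormedModule) (fun x => c * (w x * psi x))).
- apply (is_derive_scal (fun x => w x * psi x)).
  apply (is_derive_mult w psi); [apply Hwd|apply Derive_correct, Hder|].
  intros; apply Rmult_comm.
- apply (lsum_derive l (fun p x => fst p * (prim (snd p) x - prim (snd p) (x - snd p)))).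
  intros p _; apply (is_derive_scal (fun x => prim (snd p) x - prim (snd p) (x - snd p))).
  apply (is_derive_minus (V := R_NormedModule) (prim (snd p)) (fun x => prim (snd p) (x - snd p)));
    [apply prim_derive|].
  apply (is_derive_shift (prim (snd p)) (- snd p)).
  assert (E := prim_derive (snd p) (x + - snd p)).
  replace (x + - snd p + snd p) with x in E by ring; exact E.
Qed.

(** The derivative is [psi] times the adjoint expression in [w], corrected by [w] times the
    inequality for [psi]. The terms in [Derive psi] and in [mu] cancel, and at least
    [kappa * w * psi] remains, where [w >= 1]. *)
Lemma lyap_incr x y m : 0 <= x <= y -> (forall z, x <= z <= y -> m <= psi z) -> 0 <= m ->
  kappa * m * (y - x) <= lyap y - lyap x.
Proof.
intros Hxy Hm Hm0.
apply incr_bound with (f' := fun x => c * (w' x * psi x + w x * Derive psi x)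
   + lsum l (fun p => fst p * (w (x + snd p) * psi x - w x * psi (x - snd p)))); [lra| |].
{ intros z _; apply lyap_derive. }
intros z Hz; assert (Hz0 : 0 <= z) by lra.
specialize (Hm z Hz); assert (H1 := Hineq z Hz0); assert (H2 := Hadj z Hz0).
assert (E : lsum l (fun p => fst p * (w (z + snd p) * psi z - w z * psi (z - snd p)))
  = psi z * lsum l (fun p => fst p * w (z + snd p))
    - w z * lsum l (fun p => fst p * psi (z - snd p))).
{ rewrite <- !lsum_scal, <- lsum_minus; apply lsum_ext; intros p; ring. }
rewrite E; destruct (Hw z) as [Hwz _]; assert (Hw1z := Hw1 z Hz0).
apply (Rmult_le_compat_l (w z)) in H1; [|lra].
apply (Rmult_le_compat_l (psi z)) in H2; [|lra].
assert (kappa * m <= kappa * (psi z * w z)); [|lra].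
apply Rmult_le_compat_l; nra.
Qed.

Lemma lyap_small x m M : 0 <= m -> (forall p, In p l -> Rabs (snd p) <= M) ->
  (forall y, Rabs (y - x) <= M -> psi y <= m) -> 0 <= M ->
  Rabs (lyap x) <= (Rabs c + moment) * W * m.
Proof.
intros Hm HM Hy HM0; unfold lyap.
destruct (Hw x) as [Hwx HwW].
eapply Rle_trans; [apply Rabs_triang|].
replace ((Rabs c + moment) * W * m) with (Rabs c * (W * m) + moment * (W * m)) by ring.
apply Rplus_le_compat.
- rewrite Rabs_mult; apply Rmult_le_compat_l; [apply Rabs_pos|].
  specialize (Hpsi x); rewrite Rabs_pos_eq by nra; apply Rmult_le_compat; try lra.
  apply Hy; rewrite Rminus_eq_0, Rabs_R0; exact HM0.
- eapply Rle_trans; [apply lsum_abs|].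
  unfold moment; rewrite Rmult_comm, <- lsum_scal; apply lsum_le; intros p Hp.
  rewrite Rabs_mult, (Rabs_pos_eq (fst p)) by auto.
  replace (W * m * (fst p * Rabs (snd p))) with (fst p * (W * m * Rabs (snd p))) by ring.
  apply Rmult_le_compat_l; [auto|].
  replace (Rabs (snd p)) with (Rabs (x - (x - snd p))) by (f_equal; ring).
  apply (abs_bound (prim (snd p)) (fun y => w (y + snd p) * psi y)).
  + apply Rmult_le_pos; lra.
  + intros z _; apply prim_derive.
  + intros z Hz.
    assert (Hzm : psi z <= m).
    { apply Hy; specialize (HM p Hp); apply Rabs_le_between in HM.
      unfold Rmin, Rmax in Hz; destruct (Rle_dec _ _); apply Rabs_le; lra. }
    specialize (Hpsi z); destruct (Hw (z + snd p)).
    rewrite Rabs_pos_eq by nra; apply Rmult_le_compat; lra.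
Qed.

Lemma shifts_bounded : exists M, 0 <= M /\ forall p, In p l -> Rabs (snd p) <= M.
Proof.
clear; exists (lsum l (fun p => Rabs (snd p))); split.
- apply lsum_nonneg; intros; apply Rabs_pos.
- intros p Hp; apply (lsum_mem_le l (fun p => Rabs (snd p))); [intros; apply Rabs_pos|exact Hp].
Qed.

(** Whenever [psi] exceeds [eps], the Lipschitz bound keeps it above [eps / 2] on an interval of
    length [tau], and [lyap] gains [Del]. As [lyap] is bounded and nondecreasing, this cannot happen
    arbitrarily far out. *)
Lemma lyap_decay eps : 0 < eps -> exists X, forall x, X <= x -> psi x <= eps.
Proof.
intros Heps; apply NNPP; intros Hn.
assert (Hfar : forall X, exists x, X <= x /\ eps < psi x).
{ intros X; apply NNPP; intros H; apply Hn; exists X; intros x Hx.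
  apply Rnot_lt_le; intros Hlt; apply H; exists x; auto. }
set (tau := eps / (2 * (L + 1))).
assert (Htau : 0 < tau) by (apply Rdiv_lt_0_compat; lra).
assert (HLtau : L * tau <= eps / 2).
{ unfold tau; apply Rmult_le_reg_r with (2 * (L + 1)); [lra|].
  replace (L * (eps / (2 * (L + 1))) * (2 * (L + 1))) with (L * eps) by (field; lra).
  nra. }
set (Del := kappa * (eps / 2) * tau).
assert (HDel : 0 < Del) by (apply Rmult_lt_0_compat; [nra|exact Htau]).
assert (Hgrow : forall k : nat, exists x, 0 <= x /\ lyap 0 + INR k * Del <= lyap x).
{ induction k as [|k [x [Hx0 Hx]]].
  - exists 0; simpl; lra.
  - destruct (Hfar x) as [y [Hxy Hy]].
    exists (y + tau); split; [lra|].
    assert (H1 := lyap_incr x y 0 (conj Hx0 Hxy) (fun z _ => proj1 (Hpsi z)) (Rle_refl 0)).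
    assert (H2 : kappa * (eps / 2) * (y + tau - y) <= lyap (y + tau) - lyap y).
    { apply lyap_incr; [lra| |lra]; intros z Hz.
      assert (H := HpsiL y z); rewrite Rabs_minus_sym with (x := y) in H.
      rewrite (Rabs_pos_eq (z - y)) in H by lra.
      assert (L * (z - y) <= L * tau) by (apply Rmult_le_compat_l; lra).
      apply Rabs_le_between in H; lra. }
    rewrite S_INR; replace (y + tau - y) with tau in H2 by ring.
    fold Del in H2; lra. }
destruct shifts_bounded as [M [HM0 HM]].
set (C := (Rabs c + moment) * W * B).
assert (Hbd : forall x, Rabs (lyap x) <= C).
{ intros x; apply (lyap_small x B M); [lra|exact HM| |exact HM0]; intros y _; apply Hpsi. }
destruct (nfloor_ex (Rabs (2 * C / Del))) as [k [_ Hk]]; [apply Rabs_pos|].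
destruct (Hgrow (S k)) as [x [_ Hx]]; rewrite S_INR in Hx.
assert (H1 := Hbd x); assert (H2 := Hbd 0).
apply Rabs_le_between in H1; apply Rabs_le_between in H2.
assert (H3 := Rle_abs (2 * C / Del)).
assert (H4 : 2 * C / Del * Del = 2 * C) by (field; lra).
nra.
Qed.

(** On the right half line [lyap] is nondecreasing, and it tends to 0 because [psi] does. *)
Lemma lyap_nonpos : lyap 0 <= 0.
Proof.
destruct shifts_bounded as [M [HM0 HM]].
apply Rabs_bound_0; intros e He.
set (C := (Rabs c + moment) * W).
assert (HC : 0 <= C).
{ apply Rmult_le_pos; [assert (X := moment_nonneg); assert (Y := Rabs_pos c); lra|].
  destruct (Hw 0); lra. }
destruct (lyap_decay (e / (C + 1))) as [X HX]; [apply Rdiv_lt_0_compat; lra|].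
set (x := Rmax 0 X + M).
assert (Hx0 : 0 <= x) by (unfold x; assert (H := Rmax_l 0 X); lra).
assert (H1 := lyap_incr 0 x 0 (conj (Rle_refl 0) Hx0) (fun z _ => proj1 (Hpsi z)) (Rle_refl 0)).
assert (He' : 0 < e / (C + 1)) by (apply Rdiv_lt_0_compat; lra).
assert (H2 : Rabs (lyap x) <= C * (e / (C + 1))).
{ apply (lyap_small x _ M); [lra|exact HM| |exact HM0].
  intros y Hy; apply HX; apply Rabs_le_between in Hy.
  unfold x in Hy; assert (H := Rmax_r 0 X); lra. }
assert (H3 : C * (e / (C + 1)) <= e).
{ apply Rmult_le_reg_r with (C + 1); [lra|].
  replace (C * (e / (C + 1)) * (C + 1)) with (C * e) by (field; lra); nra. }
assert (H4 := Rle_abs (lyap x)); lra.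
Qed.

End Weight.

(** The weight is constant, so the adjoint inequality only says that the mass of the kernel exceeds
    [mu]. *)
Lemma decay : mu < lsum l fst -> forall eps, 0 < eps ->
  exists X, forall x, X <= x -> psi x <= eps.
Proof.
intros Hmu; apply (lyap_decay (fun _ => 1) (fun _ => 0) 1 (lsum l fst - mu)).
- lra.
- intros; lra.
- intros; lra.
- intros; apply (is_derive_const (V := R_NormedModule)).
- intros x _.
  rewrite (lsum_ext l (fun p => fst p * 1) fst) by (intros; ring); lra.
Qed.

Section Slope.

Context (Z eps : R) (HZ : 0 < Z) (Heps : 0 < eps).

Definition slope (x : R) : R := clip Z (Z - eps * x).
Definition expo (x : R) : R := RInt slope 0 x.

Lemma slope_bounds x : 0 <= slope x <= Z.
Proof. apply clip_bounds; lra. Qed.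

Lemma slope_lip x y : Rabs (slope x - slope y) <= eps * Rabs (x - y).
Proof.
eapply Rle_trans; [apply clip_lip|].
replace (Z - eps * x - (Z - eps * y)) with (- (eps * (x - y))) by ring.
rewrite Rabs_Ropp, Rabs_mult, (Rabs_pos_eq eps); lra.
Qed.

Lemma expo_derive (x : R) : is_derive expo x (slope x).
Proof. apply derive_primitive, (lip_continuous slope eps slope_lip). Qed.

Lemma expo_0 : expo 0 = 0.
Proof. apply RInt_point_R. Qed.

Lemma expo_neg x : x <= 0 -> expo x <= 0.
Proof.
intros Hx.
assert (H := incr_bound expo slope x 0 0 Hx (fun z _ => expo_derive z)
  (fun z _ => proj1 (slope_bounds z))); rewrite expo_0 in H; lra.
Qed.

Lemma expo_pos x : 0 <= x -> 0 <= expo x.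
Proof.
intros Hx.
assert (H := incr_bound expo slope 0 x 0 Hx (fun z _ => expo_derive z)
  (fun z _ => proj1 (slope_bounds z))); rewrite expo_0 in H; lra.
Qed.

Lemma expo_ge x : 0 <= x -> eps * x <= Z / 2 -> Z / 2 * x <= expo x.
Proof.
intros Hx Hex.
assert (H : Z / 2 * (x - 0) <= expo x - expo 0).
{ apply (incr_bound expo slope); [exact Hx|intros; apply expo_derive|].
  intros y Hy; assert (eps * y <= eps * x) by (apply Rmult_le_compat_l; lra).
  unfold slope; assert (0 <= eps * y) by (apply Rmult_le_pos; lra).
  rewrite clip_id; lra. }
rewrite expo_0 in H; lra.
Qed.

Lemma expo_le x : expo x <= Z * (Z / eps).
Proof.
assert (H0 : 0 <= Z / eps) by (apply Rdiv_le_0_compat; lra).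
assert (H1 : forall y, 0 <= y -> expo y <= Z * y).
{ intros y Hy; assert (H := decr_bound expo slope 0 y Z Hy (fun z _ => expo_derive z)
  (fun z _ => proj2 (slope_bounds z))); rewrite expo_0 in H; lra. }
destruct (Rle_lt_dec x 0) as [Hx|Hx].
{ apply Rle_trans with 0; [apply expo_neg; exact Hx|apply Rmult_le_pos; lra]. }
destruct (Rle_lt_dec x (Z / eps)) as [Hx'|Hx'].
{ apply Rle_trans with (Z * x); [apply H1; lra|apply Rmult_le_compat_l; lra]. }
apply Rle_trans with (expo (Z / eps)); [|apply H1; lra].
assert (H : expo x - expo (Z / eps) <= 0 * (x - Z / eps)).
{ apply (decr_bound expo slope); [lra|intros; apply expo_derive|].
  intros y Hy; unfold slope, clip.
  assert (eps * (Z / eps) = Z) by (field; lra).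
  assert (eps * (Z / eps) <= eps * y) by (apply Rmult_le_compat_l; lra).
  rewrite Rmax_left by lra; apply Rmin_r. }
lra.
Qed.

(** Over a distance [M] the slope varies by at most [eps * M]. Hence the weight [exp (expo x)]
    changes under a shift [a] like an exponential of rate [slope x], up to the factor
    [exp (- eps * M ^ 2)]. *)
Lemma expo_shift x a M : Rabs a <= M -> a * slope x - eps * (M * M) <= expo (x + a) - expo x.
Proof.
intros Ha.
destruct (MVT_gen expo x (x + a) slope) as [y [Hy E]].
- intros y _; apply expo_derive.
- intros y _; apply continuity_pt_filterlim, (is_derive_continuous expo y (slope y)), expo_derive.
- rewrite E; replace (x + a - x) with a by ring.
  assert (Hyx : Rabs (y - x) <= Rabs a).
  { unfold Rmin, Rmax in Hy; destruct (Rle_dec _ _); unfold Rabs;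
    destruct (Rcase_abs a); destruct (Rcase_abs (y - x)); lra. }
  assert (H := slope_lip y x).
  assert (H2 : Rabs ((slope y - slope x) * a) <= eps * (M * M)).
  { rewrite Rabs_mult; assert (P := Rabs_pos a); assert (P' := Rabs_pos (y - x)).
    apply Rle_trans with (eps * Rabs (y - x) * Rabs a); [apply Rmult_le_compat_r; lra|].
    rewrite Rmult_assoc; apply Rmult_le_compat_l; [lra|apply Rmult_le_compat; lra]. }
  apply Rabs_le_between in H2; lra.
Qed.

End Slope.

(* The exponent of the weight decreases slowly from a large [Z] to [0]: locally the weight
   is exponential, so the hypothesis makes the Lyapunov functional increase to its limit 0,
   whereas its value at 0 is positive when [Z] is large. *)
Lemma no_decay (kappa b1 a1 : R) : 0 < mu -> 0 < kappa -> (forall x, 0 < psi x) ->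
  (forall z, 0 <= z -> kappa <= c * z - mu + lsum l (fun p => fst p * exp (snd p * z))) ->
  In (b1, a1) l -> 0 < b1 -> 0 < a1 -> False.
Proof.
intros Hmu Hkappa Hpos HQ Hin Hb1 Ha1.
destruct shifts_bounded as [M0 [HM0 HM']].
set (M := M0 + 1).
assert (HM : forall p, In p l -> Rabs (snd p) <= M)
  by (intros p Hp; specialize (HM' p Hp); unfold M; lra).
(* The window of the positive shift [a1] at 0 is [[- a1, 0]]; a positive minimum of [psi] on it
   makes this window large when the weight is. *)
destruct (continuity_ab_min psi (- a1) 0) as [xm [Hxm1 Hxm2]]; [lra| |].
{ intros x _; apply continuity_pt_filterlim, psi_continuous. }
set (eta := psi xm); assert (Heta : 0 < eta) by apply Hpos.
set (C1 := (Rabs c + moment) * B).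
assert (HC1 : 0 <= C1).
{ apply Rmult_le_pos; [assert (X := moment_nonneg); assert (Y := Rabs_pos c); lra|lra]. }
set (q := b1 * (a1 / 2 * eta)).
assert (Hq : 0 < q) by (unfold q; repeat apply Rmult_lt_0_compat; lra).
(* Chosen so that [Z / 2 * (a1 / 2) = C1 / q + 1], whose exponential times [q] exceeds [C1], the
   bound on the remaining terms of [lyap 0]. *)
set (Z := 4 / a1 * (C1 / q + 1)).
assert (HC1q : 0 <= C1 / q) by (apply Rdiv_le_0_compat; lra).
assert (HZ : 0 < Z).
{ unfold Z; apply Rmult_lt_0_compat; [apply Rdiv_lt_0_compat|]; lra. }
(* The relative loss allowed in the shifted weights: [kappa - delta * (kappa + mu + Rabs c * Z) =
   kappa / 2] leaves half of the margin for every slope in [[0, Z]]. *)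
set (delta := kappa / (2 * (kappa + mu + Rabs c * Z))).
assert (HcZ : 0 <= Rabs c * Z) by (apply Rmult_le_pos; [apply Rabs_pos|lra]).
assert (Hdelta : 0 < delta) by (apply Rdiv_lt_0_compat; lra).
assert (Hdelta2 : delta * (kappa + mu + Rabs c * Z) = kappa / 2)
  by (unfold delta; field; lra).
assert (Hdelta1 : delta <= 1) by nra.
(* The first bound keeps the loss from the varying slope below [delta]; the second keeps the slope
   above [Z / 2] on [[0, a1 / 2]]. *)
set (eps := Rmin (delta / (M * M)) (Z / a1)).
assert (HMM : 0 < M * M) by (unfold M; nra).
assert (Heps : 0 < eps) by (apply Rmin_pos; apply Rdiv_lt_0_compat; lra).
assert (HepsM : eps * (M * M) <= delta).
{ apply Rle_trans with (delta / (M * M) * (M * M)); [|right; field; unfold M; lra].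
  apply Rmult_le_compat_r; [lra|apply Rmin_l]. }
assert (Hepsa : eps * (a1 / 2) <= Z / 2).
{ apply Rle_trans with (Z / a1 * (a1 / 2)); [|right; field; lra].
  apply Rmult_le_compat_r; [lra|apply Rmin_r]. }
set (w := fun x => exp (expo Z eps x)).
set (w' := fun x => slope Z eps x * exp (expo Z eps x)).
set (W := exp (Z * (Z / eps))).
assert (Hw : forall x, 0 < w x <= W).
{ intros x; split; [apply exp_pos|]; apply exp_le, expo_le; assumption. }
assert (Hw1 : forall x, 0 <= x -> 1 <= w x).
{ intros x Hx; rewrite <- exp_0; apply exp_le, expo_pos; assumption. }
assert (Hwd : forall x, is_derive w x (w' x)).
{ intros x; apply (is_derive_comp exp (expo Z eps)); [apply is_derive_exp|].
  apply expo_derive; assumption. }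
assert (Hadj : forall x, 0 <= x ->
  kappa / 2 * w x <= c * w' x - mu * w x + lsum l (fun p => fst p * w (x + snd p))).
{ intros x _; set (z := slope Z eps x).
  assert (Hz : 0 <= z <= Z) by (apply slope_bounds; assumption).
  set (S := lsum l (fun p => fst p * exp (snd p * z))).
  assert (HS : 0 <= S).
  { apply lsum_nonneg; intros p Hp; apply Rmult_le_pos; [auto|left; apply exp_pos]. }
  assert (HQz := HQ z (proj1 Hz)); fold S in HQz.
  assert (HwS : w x * ((1 - delta) * S) <= lsum l (fun p => fst p * w (x + snd p))).
  { unfold S; rewrite <- !lsum_scal; apply lsum_le; intros p Hp.
    replace (w x * ((1 - delta) * (fst p * exp (snd p * z))))
      with (fst p * (w x * ((1 - delta) * exp (snd p * z)))) by ring.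
    apply Rmult_le_compat_l; [auto|].
    apply Rle_trans with (w x * exp (- delta + snd p * z)).
    - apply Rmult_le_compat_l; [left; apply exp_pos|]; rewrite exp_plus.
      apply Rmult_le_compat_r; [left; apply exp_pos|].
      assert (X := exp_ge_1_plus (- delta)); lra.
    - unfold w; rewrite <- exp_plus; apply exp_le.
      assert (X := expo_shift Z eps Heps x (snd p) M (HM p Hp)); fold z in X; lra. }
  unfold w' at 1; fold z; change (exp (expo Z eps x)) with (w x).
  destruct (Hw x) as [Hwx _].
  assert (Hcz : - (c * z) <= Rabs c * Z).
  { assert (X := Rle_abs (- c)); rewrite Rabs_Ropp in X; assert (Y := Rabs_pos c); nra. }
  assert (H : kappa / 2 <= c * z - mu + (1 - delta) * S) by nra.
  apply (Rmult_le_compat_l (w x)) in H; [|lra]; lra. }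
assert (Hk2 : 0 < kappa / 2) by lra.
assert (Hle := lyap_nonpos w w' W (kappa / 2) Hk2 Hw Hw1 Hwd Hadj).
assert (Hw0 : w 0 = 1) by (unfold w; rewrite expo_0; apply exp_0).
(* No window is very negative: for a positive shift it is nonnegative, and for a negative one the
   weight is evaluated at nonpositive points, where it is at most 1. *)
assert (Hint : forall p, In p l ->
  0 <= fst p * (prim w (snd p) 0 - prim w (snd p) (0 - snd p)) + B * (fst p * Rabs (snd p))).
{ intros p Hp.
  replace (_ + _) with (fst p * (prim w (snd p) 0 - prim w (snd p) (0 - snd p) + B * Rabs (snd p)))
    by ring.
  apply Rmult_le_pos; [auto|].
  destruct (Rle_lt_dec 0 (snd p)) as [Ha|Ha].
  - assert (H := incr_bound (prim w (snd p)) (fun y => w (y + snd p) * psi y) (0 - snd p) 0 0).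
    assert (0 * (0 - (0 - snd p)) <= prim w (snd p) 0 - prim w (snd p) (0 - snd p)).
    { apply H; [lra|intros; apply (prim_derive w w' Hwd)|].
      intros y _; apply Rmult_le_pos; [left; apply exp_pos|apply Hpsi]. }
    assert (0 <= B * Rabs (snd p)) by (apply Rmult_le_pos; [lra|apply Rabs_pos]); lra.
  - rewrite Rabs_left by exact Ha.
    assert (H := decr_bound (prim w (snd p)) (fun y => w (y + snd p) * psi y) 0 (0 - snd p) B).
    assert (prim w (snd p) (0 - snd p) - prim w (snd p) 0 <= B * (0 - snd p - 0)); [|lra].
    apply H; [lra|intros; apply (prim_derive w w' Hwd)|].
    intros y Hy; assert (w (y + snd p) <= 1).
    { unfold w; rewrite <- exp_0; apply exp_le, expo_neg; lra. }
    destruct (Hw (y + snd p)) as [Hwy _]; specialize (Hpsi y); nra. }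
assert (Hb : b1 * (prim w a1 0 - prim w a1 (0 - a1)) + B * (b1 * Rabs a1) <=
  lsum l (fun p => fst p * (prim w (snd p) 0 - prim w (snd p) (0 - snd p))
    + B * (fst p * Rabs (snd p)))).
{ apply (lsum_mem_le l (fun p => fst p * (prim w (snd p) 0 - prim w (snd p) (0 - snd p))
    + B * (fst p * Rabs (snd p))) (b1, a1)); assumption. }
rewrite lsum_plus, lsum_scal in Hb; fold moment in Hb.
(* On the right half of the window the weight is evaluated beyond [a1 / 2], where its exponent is at
   least [Z / 2 * (a1 / 2)]. *)
assert (Hbig : a1 / 2 * (eta * exp (Z / 2 * (a1 / 2))) <= prim w a1 0 - prim w a1 (0 - a1)).
{ assert (H1 : 0 * (- (a1 / 2) - (0 - a1)) <= prim w a1 (- (a1 / 2)) - prim w a1 (0 - a1)).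
  { apply (incr_bound (prim w a1) (fun y => w (y + a1) * psi y)); [lra| |].
    - intros; apply (prim_derive w w' Hwd).
    - intros y _; apply Rmult_le_pos; [left; apply exp_pos|apply Hpsi]. }
  assert (H2 : eta * exp (Z / 2 * (a1 / 2)) * (0 - - (a1 / 2)) <= prim w a1 0 - prim w a1 (- (a1 / 2))).
  { apply (incr_bound (prim w a1) (fun y => w (y + a1) * psi y)); [lra| |].
    - intros; apply (prim_derive w w' Hwd).
    - intros y Hy; rewrite Rmult_comm.
      apply Rmult_le_compat; [left; apply exp_pos|lra| |apply Hxm1; lra].
      apply exp_le; apply Rle_trans with (expo Z eps (a1 / 2)); [apply expo_ge; lra|].
      assert (X := incr_bound (expo Z eps) (slope Z eps) (a1 / 2) (y + a1) 0).
      assert (0 * (y + a1 - a1 / 2) <= expo Z eps (y + a1) - expo Z eps (a1 / 2)); [|lra].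
      apply X; [lra|intros; apply expo_derive; assumption|].
      intros; apply slope_bounds; assumption. }
  lra. }
assert (HB1 : 0 <= B * (b1 * Rabs a1))
  by (apply Rmult_le_pos; [lra|apply Rmult_le_pos; [lra|apply Rabs_pos]]).
assert (Hc0 : - (Rabs c * B) <= c * (w 0 * psi 0)).
{ rewrite Hw0, Rmult_1_l; assert (X := Rle_abs (- c)); rewrite Rabs_Ropp in X.
  assert (Y := Rabs_pos c); specialize (Hpsi 0); nra. }
unfold lyap in Hle.
assert (Hexp : C1 / q + 1 + 1 <= exp (Z / 2 * (a1 / 2))).
{ replace (Z / 2 * (a1 / 2)) with (C1 / q + 1) by (unfold Z; field; lra).
  assert (X := exp_ge_1_plus (C1 / q + 1)); lra. }
assert (Hfin : q * exp (Z / 2 * (a1 / 2)) <= b1 * (prim w a1 0 - prim w a1 (0 - a1))).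
{ unfold q; rewrite !Rmult_assoc; apply Rmult_le_compat_l; lra. }
assert (Hqq : q * (C1 / q + 1 + 1) <= q * exp (Z / 2 * (a1 / 2)))
  by (apply Rmult_le_compat_l; lra).
replace (q * (C1 / q + 1 + 1)) with (C1 + 2 * q) in Hqq by (field; lra).
unfold C1 in Hqq; lra.
Qed.

End Lyapunov.

(** * The relaxation operator *)

Lemma RInt_exp_le (f : R -> R) C a S : (forall s, continuous f s) -> 0 < a -> 0 <= C -> 0 <= S ->
  (forall s, 0 <= s <= S -> f s <= C * exp (- (a * s))) -> RInt f 0 S <= C / a.
Proof.
intros Hf Ha HC HS H.
set (G := fun t => RInt f 0 t + C / a * exp (- (a * t))).
assert (HG : G S - G 0 <= 0 * (S - 0)).
{ apply (decr_bound G (fun t => f t + - C * exp (- (a * t)))); [exact HS| |].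
  - intros t _; apply (is_derive_plus (V := R_NormedModule) (fun t => RInt f 0 t));
      [apply derive_primitive, Hf|].
    auto_derive; [auto|]; field; lra.
  - intros t Ht; specialize (H t Ht); lra. }
unfold G in HG; rewrite RInt_point_R, Rmult_0_r, Ropp_0, exp_0 in HG.
assert (0 <= C / a * exp (- (a * S))); [|lra].
apply Rmult_le_pos; [apply Rdiv_le_0_compat; lra|left; apply exp_pos].
Qed.

Lemma RInt_nonneg (f : R -> R) S : (forall s, continuous f s) -> 0 <= S ->
  (forall s, 0 <= f s) -> 0 <= RInt f 0 S.
Proof.
intros Hf HS H.
assert (X := incr_bound (fun t => RInt f 0 t) f 0 S 0 HS
  (fun t _ => derive_primitive f 0 t Hf) (fun t _ => H t)).
cbv beta in X; rewrite RInt_point_R in X; lra.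
Qed.

Lemma RInt_close (f f' : R -> R) S om : (forall s, continuous f s) -> (forall s, continuous f' s) ->
  0 <= S -> 0 <= om -> (forall s, 0 <= s <= S -> Rabs (f s - f' s) <= om) ->
  Rabs (RInt f 0 S - RInt f' 0 S) <= om * S.
Proof.
intros Hf Hf' HS Hom H.
assert (X := abs_bound (fun t => RInt f 0 t - RInt f' 0 t) (fun t => f t - f' t) 0 S om Hom).
cbv beta in X; rewrite !RInt_point_R in X.
rewrite Rminus_0_r, (Rminus_0_r S), (Rabs_pos_eq S), Rminus_0_r in X by exact HS; apply X.
- intros t _; apply (is_derive_minus (V := R_NormedModule) (fun t => RInt f 0 t));
    apply derive_primitive; assumption.
- intros t; rewrite Rmin_left, Rmax_right by exact HS; apply H.
Qed.

Section Relaxation.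

Context (c mu S : R) (h : R -> R) (Hc : c <> 0) (HS : 0 <= S) (Hh : forall y, continuous h y).

(** Variation of constants for [c * u' + mu * u = h], written along the characteristics so that one
    formula serves both signs of [c]. *)
Definition relax (x : R) : R := RInt (fun s => exp (- (mu * s)) * h (x - c * s)) 0 S.

Lemma relax_integrand_continuous x s : continuous (fun s => exp (- (mu * s)) * h (x - c * s)) s.
Proof.
apply (continuous_mult (fun s => exp (- (mu * s))) (fun s => h (x - c * s))).
- apply (is_derive_continuous _ s (- mu * exp (- (mu * s)))); auto_derive; [auto|ring].
- apply (continuous_comp (fun s => x - c * s) h); [|apply Hh].
  apply (is_derive_continuous _ s (- c)); auto_derive; [auto|ring].
Qed.

(** The substitution [y = x - c * s] removes the parameter from the integrand: [relax x] is
    [exp (- (mu / c * x)) / c] times a difference of values of a primitive [P], and this can be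
    differentiated directly. *)
Lemma relax_derive (x : R) :
  is_derive relax x ((h x - exp (- (mu * S)) * h (x - c * S) - mu * relax x) / c).
Proof.
set (k := fun y => exp (mu / c * y) * h y).
assert (Hk : forall y, continuous k y).
{ intros y; apply (continuous_mult (fun y => exp (mu / c * y)) h); [|apply Hh].
  apply (is_derive_continuous _ y (mu / c * exp (mu / c * y))); auto_derive; [auto|ring]. }
set (P := fun y => RInt k 0 y).
assert (HP : forall y, is_derive P y (k y)) by (intros y; apply derive_primitive, Hk).
assert (HPex : forall y, ex_derive P y) by (intros y; eexists; apply HP).
assert (HPD : forall y, Derive P y = k y) by (intros y; apply is_derive_unique, HP).
assert (E : forall x, relax x = exp (- (mu / c * x)) / c * (P x - P (x - c * S))).
{ clear x; intros x; unfold relax.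
  assert (HE : forall t, exp (- (mu / c * x)) * exp (mu / c * (x - c * t)) = exp (- (mu * t))).
  { intros t; rewrite <- exp_plus; f_equal; field; exact Hc. }
  set (f := fun s => exp (- (mu * s)) * h (x - c * s)).
  (* The substitution is verified by differentiating both sides with respect to the cutoff time
     [t]. *)
  set (F := fun t => RInt f 0 t - exp (- (mu / c * x)) / c * (P x - P (x - c * t))).
  assert (HF : Rabs (F S - F 0) <= 0 * Rabs (S - 0)).
  { apply (abs_bound F (fun _ => 0)); [lra| |intros; rewrite Rabs_R0; lra].
    intros t _; replace 0 with (f t - exp (- (mu / c * x)) / c * (c * k (x - c * t))).
    - apply (is_derive_minus (V := R_NormedModule) (fun t => RInt f 0 t)).
      + apply derive_primitive; intros s; apply relax_integrand_continuous.
      + auto_derive; [apply HPex|].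
        change (fun x0 : R => P x0) with P; rewrite HPD; unfold Rminus; ring.
    - unfold f, k; rewrite <- HE; field; exact Hc. }
  rewrite Rmult_0_l in HF; unfold F at 2 in HF; cbv beta in HF.
  rewrite RInt_point_R, Rmult_0_r, Rminus_0_r, Rminus_eq_0, Rmult_0_r, Rminus_0_r, Rminus_0_r in HF.
  apply Rminus_diag_uniq, Rabs_eq_0, Rle_antisym; [exact HF|apply Rabs_pos]. }
apply (is_derive_ext (fun x => exp (- (mu / c * x)) / c * (P x - P (x - c * S)))).
{ intros t; symmetry; apply E. }
rewrite E; auto_derive; [auto|].
change (fun x0 : R => P x0) with P; rewrite !HPD.
replace (x + - (c * S)) with (x - c * S) by ring.
unfold k.
replace (h x) with (exp (- (mu / c * x)) * exp (mu / c * x) * h x) at 2.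
- replace (exp (- (mu * S))) with (exp (- (mu / c * x)) * exp (mu / c * (x - c * S))).
  + field; exact Hc.
  + rewrite <- exp_plus; f_equal; field; exact Hc.
- rewrite <- exp_plus, Rplus_opp_l, exp_0; ring.
Qed.

End Relaxation.

(** * Wave profiles and their limits *)

Lemma lsum_map {A A' : Type} (h : A -> A') (l : list A) f :
  lsum (map h l) f = lsum l (fun a => f (h a)).
Proof. induction l; simpl; [reflexivity|rewrite IHl; reflexivity]. Qed.

Lemma last_above (f : R -> R) L th a b : (forall x y, Rabs (f x - f y) <= L * Rabs (x - y)) ->
  a <= b -> th <= f a ->
  exists x, a <= x <= b /\ th <= f x /\ forall y, x < y <= b -> f y < th.
Proof.
intros HL Hab Ha.
destruct (completeness (fun x => a <= x <= b /\ th <= f x)) as [x [Hub Hlub]].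
- exists b; intros x [H _]; lra.
- exists a; lra.
- assert (Hax : a <= x) by (apply Hub; lra).
  assert (Hxb : x <= b) by (apply Hlub; intros y [Hy _]; lra).
  exists x; split; [lra|split].
  + apply Rnot_lt_le; intros Hlt.
    set (e := (th - f x) / (2 * (Rabs L + 1))).
    assert (HL0 := Rabs_pos L); assert (HL1 := Rle_abs L).
    assert (He : 0 < e) by (apply Rdiv_lt_0_compat; lra).
    assert (Hbd : x <= x - e); [|lra].
    apply Hlub; intros y [Hy1 Hy2]; apply Rnot_lt_le; intros Hye.
    assert (Hyx : y <= x) by (apply Hub; auto).
    assert (H := HL y x); rewrite Rabs_minus_sym with (x := y), (Rabs_pos_eq (x - y)) in H by lra.
    assert (E : (Rabs L + 1) * e = (th - f x) / 2) by (unfold e; field; lra).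
    assert (L * (x - y) <= (Rabs L + 1) * e) by nra.
    apply Rabs_le_between in H; lra.
  + intros y Hy; apply Rnot_le_lt; intros Hle.
    assert (y <= x) by (apply Hub; split; [lra|exact Hle]); lra.
Qed.

Section Equation.

Context (D d r B : R) (beta : Z -> R) (g : R -> R).
Context (HD : 0 < D) (Hd : 0 < d) (Hr : 0 <= r) (HB : 0 < B).
Context (Hbeta : forall k, 0 <= beta k) (Hsum : is_sumZ beta 1).
Context (Hg : forall s, 0 <= g s <= d * B).
Context (Huc : forall om, 0 < om -> exists del, 0 < del /\
     forall s s', Rabs (s - s') <= del -> Rabs (g s - g s') <= om).

Notation mu := (d + 2 * D).

Definition mass (N : nat) : R := lsum (zl N) beta.

Definition rhs (c : R) (N : nat) (phi : R -> R) (y : R) : R :=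
  D * (phi (y + 1) + phi (y - 1))
  + lsum (zl N) (fun k => beta k * g (phi (y - IZR k - c * r))).

(* The equation is solved for its series, which encodes the convergence of the latter. *)
Definition profile (c : R) (phi : R -> R) : Prop :=
  (forall x, 0 <= phi x <= B) /\
  forall x, ex_derive phi x /\
    is_sumZ (fun k => beta k * g (phi (x - IZR k - c * r)))
      (c * Derive phi x + mu * phi x - D * (phi (x + 1) + phi (x - 1))).

(** Covers the solutions of the perturbed equation, whose upper bound is raised by the source, as
    well as exact profiles, for which the error is the tail [d * B * (1 - mass N)]. *)
Definition approx_profile (c : R) (N : nat) (eps : R) (phi : R -> R) : Prop :=
  (forall x, 0 <= phi x <= B + eps) /\
  forall x, ex_derive phi x /\
    Rabs (c * Derive phi x + mu * phi x - rhs c N phi x) <= eps.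

Lemma mass_bounds N : 0 <= mass N <= 1.
Proof.
split; [apply lsum_nonneg; auto|apply lsum_zl_le_sum; auto].
Qed.

Lemma mass_near_1 eps : 0 < eps -> exists N0, forall N, (N0 <= N)%nat -> 1 - eps < mass N.
Proof. apply lsum_zl_near_sum, Hsum. Qed.

Lemma tail_small eps : 0 < eps -> exists N0, forall N, (N0 <= N)%nat ->
  0 <= d * B * (1 - mass N) <= eps.
Proof.
intros Heps; assert (HdB : 0 < d * B) by nra.
destruct (mass_near_1 (eps / (d * B))) as [N0 H]; [apply Rdiv_lt_0_compat; lra|].
exists N0; intros N HN; specialize (H N HN); assert (M := mass_bounds N).
split; [apply Rmult_le_pos; lra|].
apply Rle_trans with (d * B * (eps / (d * B))); [apply Rmult_le_compat_l; lra|].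
right; field; lra.
Qed.

Lemma kernel_dominated c phi y k :
  0 <= beta k * g (phi (y - IZR k - c * r)) <= d * B * beta k.
Proof.
destruct (Hg (phi (y - IZR k - c * r))); specialize (Hbeta k).
split; [apply Rmult_le_pos; assumption|].
rewrite Rmult_comm; apply Rmult_le_compat_r; assumption.
Qed.

Lemma kernel_sum c phi y : exists s,
  is_sumZ (fun k => beta k * g (phi (y - IZR k - c * r))) s /\
  forall N, rhs c N phi y <= D * (phi (y + 1) + phi (y - 1)) + s
    <= rhs c N phi y + d * B * (1 - mass N).
Proof.
destruct (is_sumZ_dominated beta (fun k => beta k * g (phi (y - IZR k - c * r))) (d * B))
  as [s [H1 H2]]; [exact Hsum|apply kernel_dominated|].
exists s; split; [exact H1|]; intros N; specialize (H2 N); unfold rhs, mass; lra.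
Qed.

Lemma rhs_nonneg c N phi y : (forall x, 0 <= phi x) -> 0 <= rhs c N phi y.
Proof.
intros H; unfold rhs; apply Rplus_le_le_0_compat.
- apply Rmult_le_pos; [lra|]; assert (X := H (y + 1)); assert (Y := H (y - 1)); lra.
- apply lsum_nonneg; intros k _; apply kernel_dominated.
Qed.

Lemma rhs_le c N phi y b : (forall x, phi x <= b) -> rhs c N phi y <= 2 * D * b + d * B.
Proof.
intros H; unfold rhs.
assert (X := H (y + 1)); assert (Y := H (y - 1)).
assert (Z : lsum (zl N) (fun k => beta k * g (phi (y - IZR k - c * r))) <= d * B * mass N).
{ unfold mass; rewrite <- lsum_scal; apply lsum_le; intros k _; apply kernel_dominated. }
assert (M := mass_bounds N); assert (0 < d * B) by nra.
assert (d * B * mass N <= d * B * 1) by (apply Rmult_le_compat_l; lra).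
assert (D * (phi (y + 1) + phi (y - 1)) <= D * (b + b)) by (apply Rmult_le_compat_l; lra).
lra.
Qed.

Lemma rhs_mono c n m phi y : (n <= m)%nat ->
  rhs c n phi y <= rhs c m phi y <= rhs c n phi y + d * B * (1 - mass n).
Proof.
intros Hnm; split.
- unfold rhs; apply Rplus_le_compat_l, lsum_zl_incr; [intros; apply kernel_dominated|exact Hnm].
- destruct (kernel_sum c phi y) as [s [_ H]]; destruct (H n); destruct (H m); lra.
Qed.

Lemma rhs_close c c' N phi phi' y y' del om :
  (forall s s', Rabs (s - s') <= del -> Rabs (g s - g s') <= om) ->
  0 <= om ->
  Rabs (phi (y + 1) - phi' (y' + 1)) <= del -> Rabs (phi (y - 1) - phi' (y' - 1)) <= del ->
  (forall k, In k (zl N) ->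
    Rabs (phi (y - IZR k - c * r) - phi' (y' - IZR k - c' * r)) <= del) ->
  Rabs (rhs c N phi y - rhs c' N phi' y') <= 2 * D * del + om.
Proof.
intros Hgc Hom H1 H2 H3; unfold rhs.
set (S1 := lsum _ _); set (S2 := lsum _ (fun k => beta k * g (phi' _))).
assert (HS : Rabs (S1 - S2) <= om).
{ unfold S1, S2; rewrite <- lsum_minus.
  eapply Rle_trans; [apply lsum_abs|].
  apply Rle_trans with (om * mass N).
  - unfold mass; rewrite <- lsum_scal; apply lsum_le; intros k Hk.
    rewrite <- Rmult_minus_distr_l, Rabs_mult, (Rabs_pos_eq (beta k)) by apply Hbeta.
    rewrite Rmult_comm; apply Rmult_le_compat_r; [apply Hbeta|apply Hgc, H3, Hk].
  - assert (M := mass_bounds N); assert (om * mass N <= om * 1) by (apply Rmult_le_compat_l; lra); lra. }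
apply Rabs_le_between in H1; apply Rabs_le_between in H2; apply Rabs_le_between in HS.
apply Rabs_le; nra.
Qed.

Lemma rhs_continuous c N phi : (forall x, continuous phi x) ->
  forall y, continuous (rhs c N phi) y.
Proof.
intros Hphi y; unfold rhs.
apply (continuous_plus (fun y => D * (phi (y + 1) + phi (y - 1)))).
- apply (continuous_mult (fun _ => D)); [apply continuous_const|].
  apply (continuous_plus (fun y => phi (y + 1)) (fun y => phi (y - 1)));
    apply continuous_shift, Hphi.
- apply (lsum_continuous _ (fun k y => beta k * g (phi (y - IZR k - c * r)))).
  intros k _; apply (continuous_mult (fun _ => beta k)); [apply continuous_const|].
  apply (continuous_comp (fun y => phi (y - IZR k - c * r)) g);
    [|apply unif_continuous, Huc].
  apply (continuous_ext (fun y => phi (y + (- IZR k - c * r)))).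
  { intros z; f_equal; ring. }
  apply continuous_shift, Hphi.
Qed.

(** A bound for [c * Derive phi] read off the equation when [phi <= B + 1]; divided by [|c|] it is a
    Lipschitz constant. *)
Definition lip_const : R := 1 + mu * (B + 1) + 2 * D * (B + 1) + d * B.

Lemma lip_const_pos : 0 < lip_const.
Proof. unfold lip_const; nra. Qed.

Lemma approx_profile_derive c N eps phi x : eps <= 1 -> approx_profile c N eps phi ->
  Rabs (c * Derive phi x) <= lip_const.
Proof.
intros Heps [Hb He]; destruct (He x) as [_ H].
assert (H1 := rhs_le c N phi x (B + 1)); assert (H2 := rhs_nonneg c N phi x).
assert (rhs c N phi x <= 2 * D * (B + 1) + d * B)
  by (apply H1; intros z; specialize (Hb z); lra).
assert (0 <= rhs c N phi x) by (apply H2; intros z; apply Hb).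
destruct (Hb x) as [Hx0 Hx1].
assert (mu * phi x <= mu * (B + 1)) by (apply Rmult_le_compat_l; lra).
assert (0 <= mu * phi x) by (apply Rmult_le_pos; lra).
assert (0 < 2 * D * (B + 1)) by nra.
assert (0 < d * B) by nra.
apply Rabs_le_between in H; apply Rabs_le; unfold lip_const; lra.
Qed.

Lemma approx_profile_lip c c0 N eps phi : eps <= 1 -> 0 < c0 <= Rabs c ->
  approx_profile c N eps phi ->
  forall x y, Rabs (phi x - phi y) <= lip_const / c0 * Rabs (x - y).
Proof.
intros Heps Hc H x y.
assert (HL := lip_const_pos).
apply (abs_bound phi (Derive phi)).
- apply Rlt_le, Rdiv_lt_0_compat; lra.
- intros z _; apply Derive_correct, H.
- intros z _; assert (X := approx_profile_derive c N eps phi z Heps H).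
  rewrite Rabs_mult in X; apply Rmult_le_reg_l with c0; [lra|].
  replace (c0 * (lip_const / c0)) with lip_const by (field; lra).
  apply Rle_trans with (2 := X), Rmult_le_compat_r; [apply Rabs_pos|lra].
Qed.

Lemma profile_rhs c phi N x : profile c phi ->
  rhs c N phi x <= c * Derive phi x + mu * phi x <= rhs c N phi x + d * B * (1 - mass N).
Proof.
intros [_ H]; destruct (H x) as [_ Hs].
destruct (kernel_sum c phi x) as [s [H1 H2]].
assert (E := is_sumZ_unique _ _ _ Hs H1); specialize (H2 N); lra.
Qed.

Lemma profile_approx c phi N eps : profile c phi -> d * B * (1 - mass N) <= eps ->
  approx_profile c N eps phi.
Proof.
intros H He.
assert (M := mass_bounds N); assert (0 <= d * B * (1 - mass N)) by (apply Rmult_le_pos; nra).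
split.
- intros x; destruct H as [H _]; specialize (H x); lra.
- intros x; split; [apply H|].
  assert (X := profile_rhs c phi N x H); apply Rabs_le; lra.
Qed.

Lemma profile_translate c phi a : profile c phi -> profile c (fun x => phi (x + a)).
Proof.
intros [Hb He]; split; [intros x; apply Hb|]; intros x.
destruct (He (x + a)) as [H1 H2].
destruct (translate_derive phi a x H1) as [E1 E2]; split; [exact E1|]; rewrite E2.
replace (x + 1 + a) with (x + a + 1) by ring; replace (x - 1 + a) with (x + a - 1) by ring.
revert H2; apply is_sumZ_ext; intros k; do 3 f_equal; ring.
Qed.

Lemma approx_translate c N eps phi a : approx_profile c N eps phi ->
  approx_profile c N eps (fun x => phi (x + a)).
Proof.
intros [Hb He]; split; [intros x; apply Hb|]; intros x.
destruct (He (x + a)) as [H1 H2].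
destruct (translate_derive phi a x H1) as [E1 E2]; split; [exact E1|]; rewrite E2.
replace (rhs c N (fun x0 : R => phi (x0 + a)) x) with (rhs c N phi (x + a)); [exact H2|].
unfold rhs; f_equal; [do 2 f_equal; f_equal; ring|].
apply lsum_ext; intros k; do 3 f_equal; ring.
Qed.

Lemma profile_lip c phi : c <> 0 -> profile c phi ->
  forall x y, Rabs (phi x - phi y) <= lip_const / Rabs c * Rabs (x - y).
Proof.
intros Hc H; destruct (tail_small 1) as [N HN]; [lra|].
apply (approx_profile_lip c _ N 1); [lra| |].
- assert (X := Rabs_pos_lt c Hc); lra.
- apply profile_approx; [exact H|apply (HN N); lia].
Qed.

Section Limit.

Context (U : (nat -> Prop) -> Prop) (HU : ultrafilter U).
Context (c : R) (Nn : nat -> nat) (cn eps : nat -> R) (f : nat -> R -> R).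
Context (Hc : c <> 0) (Hcn : is_lim_seq cn (Finite c)) (Hcb : forall n, Rabs c / 2 <= Rabs (cn n)).
Context (HNn : forall n, (n <= Nn n)%nat).
Context (Heps : forall n, eps n <= 1) (Heps0 : is_lim_seq eps (Finite 0)).
Context (Hf : forall n, approx_profile (cn n) (Nn n) (eps n) (f n)).

Notation L := (lip_const / (Rabs c / 2)).

Lemma limit_L_pos : 0 < L.
Proof.
assert (X := Rabs_pos_lt c Hc); assert (Y := lip_const_pos).
apply Rdiv_lt_0_compat; lra.
Qed.

Lemma limit_lip n x y : Rabs (f n x - f n y) <= L * Rabs (x - y).
Proof.
apply (approx_profile_lip (cn n) _ (Nn n) (eps n)); auto.
assert (X := Rabs_pos_lt c Hc); split; [lra|apply Hcb].
Qed.

Context (psi : R -> R) (Hpsi : is_ulim_loc U f psi).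
Context (HpsiL : forall x y, Rabs (psi x - psi y) <= L * Rabs (x - y)).

Definition full_rhs (y : R) : R :=
  D * (psi (y + 1) + psi (y - 1)) + SeriesZ (fun k => beta k * g (psi (y - IZR k - c * r))).

Lemma full_rhs_bounds y N :
  rhs c N psi y <= full_rhs y <= rhs c N psi y + d * B * (1 - mass N).
Proof.
destruct (kernel_sum c psi y) as [s [H1 H2]]; unfold full_rhs.
rewrite (is_sumZ_SeriesZ _ _ H1); apply H2.
Qed.

Lemma full_rhs_uc om : 0 < om -> exists del, 0 < del /\
  forall y y', Rabs (y - y') <= del -> Rabs (full_rhs y - full_rhs y') <= om.
Proof.
intros Hom.
destruct (Huc (om / 3)) as [d0 [Hd0 Hg0]]; [lra|].
set (d1 := Rmin d0 (om / (6 * D))).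
assert (Hd1 : 0 < d1) by (apply Rmin_pos; [lra|apply Rdiv_lt_0_compat; lra]).
assert (Hd1' : 2 * D * d1 <= om / 3).
{ apply Rle_trans with (2 * D * (om / (6 * D))); [|right; field; lra].
  apply Rmult_le_compat_l; [lra|apply Rmin_r]. }
assert (HLp := limit_L_pos).
destruct (tail_small (om / 3)) as [N HN]; [lra|]; specialize (HN N (le_n _)).
exists (d1 / L); split; [apply Rdiv_lt_0_compat; lra|].
intros y y' Hy.
assert (Hcl : forall a, Rabs (psi (y + a) - psi (y' + a)) <= d1).
{ intros a; eapply Rle_trans; [apply HpsiL|].
  replace (y + a - (y' + a)) with (y - y') by ring.
  replace d1 with (L * (d1 / L)); [apply Rmult_le_compat_l; lra|].
  assert (X := Rabs_pos_lt c Hc); assert (Y := lip_const_pos); field; lra. }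
assert (H : Rabs (rhs c N psi y - rhs c N psi y') <= 2 * D * d1 + om / 3).
{ apply rhs_close; try lra.
  - intros s s' Hs; apply Hg0; apply Rle_trans with (1 := Hs), Rmin_l.
  - apply Hcl.
  - apply Hcl.
  - intros k _; replace (y - IZR k - c * r) with (y + (- IZR k - c * r)) by ring.
    replace (y' - IZR k - c * r) with (y' + (- IZR k - c * r)) by ring; apply Hcl. }
assert (X := full_rhs_bounds y N); assert (Y := full_rhs_bounds y' N).
apply Rabs_le_between in H; apply Rabs_le; lra.
Qed.

(** A cut at a fixed [M] costs little uniformly in [n], and finitely many shifts only see a bounded
    interval. The Lipschitz bound of [psi] absorbs the difference between the delays [cn n * r] and
    [c * r]. *)
Lemma rhs_ulim A om : 0 < om ->
  U (fun n => forall y, Rabs y <= A -> Rabs (rhs (cn n) (Nn n) (f n) y - full_rhs y) <= om).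
Proof.
intros Hom.
destruct (Huc (om / 4)) as [d0 [Hd0 Hg0]]; [lra|].
set (d1 := Rmin d0 (om / (8 * D))).
assert (Hd1 : 0 < d1) by (apply Rmin_pos; [lra|apply Rdiv_lt_0_compat; lra]).
assert (Hd1' : 2 * D * d1 <= om / 4).
{ apply Rle_trans with (2 * D * (om / (8 * D))); [|right; field; lra].
  apply Rmult_le_compat_l; [lra|apply Rmin_r]. }
assert (HLp := limit_L_pos).
destruct (tail_small (om / 4)) as [M HM]; [lra|]; specialize (HM M (le_n _)).
set (e := Rmin 1 (d1 / (2 * L * (r + 1)))).
assert (He : 0 < e).
{ apply Rmin_pos; [lra|]; apply Rdiv_lt_0_compat; [lra|].
  apply Rmult_lt_0_compat; [apply Rmult_lt_0_compat; [lra|exact HLp]|lra]. }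
assert (He' : L * (e * r) <= d1 / 2).
{ apply Rle_trans with (L * (d1 / (2 * L * (r + 1)) * (r + 1))).
  - apply Rmult_le_compat_l; [lra|]; apply Rmult_le_compat; try lra.
    apply Rmin_r.
  - right; assert (X := Rabs_pos_lt c Hc); assert (Y := lip_const_pos); field; lra. }
assert (E1 := is_ulim_seq U HU cn c Hcn e He).
assert (E2 := Hpsi (A + INR M + 2 + (Rabs c + 1) * r) (d1 / 2) ltac:(lra)).
apply (uf_mono U HU _ _) with (2 := uf_and U HU _ _ (uf_tail U HU M) (uf_and U HU _ _ E1 E2)).
intros n [Hn [Hce Hfn]] y Hy.
assert (Hce1 : Rabs (cn n - c) <= 1) by (apply Rle_trans with (1 := Hce), Rmin_l).
assert (HMn := pos_INR M).
assert (Hcr : 0 <= (Rabs c + 1) * r) by (apply Rmult_le_pos; [assert (X := Rabs_pos c); lra|lra]).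
assert (H : Rabs (rhs (cn n) M (f n) y - rhs c M psi y) <= 2 * D * d1 + om / 4).
{ assert (Hy' := Hy); apply Rabs_le_between in Hy'.
  apply rhs_close; try lra.
  - intros s s' Hs; apply Hg0; apply Rle_trans with (1 := Hs), Rmin_l.
  - apply Rle_trans with (d1 / 2); [|lra]; apply Hfn, Rabs_le; lra.
  - apply Rle_trans with (d1 / 2); [|lra]; apply Hfn, Rabs_le; lra.
  - intros k Hk; apply zl_bound in Hk.
    replace (f n (y - IZR k - cn n * r) - psi (y - IZR k - c * r)) with
      ((f n (y - IZR k - cn n * r) - psi (y - IZR k - cn n * r))
       + (psi (y - IZR k - cn n * r) - psi (y - IZR k - c * r))) by ring.
    eapply Rle_trans; [apply Rabs_triang|].
    replace d1 with (d1 / 2 + d1 / 2) by lra; apply Rplus_le_compat.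
    + apply Hfn.
      assert (Hcnr : Rabs (cn n * r) <= (Rabs c + 1) * r).
      { rewrite Rabs_mult, (Rabs_pos_eq r) by lra; apply Rmult_le_compat_r; [lra|].
        replace (cn n) with (c + (cn n - c)) by ring.
        eapply Rle_trans; [apply Rabs_triang|lra]. }
      apply Rabs_le_between in Hcnr; apply Rabs_le_between in Hk; apply Rabs_le; lra.
    + eapply Rle_trans; [apply HpsiL|]; apply Rle_trans with (2 := He').
      apply Rmult_le_compat_l; [lra|].
      replace (y - IZR k - cn n * r - (y - IZR k - c * r)) with (- ((cn n - c) * r)) by ring.
      rewrite Rabs_Ropp, Rabs_mult, (Rabs_pos_eq r) by lra; apply Rmult_le_compat_r; lra. }
assert (X := full_rhs_bounds y M); assert (Y := rhs_mono (cn n) M (Nn n) (f n) y (Nat.le_trans _ _ _ Hn (HNn n))).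
apply Rabs_le_between in H; apply Rabs_le; lra.
Qed.

Lemma slope_continuous y : continuous (fun y => (full_rhs y - mu * psi y) / c) y.
Proof.
apply continuous_Rdiv; [|apply continuous_const|exact Hc].
apply (continuous_minus full_rhs (fun y => mu * psi y)).
- apply unif_continuous, full_rhs_uc.
- apply (continuous_mult (fun _ => mu) psi); [apply continuous_const|].
  apply (lip_continuous _ _ HpsiL).
Qed.

(** The limit is taken in the integrated equation, since the derivatives of the [f n] are not known
    to converge beforehand; their common bound allows replacing [cn n] by [c]. *)
Lemma full_rhs_integral x : psi x - psi 0 =
  RInt (fun y => (full_rhs y - mu * psi y) / c) 0 x.
Proof.
assert (HLp := limit_L_pos); assert (Hc' := Rabs_pos_lt c Hc).
set (I := fun x => RInt (fun y => (full_rhs y - mu * psi y) / c) 0 x).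
assert (HI : forall y, is_derive I y ((full_rhs y - mu * psi y) / c)).
{ intros y; apply (derive_primitive (fun y => (full_rhs y - mu * psi y) / c)), slope_continuous. }
apply Rminus_diag_uniq, Rabs_eq_0, Rle_antisym; [|apply Rabs_pos].
apply Rabs_bound_0; intros e He.
change (Rabs (psi x - psi 0 - I x) <= e).
set (K := (L + 2 + mu) / Rabs c * Rabs x + 2).
assert (HK : 2 <= K).
{ assert (0 <= (L + 2 + mu) / Rabs c * Rabs x); [|unfold K; lra].
  apply Rmult_le_pos; [|apply Rabs_pos]; apply Rlt_le, Rdiv_lt_0_compat; lra. }
set (w := e / K).
assert (Hw : 0 < w) by (apply Rdiv_lt_0_compat; lra).
destruct (uf_ex U HU _ (uf_and U HU _ _ (is_ulim_seq U HU cn c Hcn w Hw)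
  (uf_and U HU _ _ (is_ulim_seq U HU eps 0 Heps0 w Hw)
  (uf_and U HU _ _ (Hpsi (Rabs x) w Hw) (rhs_ulim (Rabs x) w Hw)))))
  as [n [H1 [H2 [H3 H4]]]].
assert (H0 : I 0 = 0) by apply RInt_point_R.
assert (Hdiff : Rabs ((f n x - I x) - (f n 0 - I 0)) <= (L + 2 + mu) / Rabs c * w * Rabs (x - 0)).
{ apply (abs_bound (fun y => f n y - I y)
    (fun y => Derive (f n) y - (full_rhs y - mu * psi y) / c)).
  - apply Rmult_le_pos; [apply Rlt_le, Rdiv_lt_0_compat|]; lra.
  - intros y _; apply (is_derive_minus (f n) I); [|apply HI].
    apply Derive_correct, Hf.
  - intros y Hy.
    assert (Hyx : Rabs y <= Rabs x).
    { unfold Rmin, Rmax in Hy; destruct (Rle_dec 0 x);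
      unfold Rabs; destruct (Rcase_abs y); destruct (Rcase_abs x); lra. }
    destruct (Hf n) as [_ Hn]; destruct (Hn y) as [_ Hny].
    specialize (H3 y Hyx); specialize (H4 y Hyx).
    replace (Derive (f n) y - (full_rhs y - mu * psi y) / c) with
      (((cn n * Derive (f n) y + mu * f n y - rhs (cn n) (Nn n) (f n) y)
       + (rhs (cn n) (Nn n) (f n) y - full_rhs y) - mu * (f n y - psi y)
       - (cn n - c) * Derive (f n) y) / c) by (field; exact Hc).
    unfold Rdiv at 1; rewrite Rabs_mult, Rabs_inv.
    replace ((L + 2 + mu) / Rabs c * w) with ((L + 2 + mu) * w * / Rabs c) by (field; lra).
    apply Rmult_le_compat_r; [left; apply Rinv_0_lt_compat; lra|].
    assert (HDL : Rabs (Derive (f n) y) <= L).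
    { assert (Z := approx_profile_derive (cn n) (Nn n) (eps n) (f n) y (Heps n) (Hf n)).
      rewrite Rabs_mult in Z; apply Rmult_le_reg_l with (Rabs c / 2); [lra|].
      replace (Rabs c / 2 * L) with lip_const by (field; lra).
      apply Rle_trans with (2 := Z), Rmult_le_compat_r; [apply Rabs_pos|apply Hcb]. }
    assert (Z1 : Rabs ((cn n - c) * Derive (f n) y) <= w * L).
    { rewrite Rabs_mult; apply Rmult_le_compat; try apply Rabs_pos; assumption. }
    assert (Z2 : Rabs (mu * (f n y - psi y)) <= mu * w).
    { rewrite Rabs_mult, (Rabs_pos_eq mu) by lra; apply Rmult_le_compat_l; lra. }
    rewrite Rminus_0_r in H2.
    assert (He2 := Rle_abs (eps n)).
    apply Rabs_le_between in Z1; apply Rabs_le_between in Z2.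
    apply Rabs_le_between in Hny; apply Rabs_le_between in H4; apply Rabs_le; lra. }
rewrite H0, Rminus_0_r, Rminus_0_r in Hdiff.
assert (H3x := H3 x (Rle_refl _)).
assert (H30 := H3 0 ltac:(rewrite Rabs_R0; apply Rabs_pos)).
assert (E : K * w = e) by (unfold w; field; lra).
unfold K in E.
apply Rabs_le_between in H3x; apply Rabs_le_between in H30; apply Rabs_le_between in Hdiff.
apply Rabs_le; lra.
Qed.

Lemma limit_is_profile : (forall x, 0 <= psi x <= B) -> profile c psi.
Proof.
intros Hb; split; [exact Hb|]; intros x.
assert (HD' : is_derive psi x ((full_rhs x - mu * psi x) / c)).
{ apply (is_derive_ext (fun x => psi 0 + RInt (fun y => (full_rhs y - mu * psi y) / c) 0 x)).
  { intros t; rewrite <- full_rhs_integral; apply Rplus_minus. }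
  replace ((full_rhs x - mu * psi x) / c) with (0 + (full_rhs x - mu * psi x) / c) by ring.
  apply (is_derive_plus (V := R_NormedModule) (fun _ => psi 0)); [apply (is_derive_const (V := R_NormedModule))|].
  apply (derive_primitive (fun y => (full_rhs y - mu * psi y) / c)), slope_continuous. }
split; [eexists; exact HD'|].
rewrite (is_derive_unique psi x _ HD').
destruct (kernel_sum c psi x) as [s [H1 _]].
replace (_ - _) with s; [exact H1|].
unfold full_rhs; rewrite (is_sumZ_SeriesZ _ _ H1); field; exact Hc.
Qed.

End Limit.

Lemma limit_profile U (HU : ultrafilter U) c (Nn : nat -> nat) (cn eps : nat -> R) (f : nat -> R -> R) :
  c <> 0 -> is_lim_seq cn (Finite c) -> (forall n, Rabs c / 2 <= Rabs (cn n)) ->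
  (forall n, (n <= Nn n)%nat) -> (forall n, eps n <= 1) -> is_lim_seq eps (Finite 0) ->
  (forall n, approx_profile (cn n) (Nn n) (eps n) (f n)) ->
  exists psi, is_ulim_loc U f psi /\ profile c psi.
Proof.
intros Hc Hcn Hcb HNn Heps Heps0 Hf.
destruct (equilip_ulim U HU f 0 (B + 1) (lip_const / (Rabs c / 2))) as [psi [H1 [H2 H3]]].
- intros n x; destruct (Hf n) as [Hb _]; specialize (Hb x); specialize (Heps n); lra.
- intros n x y; apply (limit_lip c Nn cn eps f); assumption.
- exists psi; split; [exact H1|].
  apply (limit_is_profile U HU c Nn cn eps f); auto.
  intros x; split; [apply H2|].
  (* Compactness only gives the bound [B + 1]; it improves to [B] because [eps n] tends to 0. *)
  apply Rnot_lt_le; intros Hlt.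
  set (e := (psi x - B) / 3).
  assert (He : 0 < e) by (unfold e; lra).
  destruct (uf_ex U HU _ (uf_and U HU _ _ (is_ulim_seq U HU eps 0 Heps0 e He)
    (H1 (Rabs x) e He))) as [n [E1 E2]].
  specialize (E2 x (Rle_refl _)); destruct (Hf n) as [Hb _]; specialize (Hb x).
  apply Rabs_le_between in E1; apply Rabs_le_between in E2; unfold e in *; lra.
Qed.

(** * Small profiles *)

(** The value of [rhs c N phi] at [y] depends only on [phi] within this distance of [y]. *)
Definition reach (c : R) (N : nat) : R := INR N + 2 + Rabs c * r.

Lemma reach_pos c N : 0 < reach c N.
Proof.
unfold reach; assert (H := pos_INR N); assert (H' := Rabs_pos c); nra.
Qed.

Lemma reach_bound c N k : In k (zl N) -> Rabs (IZR k + c * r) <= reach c N.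
Proof.
intros Hk; apply zl_bound in Hk; unfold reach.
eapply Rle_trans; [apply Rabs_triang|]; rewrite Rabs_mult, (Rabs_pos_eq r) by lra; lra.
Qed.

Lemma rhs_ge c N phi m G X :
  (forall x, X <= x -> m <= phi x /\ G <= g (phi x)) ->
  forall y, X + reach c N <= y -> 2 * D * m + mass N * G <= rhs c N phi y.
Proof.
intros H y Hy; unfold rhs.
assert (HN := pos_INR N); assert (Hcr : 0 <= Rabs c * r) by (apply Rmult_le_pos; [apply Rabs_pos|lra]).
apply Rplus_le_compat.
- assert (H1 := proj1 (H (y + 1) ltac:(unfold reach in *; lra))).
  assert (H2 := proj1 (H (y - 1) ltac:(unfold reach in *; lra))); nra.
- unfold mass; rewrite Rmult_comm, <- lsum_scal; apply lsum_le; intros k Hk.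
  rewrite Rmult_comm; apply Rmult_le_compat_l; [apply Hbeta|apply H].
  apply reach_bound with (c := c) in Hk; apply Rabs_le_between in Hk; lra.
Qed.

(** Far to the right the right-hand side is at least [2 * D * m + mass N * G], and the solution
    relaxes to at least this value divided by [mu], up to a small error. *)
Lemma profile_relax c phi m G X K : profile c phi -> 0 <= K ->
  (forall x, X <= x -> m <= phi x /\ G <= g (phi x)) ->
  mu * K < 2 * D * m + G -> 0 <= G ->
  exists X', forall x, X' <= x -> K <= phi x.
Proof.
intros Hphi HK H Hlt HG.
(* A third of the gap is spent on raising [K] by [e], another on the mass lost by the cut. *)
set (e := (2 * D * m + G - mu * K) / (3 * mu)).
assert (He : 0 < e) by (apply Rdiv_lt_0_compat; lra).
assert (E : mu * e = (2 * D * m + G - mu * K) / 3) by (unfold e; field; lra).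
destruct (mass_near_1 (mu * e / (G + 1))) as [N HN]; [apply Rdiv_lt_0_compat; nra|].
specialize (HN N (le_n _)).
assert (E2 : mu * e / (G + 1) * (G + 1) = mu * e) by (field; lra).
destruct (relax_lower c mu (K + e) (X + reach c N) phi) with (e := e) as [X' HX']; try lra.
- intros x; apply Hphi.
- intros x; apply Hphi.
- intros x Hx; assert (H1 := rhs_ge c N phi m G X H x Hx).
  destruct (profile_rhs c phi N x Hphi) as [H2 _].
  apply Rle_trans with (2 := H2), Rle_trans with (2 := H1).
  assert (0 <= mu * e / (G + 1)) by (apply Rdiv_le_0_compat; nra).
  nra.
- exists X'; intros x Hx; specialize (HX' x Hx); lra.
Qed.

Context (g0 rho zeta : R).
Context (Hlin : forall s, 0 <= s -> g s <= g0 * s).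
Context (Hzeta : 0 < zeta) (Hrho : 1 < rho).
Context (Hlow : forall s, 0 <= s -> rho * d * Rmin s zeta <= g s).
Context (Hg0 : d < g0).
Context (Hder : forall eta, 0 < eta -> exists th, 0 < th /\
  forall s, 0 <= s <= th -> (g0 - eta) * s <= g s).

(** Up to [zeta] one has [g s >= rho * d * s] with [rho > 1], so an eventual lower bound [m <= zeta]
    is multiplied by [rho1] after relaxation. *)
Lemma persist_step c N phi rho1 : (forall x, 0 <= phi x) -> (forall x, ex_derive phi x) ->
  (forall x, 0 <= x -> rhs c N phi x <= c * Derive phi x + mu * phi x) ->
  1 < rho1 -> mu * rho1 < 2 * D + rho * d * mass N ->
  forall m X, 0 < m -> (forall x, X <= x -> Rmin m zeta <= phi x) ->
  exists X', forall x, X' <= x -> rho1 * Rmin m zeta <= phi x.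
Proof.
intros Hpos Hex Hineq H1 H2 m0 X Hm0 HX.
set (m := Rmin m0 zeta) in *.
assert (Hm : 0 < m) by (apply Rmin_pos; assumption).
assert (Hmz : m <= zeta) by apply Rmin_r.
set (K := (2 * D + rho * d * mass N) * m / mu).
assert (HK : mu * K = (2 * D + rho * d * mass N) * m) by (unfold K; field; lra).
assert (HM := mass_bounds N).
assert (Hrd : 0 < rho * d) by nra.
destruct (relax_lower c mu K (Rmax X 0 + reach c N) phi) with (e := K - rho1 * m) as [X' HX'].
- lra.
- apply Rdiv_le_0_compat; [apply Rmult_le_pos; nra|lra].
- exact Hpos.
- exact Hex.
- intros x Hx; rewrite HK.
  assert (R1 := reach_pos c N); assert (R2 := Rmax_l X 0); assert (R3 := Rmax_r X 0).
  apply Rle_trans with (rhs c N phi x); [|apply Hineq; lra].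
  apply Rle_trans with (2 * D * m + mass N * (rho * d * m)); [right; ring|].
  apply rhs_ge with (X := X); [|lra].
  intros y Hy; split; [apply HX; exact Hy|].
  apply Rle_trans with (2 := Hlow _ (Hpos y)); apply Rmult_le_compat_l; [lra|].
  apply Rmin_glb; [apply HX; exact Hy|exact Hmz].
- apply Rmult_lt_reg_l with mu; [lra|]; rewrite Rmult_0_r, Rmult_minus_distr_l, HK.
  rewrite <- Rmult_assoc, <- Rmult_minus_distr_r; apply Rmult_lt_0_compat; lra.
- exists X'; intros x Hx; specialize (HX' x Hx); lra.
Qed.

(** The bound grows geometrically until it reaches [zeta], which Bernoulli's inequality guarantees
    after finitely many steps; one further step carries it beyond [zeta]. *)
Lemma persist c N phi rho1 : (forall x, 0 <= phi x) -> (forall x, ex_derive phi x) ->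
  (forall x, 0 <= x -> rhs c N phi x <= c * Derive phi x + mu * phi x) ->
  1 < rho1 -> mu * rho1 < 2 * D + rho * d * mass N ->
  (exists m X, 0 < m /\ forall x, X <= x -> m <= phi x) ->
  exists X, forall x, X <= x -> rho1 * zeta <= phi x.
Proof.
intros Hpos Hex Hineq H1 H2 [m [X [Hm HX]]].
assert (Hp : forall j, 0 < rho1 ^ j * m) by (intros j; apply Rmult_lt_0_compat; [apply pow_lt; lra|exact Hm]).
assert (Hj : forall j, exists X, forall x, X <= x -> Rmin (rho1 ^ j * m) zeta <= phi x).
{ induction j as [|j [Xj HXj]].
  - exists X; intros x Hx; eapply Rle_trans; [apply Rmin_l|]; simpl; rewrite Rmult_1_l; auto.
  - destruct (persist_step c N phi rho1 Hpos Hex Hineq H1 H2 _ Xj (Hp j) HXj) as [X' HX'].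
    exists X'; intros x Hx; specialize (HX' x Hx); apply Rle_trans with (2 := HX').
    unfold Rmin; simpl; destruct (Rle_dec (rho1 ^ j * m) zeta);
    destruct (Rle_dec (rho1 * rho1 ^ j * m) zeta); nra. }
destruct (nfloor_ex (zeta / (m * (rho1 - 1)))) as [j [_ Hjj]]; [apply Rdiv_le_0_compat; nra|].
destruct (Hj (S j)) as [Xj HXj].
assert (Hbig : zeta <= rho1 ^ (S j) * m).
{ assert (X1 := poly (S j) (rho1 - 1) ltac:(lra)).
  replace (1 + (rho1 - 1)) with rho1 in X1 by ring.
  assert (X2 : zeta / (m * (rho1 - 1)) * (m * (rho1 - 1)) = zeta) by (field; lra).
  rewrite S_INR in X1.
  assert (0 < m * (rho1 - 1)) by nra.
  assert (zeta <= (INR j + 1) * (rho1 - 1) * m) by nra.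
  nra. }
destruct (persist_step c N phi rho1 Hpos Hex Hineq H1 H2 _ Xj (Hp (S j)) HXj) as [X' HX'].
rewrite Rmin_right in HX' by exact Hbig.
exists X'; exact HX'.
Qed.

(** A zero is a minimum, so the derivative vanishes too, and every nonnegative term on the
    right-hand side must be 0. *)
Lemma zero_neighbours c phi y : profile c phi -> phi y = 0 -> phi (y + 1) = 0 /\ phi (y - 1) = 0.
Proof.
intros [Hb He] Hy; destruct (He y) as [Hex Hs].
assert (HD0 : Derive phi y = 0).
{ assert (pr : derivable_pt phi y) by (apply ex_derive_Reals_0; exact Hex).
  rewrite <- (Derive_Reals phi y pr).
  apply (deriv_minimum phi (y - 1) (y + 1)); try lra.
  intros x _ _; rewrite Hy; apply Hb. }
assert (H := lsum_zl_le_sum _ _ 0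
  (fun k => proj1 (kernel_dominated c phi y k)) Hs).
rewrite HD0, Hy in H.
assert (H' := lsum_nonneg (zl 0) (fun k => beta k * g (phi (y - IZR k - c * r)))
  (fun k _ => proj1 (kernel_dominated c phi y k))).
assert (H1 := proj1 (Hb (y + 1))); assert (H2 := proj1 (Hb (y - 1))).
split; nra.
Qed.

(** Since [c * phi' + mu * phi >= 0], the function [exp (- mu * s) * phi (y - c * s)] is
    nonincreasing in [s]; it starts at 0 and stays nonnegative. *)
Lemma zero_upstream c phi y s : profile c phi -> phi y = 0 -> 0 <= s -> phi (y - c * s) = 0.
Proof.
intros Hp Hy Hs; assert (Hb := proj1 Hp).
set (h := fun s => exp (mu * - s) * phi (y - c * s)).
assert (H : h s - h 0 <= 0 * (s - 0)).
{ apply (decr_bound h (fun s => - exp (mu * - s) *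
    (c * Derive phi (y - c * s) + mu * phi (y - c * s)))); [exact Hs| |].
  - intros t Ht; unfold h.
    auto_derive; [apply Hp|].
    change (fun x0 : R => phi x0) with phi; unfold Rminus; ring.
  - intros t Ht.
    destruct (profile_rhs c phi 0 (y - c * t) Hp) as [H1 _].
    assert (H2 := rhs_nonneg c 0 phi (y - c * t) (fun x => proj1 (Hb x))).
    assert (H3 := exp_pos (mu * - t)); nra. }
unfold h in H; rewrite Rmult_0_r in H; rewrite Rminus_0_r in H; rewrite Hy in H.
assert (H1 := exp_pos (mu * - s)); assert (H2 := proj1 (Hb (y - c * s))); nra.
Qed.

(** Zeros spread by unit steps in both directions through the diffusion, and continuously against
    the sign of [c]. From a zero beyond [x1] on the appropriate side the second mechanism reaches
    [x1]. *)
Lemma profile_positive c phi x1 : c <> 0 -> profile c phi -> 0 < phi x1 -> forall x, 0 < phi x.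
Proof.
intros Hc Hp Hx1 x; destruct (proj1 (proj1 Hp x)) as [|Hx]; [assumption|exfalso].
symmetry in Hx.
assert (Hn : forall n : nat, phi (x + INR n) = 0 /\ phi (x - INR n) = 0).
{ induction n as [|n [H1 H2]].
  - simpl; rewrite Rplus_0_r, Rminus_0_r; auto.
  - rewrite S_INR; split.
    + replace (x + (INR n + 1)) with (x + INR n + 1) by ring.
      apply (zero_neighbours c phi _ Hp H1).
    + replace (x - (INR n + 1)) with (x - INR n - 1) by ring.
      apply (zero_neighbours c phi _ Hp H2). }
destruct (nfloor_ex (Rabs (x1 - x))) as [n [_ H]]; [apply Rabs_pos|].
apply Rabs_lt_between in H.
destruct (Hn (S n)) as [H1 H2]; rewrite S_INR in H1, H2.
destruct (Rlt_le_dec 0 c) as [Hc0|Hc0].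
- assert (E := zero_upstream c phi _ ((x + (INR n + 1) - x1) / c) Hp H1
    ltac:(apply Rdiv_le_0_compat; lra)).
  replace (x + (INR n + 1) - c * ((x + (INR n + 1) - x1) / c)) with x1 in E by (field; lra); lra.
- assert (E := zero_upstream c phi _ ((x1 - (x - (INR n + 1))) / (- c)) Hp H2
    ltac:(apply Rdiv_le_0_compat; lra)).
  replace (x - (INR n + 1) - c * ((x1 - (x - (INR n + 1))) / - c)) with x1 in E by (field; lra); lra.
Qed.

(* [sgn = -1] serves the reflected profile. *)
Definition lin_kernel (sgn c eta : R) (N : nat) : list (R * R) :=
  (D, 1) :: (D, -1) :: map (fun k => ((g0 - eta) * beta k, sgn * (IZR k + c * r))) (zl N).

Lemma lsum_lin_kernel sgn c eta N f : lsum (lin_kernel sgn c eta N) f =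
  f (D, 1) + f (D, -1) + lsum (zl N) (fun k => f ((g0 - eta) * beta k, sgn * (IZR k + c * r))).
Proof. unfold lin_kernel; simpl; rewrite lsum_map; ring. Qed.

Lemma lin_kernel_nonneg sgn c eta N p : eta <= g0 -> In p (lin_kernel sgn c eta N) -> 0 <= fst p.
Proof.
intros Heta [<-|[<-|H]]; simpl; try lra.
apply in_map_iff in H; destruct H as [k [<- _]]; simpl; apply Rmult_le_pos; [lra|apply Hbeta].
Qed.

Lemma lin_lower c phi th eta N x : profile c phi ->
  (forall s, 0 <= s <= th -> (g0 - eta) * s <= g s) ->
  (forall k, In k (zl N) -> phi (x - IZR k - c * r) <= th) ->
  D * (phi (x + 1) + phi (x - 1))
    + lsum (zl N) (fun k => (g0 - eta) * beta k * phi (x - IZR k - c * r))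
  <= c * Derive phi x + mu * phi x.
Proof.
intros Hp Hth Hx.
destruct (profile_rhs c phi N x Hp) as [H _].
apply Rle_trans with (2 := H); unfold rhs; apply Rplus_le_compat_l, lsum_le; intros k Hk.
replace ((g0 - eta) * beta k * phi (x - IZR k - c * r))
  with (beta k * ((g0 - eta) * phi (x - IZR k - c * r))) by ring.
apply Rmult_le_compat_l; [apply Hbeta|apply Hth; split; [apply Hp|apply Hx, Hk]].
Qed.

(** A quarter of the gap [g0 - d] is given up to the linearisation and a quarter to the missing
    mass, so half remains. *)
Lemma lin_parameters : exists eta N, 0 < eta <= g0 /\ (g0 + d) / 2 <= (g0 - eta) * mass N.
Proof.
exists ((g0 - d) / 4).
destruct (mass_near_1 ((g0 - d) / (4 * g0))) as [N HN]; [apply Rdiv_lt_0_compat; lra|].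
specialize (HN N (le_n _)); exists N; split; [lra|].
assert (E : (g0 - d) / (4 * g0) * g0 = (g0 - d) / 4) by (field; lra).
assert (M := mass_bounds N).
nra.
Qed.

Lemma mass_lin_kernel eta N : lsum (zl N) (fun k => (g0 - eta) * beta k) = (g0 - eta) * mass N.
Proof. apply lsum_scal. Qed.

(** After reflection this is [decay]: where [phi] is small it satisfies the linear inequality, whose
    kernel has mass at least [2 * D + (g0 + d) / 2 > mu]. The translation by [a] places all shifted
    arguments in that region. *)
Lemma vanish_left c : c <> 0 -> exists th, 0 < th /\ forall phi, profile c phi ->
  (forall x, x <= 0 -> phi x <= th) ->
  forall eps, 0 < eps -> exists X, forall x, x <= X -> phi x <= eps.
Proof.
intros Hc; destruct lin_parameters as [eta [N [Heta HN]]].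
destruct (Hder eta (proj1 Heta)) as [th [Hth0 Hth]].
exists th; split; [exact Hth0|]; intros phi Hp Hsmall eps Heps.
set (a := reach c N).
assert (Ha := reach_pos c N); fold a in Ha.
assert (HL := lip_const_pos); assert (Hc' := Rabs_pos_lt c Hc).
assert (Hdv : forall x, is_derive (fun x => phi (- x - a)) x (- Derive phi (- x - a))).
{ intros x; auto_derive; [apply Hp|].
  change (fun x0 : R => phi x0) with phi; unfold Rminus; ring. }
destruct (decay (- c) mu B (lip_const / Rabs c) (lin_kernel (-1) c eta N)
  (fun x => phi (- x - a))) with (eps := eps) as [X HX]; try assumption.
- apply Rdiv_le_0_compat; lra.
- intros p; apply lin_kernel_nonneg; lra.
- intros x; apply Hp.
- intros x; eexists; apply Hdv.
- intros x y; eapply Rle_trans; [apply (profile_lip c phi Hc Hp)|].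
  replace (- x - a - (- y - a)) with (- (x - y)) by ring; rewrite Rabs_Ropp; lra.
- intros x Hx.
  assert (E : Derive (fun x : R => phi (- x - a)) x = - Derive phi (- x - a))
    by (apply is_derive_unique, Hdv).
  rewrite E, lsum_lin_kernel; simpl.
  assert (H := lin_lower c phi th eta N (- x - a) Hp Hth).
  replace (- c * - Derive phi (- x - a)) with (c * Derive phi (- x - a)) by ring.
  eapply Rle_trans; [|apply H].
  + right; replace (- (x - 1) - a) with (- x - a + 1) by ring.
    replace (- (x - -1) - a) with (- x - a - 1) by ring.
    rewrite <- Rmult_plus_distr_l; f_equal.
    apply lsum_ext; intros k; f_equal; f_equal; ring.
  + intros k Hk; apply Hsmall.
    apply reach_bound with (c := c) in Hk; apply Rabs_le_between in Hk; unfold a; lra.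
- rewrite lsum_lin_kernel; simpl; rewrite mass_lin_kernel; lra.
- exists (- X - a); intros x Hx.
  specialize (HX (- x - a) ltac:(lra)).
  replace (- (- x - a) - a) with x in HX by ring; exact HX.
Qed.

(** Let [Q z] be the right-hand side of the exponential condition of [no_decay]. It is convex, at
    least [(g0 - d) / 2] at 0 and at most that at [- lam], hence at least that on the right half
    line; this explains the constant in [supercritical]. The positive shift is supplied by the
    diffusion. *)
Lemma no_small_tail c : c <> 0 -> supercritical D d r g0 beta c -> exists th, 0 < th /\
  forall phi X, profile c phi -> (forall x, 0 < phi x) ->
  (forall x, X <= x -> phi x <= th) -> False.
Proof.
intros Hc [lam [Hlam Hsup]]; destruct lin_parameters as [eta [N [Heta HN]]].
destruct (Hder eta (proj1 Heta)) as [th [Hth0 Hth]].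
exists th; split; [exact Hth0|]; intros phi X Hp Hpos Hsmall.
set (a := X + reach c N).
assert (Ha := reach_pos c N).
assert (Hp' := profile_translate c phi a Hp).
assert (HL := lip_const_pos); assert (Hc' := Rabs_pos_lt c Hc).
apply (no_decay c mu B (lip_const / Rabs c) (lin_kernel 1 c eta N)
  (fun x => phi (x + a))) with (kappa := (g0 - d) / 2) (b1 := D) (a1 := 1); try assumption; try lra.
- apply Rdiv_le_0_compat; lra.
- intros p; apply lin_kernel_nonneg; lra.
- intros x; apply Hp'.
- intros x; apply Hp'.
- intros x y; apply (profile_lip c _ Hc Hp').
- intros x Hx; rewrite lsum_lin_kernel; simpl.
  eapply Rle_trans; [|apply (lin_lower c _ th eta N x Hp' Hth)].
  + right; replace (x - -1 + a) with (x + 1 + a) by ring.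
    rewrite (Rplus_comm (D * _)), <- Rmult_plus_distr_l; f_equal.
    apply lsum_ext; intros k; f_equal; f_equal; ring.
  + intros k Hk; cbv beta; apply Hsmall.
    apply reach_bound with (c := c) in Hk; apply Rabs_le_between in Hk; unfold a; lra.
- intros x; apply Hpos.
- intros z Hz; rewrite lsum_lin_kernel; simpl.
  specialize (Hsup N); unfold lin_rate in Hsup.
  set (S1 := lsum (zl N) (fun k => beta k * exp (- lam * (IZR k + c * r)))) in *.
  set (S2 := lsum (zl N) _).
  (* The convolution part of the convexity inequality [(lam + z) * Q 0 <= z * Q (- lam) + lam * Q
     z]. *)
  assert (HS : (lam + z) * ((g0 - eta) * mass N) <= z * ((g0 - eta) * S1) + lam * S2).
  { unfold S1, S2, mass; rewrite <- !lsum_scal, <- lsum_plus; apply lsum_le; intros k _.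
    assert (E := exp_convex lam z (IZR k + c * r) Hlam Hz).
    replace (1 * (IZR k + c * r) * z) with (z * (IZR k + c * r)) by ring.
    assert (Hb : 0 <= (g0 - eta) * beta k) by (apply Rmult_le_pos; [lra|apply Hbeta]).
    apply (Rmult_le_compat_l _ _ _ Hb) in E; lra. }
  assert (HS1 : 0 <= S1).
  { apply lsum_nonneg; intros; apply Rmult_le_pos; [apply Hbeta|left; apply exp_pos]. }
  assert (E1 := exp_convex lam z 1 Hlam Hz); assert (E2 := exp_convex lam z (-1) Hlam Hz).
  replace (- lam * 1) with (- lam) in E1 by ring; replace (- lam * -1) with lam in E2 by ring.
  replace (z * 1) with (1 * z) in E1 by ring; replace (z * -1) with (-1 * z) in E2 by ring.
  apply Rmult_le_reg_l with lam; [exact Hlam|].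
  assert (z * ((g0 - eta) * S1) <= z * (g0 * S1)) by (apply Rmult_le_compat_l; [exact Hz|nra]).
  assert (F1 := Rmult_le_compat_l D _ _ (Rlt_le _ _ HD) E1).
  assert (F2 := Rmult_le_compat_l D _ _ (Rlt_le _ _ HD) E2).
  assert (F3 := Rmult_le_compat_l z _ _ Hz Hsup).
  assert (F4 : (lam + z) * ((g0 + d) / 2) <= (lam + z) * ((g0 - eta) * mass N))
    by (apply Rmult_le_compat_l; lra).
  nra.
- left; reflexivity.
Qed.

(** Otherwise [phi] keeps returning to the level [th] and keeps coming near 0. Translate by the last
    point at level [th] before a value below [1 / (n + 1)]. The limit is at least [th] at 0, hence
    positive, so the distance to that small value tends to infinity; therefore the limit is at most
    [th] on the right of 0, which [no_small_tail] excludes. *)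
Lemma persistence c phi : c <> 0 -> supercritical D d r g0 beta c -> profile c phi -> (forall x, 0 < phi x) ->
  exists m X, 0 < m /\ forall x, X <= x -> m <= phi x.
Proof.
intros Hc Hsup Hp Hpos.
destruct (no_small_tail c Hc Hsup) as [th [Hth Hno]].
apply NNPP; intros Hn.
assert (Hlow1 : forall m X, 0 < m -> exists x, X <= x /\ phi x < m).
{ intros m X Hm; apply NNPP; intros H; apply Hn; exists m, X; split; [exact Hm|].
  intros x Hx; apply Rnot_lt_le; intros Hlt; apply H; exists x; auto. }
assert (Hhigh : forall X, exists x, X <= x /\ th <= phi x).
{ intros X; apply NNPP; intros H; apply (Hno phi X Hp Hpos).
  intros x Hx; apply Rnot_lt_le; intros Hlt; apply H; exists x; split; [exact Hx|lra]. }
assert (HphiL := profile_lip c phi Hc Hp).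
assert (Hay : forall n : nat, exists p : R * R, fst p <= snd p /\ th <= phi (fst p) /\
  (forall x, fst p < x <= snd p -> phi x < th) /\ phi (snd p) < / (INR n + 1)).
{ intros n; destruct (Hhigh 0) as [x1 [_ Hx1]].
  assert (Hn1 : 0 < / (INR n + 1)) by (apply Rinv_0_lt_compat; assert (X := pos_INR n); lra).
  destruct (Hlow1 (/ (INR n + 1)) x1 Hn1) as [y [Hxy Hy]].
  destruct (last_above phi _ th x1 y HphiL Hxy Hx1) as [a [Ha1 [Ha2 Ha3]]].
  exists (a, y); simpl; repeat split; try lra; exact Ha3. }
destruct (functional_choice_nat _ _ Hay) as [p Hpn]; clear Hay.
destruct ultrafilter_exists as [U HU].
destruct (tail_small 1) as [N0 HN0]; [lra|].
assert (Heps0 : is_lim_seq (fun n => d * B * (1 - mass (N0 + n))) (Finite 0)).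
{ apply is_lim_seq_spec; intros e.
  destruct (tail_small (e / 2)) as [N1 HN1]; [destruct e; simpl; lra|].
  exists N1; intros n Hn1; specialize (HN1 (N0 + n)%nat ltac:(lia)).
  rewrite Rminus_0_r, Rabs_pos_eq by lra; destruct e; simpl in *; lra. }
destruct (limit_profile U HU c
  (fun n => (N0 + n)%nat) (fun _ => c) (fun n => d * B * (1 - mass (N0 + n)))
  (fun n x => phi (x + fst (p n)))) as [psi [Hlim Hpsi]].
- exact Hc.
- apply is_lim_seq_const.
- intros _; assert (X := Rabs_pos c); lra.
- intros n; lia.
- intros n; apply (HN0 (N0 + n)%nat); lia.
- exact Heps0.
- intros n; apply (approx_translate).
  apply (profile_approx); [exact Hp|lra].
- assert (H0 : th <= psi 0).
  { apply (is_ulim_le U HU (fun _ => th) (fun n => phi (0 + fst (p n)))).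
    - apply is_ulim_const, HU.
    - apply (is_ulim_loc_pt U HU (fun n x => phi (x + fst (p n))) psi 0 Hlim).
    - apply uf_all; [exact HU|]; intros n; rewrite Rplus_0_l; apply Hpn. }
  assert (Hpsipos : forall x, 0 < psi x) by (apply (profile_positive c psi 0 Hc Hpsi); lra).
  assert (HpsiL := profile_lip c psi Hc Hpsi).
  apply (Hno psi 1 Hpsi Hpsipos); intros x Hx.
  (* The positive minimum of the limit on [[0, x]] shows that the small value lies farther than [x]
     away for almost all [n]. *)
  destruct (continuity_ab_min psi 0 x) as [xm [Hm1 Hm2]]; [lra| |].
  { intros z _; apply continuity_pt_filterlim, (lip_continuous psi _ HpsiL). }
  set (eta := psi xm) in *; assert (Heta : 0 < eta) by apply Hpsipos.
  destruct (nfloor_ex (2 / eta)) as [n0 [_ Hn0]]; [apply Rdiv_le_0_compat; lra|].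
  assert (HUx : U (fun n => phi (x + fst (p n)) <= th)).
  { apply (uf_mono U HU _ _) with (2 := uf_and U HU _ _ (uf_tail U HU (S n0)) (Hlim x (eta / 2) ltac:(lra))).
    intros n [Hn1 Hn2]; apply le_INR in Hn1; rewrite S_INR in Hn1.
    destruct (Hpn n) as [P1 [P2 [P3 P4]]].
    left; apply P3; split; [lra|].
    apply Rnot_lt_le; intros Hlt.
    assert (Ht : Rabs (snd (p n) - fst (p n)) <= x) by (rewrite Rabs_pos_eq; lra).
    assert (H1 := Hn2 _ Ht).
    replace (snd (p n) - fst (p n) + fst (p n)) with (snd (p n)) in H1 by ring.
    assert (H2 := Hm1 (snd (p n) - fst (p n)) ltac:(lra)); fold eta in H2.
    assert (/ (INR n + 1) <= eta / 2).
    { replace (eta / 2) with (/ (2 / eta)) by (field; lra).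
      apply Rinv_le_contravar; [apply Rdiv_lt_0_compat|]; lra. }
    apply Rabs_le_between in H1; lra. }
  apply (is_ulim_le U HU (fun n => phi (x + fst (p n))) (fun _ => th)).
  + apply (is_ulim_loc_pt U HU (fun n x => phi (x + fst (p n))) psi x Hlim).
  + apply is_ulim_const, HU.
  + exact HUx.
Qed.

(** * Approximate profiles *)

Section Approximant.

Context (c lam : R) (N : nat) (Hc : c <> 0) (Hlam : 0 < lam).

Context (delta S : R) (Hdelta : 0 < delta) (HS : 0 <= S).
Context (Hslack : lin_rate D r g0 beta c lam N + delta <= mu + c * lam).

(** The constant that balances the largest nonlinearity and the full source:
    [d * top = d * B + delta]. *)
Definition top : R := B + delta / d.
Definition barrier (x : R) : R := Rmin top (exp (lam * x)).
(* The bump keeps fixed points away from 0 at [+oo]. The cutoff of the relaxation integral at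
   time [S] avoids an improper integral and costs only [exp (- (mu * S))]. *)
Definition source (phi : R -> R) (y : R) : R := rhs c N phi y + delta * Rmin 1 (exp (lam * y)).
Definition relax_map (phi : R -> R) (x : R) : R := relax c mu S (source phi) x.

Notation below := (below_cont barrier).

Lemma top_pos : 0 < top.
Proof. assert (0 < delta / d) by (apply Rdiv_lt_0_compat; lra); unfold top; lra. Qed.

Lemma exp_lam_continuous x : continuous (fun x => exp (lam * x)) x.
Proof. apply (is_derive_continuous _ x (lam * exp (lam * x))); auto_derive; [auto|ring]. Qed.

Lemma barrier_bounds x : 0 <= barrier x <= top.
Proof.
split; [apply Rmin_glb; left; [apply top_pos|apply exp_pos]|apply Rmin_l].
Qed.

Lemma barrier_continuous x : continuous barrier x.
Proof.
apply (continuous_Rmin (fun _ => top)); [apply continuous_const|apply exp_lam_continuous].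
Qed.

Lemma source_continuous phi : below phi -> forall y, continuous (source phi) y.
Proof.
intros [H _] y; apply (continuous_plus (rhs c N phi)).
- apply (rhs_continuous); exact H.
- apply (continuous_mult (fun _ => delta)); [apply continuous_const|].
  apply (continuous_Rmin (fun _ => 1)); [apply continuous_const|apply exp_lam_continuous].
Qed.

Lemma bump_bounds y : 0 <= delta * Rmin 1 (exp (lam * y)) <= delta.
Proof.
assert (H := exp_pos (lam * y)); unfold Rmin; destruct (Rle_dec _ _); nra.
Qed.

Lemma source_bounds phi y : below phi -> 0 <= source phi y <= mu * top.
Proof.
intros [_ H]; assert (Hp := bump_bounds y); unfold source.
assert (H1 : forall x, 0 <= phi x) by (intros; apply H).
assert (H2 : forall x, phi x <= top) by (intros x; specialize (H x); assert (X := barrier_bounds x); lra).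
assert (X1 := rhs_nonneg c N phi y H1).
assert (X2 := rhs_le c N phi y top H2).
assert (E : d * top = d * B + delta) by (unfold top; field; lra); lra.
Qed.

(** The linear bound on [g] gives the factor [lin_rate], and the bump is at most
    [delta * exp (lam * y)], which the slack covers. *)
Lemma source_exp phi y : below phi -> source phi y <= (mu + c * lam) * exp (lam * y).
Proof.
intros [_ H].
assert (H2 : forall x, phi x <= exp (lam * x)).
{ intros x; specialize (H x); assert (X := Rmin_r top (exp (lam * x))); unfold barrier in H; lra. }
assert (He := exp_pos (lam * y)).
apply Rle_trans with ((lin_rate D r g0 beta c lam N + delta) * exp (lam * y)); [|apply Rmult_le_compat_r; lra].
unfold source, lin_rate, rhs.
assert (X1 : delta * Rmin 1 (exp (lam * y)) <= delta * exp (lam * y))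
  by (apply Rmult_le_compat_l; [lra|apply Rmin_r]).
assert (X2 : phi (y + 1) <= exp lam * exp (lam * y)).
{ rewrite <- exp_plus; eapply Rle_trans; [apply H2|]; right; f_equal; ring. }
assert (X3 : phi (y - 1) <= exp (- lam) * exp (lam * y)).
{ rewrite <- exp_plus; eapply Rle_trans; [apply H2|]; right; f_equal; ring. }
assert (X4 : lsum (zl N) (fun k => beta k * g (phi (y - IZR k - c * r))) <=
  g0 * lsum (zl N) (fun k => beta k * exp (- lam * (IZR k + c * r))) * exp (lam * y)).
{ replace (g0 * lsum (zl N) (fun k => beta k * exp (- lam * (IZR k + c * r))) * exp (lam * y))
    with (exp (lam * y) * g0 * lsum (zl N) (fun k => beta k * exp (- lam * (IZR k + c * r)))) by ring.
  rewrite <- lsum_scal; apply lsum_le; intros k _.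
  replace (exp (lam * y) * g0 * (beta k * exp (- lam * (IZR k + c * r))))
    with (beta k * (g0 * (exp (- lam * (IZR k + c * r)) * exp (lam * y)))) by ring.
  apply Rmult_le_compat_l; [apply Hbeta|].
  eapply Rle_trans; [apply Hlin, H|]; apply Rmult_le_compat_l; [lra|].
  rewrite <- exp_plus; eapply Rle_trans; [apply H2|]; right; f_equal; ring. }
nra.
Qed.

(** Both parts of the barrier are upper solutions: relaxing [mu * top] gives at most [top], and
    relaxing [(mu + c * lam) * exp (lam * x)] gives at most [exp (lam * x)], because the integrand
    decays at rate [mu + c * lam]. *)
Lemma relax_map_bounds phi : below phi -> forall x, 0 <= relax_map phi x <= barrier x.
Proof.
intros H x.
assert (Hcont := fun s => relax_integrand_continuous c mu (source phi) (source_continuous phi H) x s).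
assert (Hmu : 0 < mu) by lra; assert (Ht := top_pos).
unfold relax_map, relax; split; [|apply Rmin_glb].
- apply RInt_nonneg; [exact Hcont|exact HS|].
  intros s; apply Rmult_le_pos; [left; apply exp_pos|apply source_bounds, H].
- replace top with (mu * top / mu) by (field; lra).
  apply RInt_exp_le; [exact Hcont|exact Hmu|nra|exact HS|].
  intros s _; rewrite Rmult_comm; apply Rmult_le_compat_r; [left; apply exp_pos|apply source_bounds, H].
(* With the slack this makes the rate [mu + c * lam] positive, also for negative [c]. *)
- assert (Hlr : 0 < lin_rate D r g0 beta c lam N).
  { unfold lin_rate; apply Rplus_lt_le_0_compat.
    - assert (X1 := exp_pos lam); assert (X2 := exp_pos (- lam)); nra.
    - apply Rmult_le_pos; [lra|]; apply lsum_nonneg; intros; apply Rmult_le_pos;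
        [apply Hbeta|left; apply exp_pos]. }
  replace (exp (lam * x)) with ((mu + c * lam) * exp (lam * x) / (mu + c * lam)) by (field; lra).
  apply RInt_exp_le; [exact Hcont|lra| |exact HS|].
  + apply Rmult_le_pos; [lra|left; apply exp_pos].
  + intros s _.
    replace ((mu + c * lam) * exp (lam * x) * exp (- ((mu + c * lam) * s)))
      with (exp (- (mu * s)) * ((mu + c * lam) * exp (lam * (x - c * s)))).
    * apply Rmult_le_compat_l; [left; apply exp_pos|apply source_exp, H].
    * replace (exp (- ((mu + c * lam) * s))) with (exp (- (mu * s)) * exp (- (lam * c * s)))
        by (rewrite <- exp_plus; f_equal; ring).
      replace (exp (lam * (x - c * s))) with (exp (lam * x) * exp (- (lam * c * s)))
        by (rewrite <- exp_plus; f_equal; ring).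
      ring.
Qed.

Lemma relax_map_derive phi (x : R) : below phi -> is_derive (relax_map phi) x
  ((source phi x - exp (- (mu * S)) * source phi (x - c * S) - mu * relax_map phi x) / c).
Proof.
intros H; apply (relax_derive c mu S (source phi) Hc (source_continuous phi H)).
Qed.

Lemma exp_mu_S : 0 < exp (- (mu * S)) <= 1.
Proof.
split; [apply exp_pos|]; rewrite <- exp_0; apply exp_le; nra.
Qed.

Lemma relax_map_lip phi : below phi ->
  forall x y, Rabs (relax_map phi x - relax_map phi y) <= 2 * mu * top / Rabs c * Rabs (x - y).
Proof.
intros H x y; assert (Hc' := Rabs_pos_lt c Hc); assert (Ht := top_pos).
apply (abs_bound (relax_map phi) (fun x =>
  (source phi x - exp (- (mu * S)) * source phi (x - c * S) - mu * relax_map phi x) / c)).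
- apply Rdiv_le_0_compat; nra.
- intros z _; apply relax_map_derive, H.
- intros z _; unfold Rdiv; rewrite Rabs_mult, Rabs_inv.
  apply Rmult_le_compat_r; [left; apply Rinv_0_lt_compat, Hc'|].
  assert (X1 := source_bounds phi z H); assert (X2 := source_bounds phi (z - c * S) H).
  assert (X3 := relax_map_bounds phi H z); assert (X4 := barrier_bounds z).
  assert (X5 := exp_mu_S).
  assert (0 <= exp (- (mu * S)) * source phi (z - c * S) <= mu * top) by nra.
  assert (0 <= mu * relax_map phi z <= mu * top) by nra.
  apply Rabs_le; lra.
Qed.

Lemma relax_map_continuous X eps : 0 < eps -> exists A del, 0 < del /\
  forall phi phi', below phi -> below phi' ->
  (forall y, Rabs y <= A -> Rabs (phi y - phi' y) <= del) ->
  forall x, Rabs x <= X -> Rabs (relax_map phi x - relax_map phi' x) <= eps.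
Proof.
intros Heps.
set (om := eps / (2 * (S + 1))).
assert (Hom : 0 < om) by (apply Rdiv_lt_0_compat; lra).
destruct (Huc om Hom) as [d0 [Hd0 Hg1]].
set (d1 := Rmin d0 (om / (2 * D))).
assert (Hd1 : 0 < d1) by (apply Rmin_pos; [lra|apply Rdiv_lt_0_compat; lra]).
assert (Hd1' : 2 * D * d1 <= om).
{ apply Rle_trans with (2 * D * (om / (2 * D))); [|right; field; lra].
  apply Rmult_le_compat_l; [lra|apply Rmin_r]. }
exists (X + Rabs c * S + reach c N), d1; split; [exact Hd1|].
intros phi phi' H H' Hcl x Hx; unfold relax_map, relax.
apply Rle_trans with (2 * om * S); [|unfold om; apply Rmult_le_reg_r with (S + 1); [lra|];
  replace (2 * (eps / (2 * (S + 1))) * S * (S + 1)) with (eps * S) by (field; lra); nra].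
apply RInt_close; try lra.
- intros s; apply (relax_integrand_continuous c mu (source phi) (source_continuous phi H)).
- intros s; apply (relax_integrand_continuous c mu (source phi') (source_continuous phi' H')).
- intros s Hs; set (y := x - c * s).
  assert (Hy : Rabs y <= X + Rabs c * S).
  { unfold y; replace (x - c * s) with (x + - (c * s)) by ring.
    eapply Rle_trans; [apply Rabs_triang|]; apply Rplus_le_compat; [exact Hx|].
    rewrite Rabs_Ropp, Rabs_mult, (Rabs_pos_eq s) by lra.
    apply Rmult_le_compat_l; [apply Rabs_pos|lra]. }
  assert (HNp := pos_INR N); assert (Hcr : 0 <= Rabs c * r) by (apply Rmult_le_pos; [apply Rabs_pos|lra]).
  assert (HR : Rabs (rhs c N phi y - rhs c N phi' y) <= 2 * D * d1 + om).
  { assert (Hy' := Hy); apply Rabs_le_between in Hy'.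
    apply (rhs_close); try lra.
    - intros s1 s2 Hss; apply Hg1; apply Rle_trans with (1 := Hss), Rmin_l.
    - apply Hcl, Rabs_le; unfold reach; lra.
    - apply Hcl, Rabs_le; unfold reach; lra.
    - intros k Hk; apply (reach_bound c N k) in Hk.
      apply Hcl; apply Rabs_le_between in Hk; apply Rabs_le; lra. }
  rewrite <- Rmult_minus_distr_l, Rabs_mult.
  unfold source.
  replace (rhs c N phi y + delta * Rmin 1 (exp (lam * y))
    - (rhs c N phi' y + delta * Rmin 1 (exp (lam * y)))) with (rhs c N phi y - rhs c N phi' y) by ring.
  assert (He : 0 < exp (- (mu * s)) <= 1).
  { split; [apply exp_pos|]; rewrite <- exp_0; apply exp_le; nra. }
  rewrite (Rabs_pos_eq (exp _)) by lra.
  assert (P := Rabs_pos (rhs c N phi y - rhs c N phi' y)); nra.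
Qed.

Lemma relax_map_fixpoint : exists phi, below phi /\ forall x, is_derive phi x
  ((source phi x - exp (- (mu * S)) * source phi (x - c * S) - mu * phi x) / c).
Proof.
destruct (schauder_fixpoint top (2 * mu * top / Rabs c) barrier relax_map) as [phi [H1 H2]].
- apply top_pos.
- assert (Hc' := Rabs_pos_lt c Hc); assert (Ht := top_pos); apply Rdiv_le_0_compat; nra.
- apply barrier_bounds.
- apply barrier_continuous.
- apply relax_map_bounds.
- apply relax_map_lip.
- apply relax_map_continuous.
- exists phi; split; [exact H1|]; intros x.
  apply (is_derive_ext (relax_map phi)); [exact H2|].
  rewrite <- (H2 x) at 1; apply relax_map_derive, H1.
Qed.

End Approximant.

(** The cutoff destroys at most half of the bump, which equals [delta] on the right half line; the
    other half keeps the solution eventually above [delta / (4 * mu)]. *)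
Lemma approximant_exists c lam N eps : c <> 0 -> 0 < lam -> 0 < eps ->
  lin_rate D r g0 beta c lam N < mu + c * lam ->
  exists phi, approx_profile c N eps phi /\
    (forall x, phi x <= exp (lam * x)) /\
    (forall x, 0 <= x -> rhs c N phi x <= c * Derive phi x + mu * phi x) /\
    exists m X, 0 < m /\ forall x, X <= x -> m <= phi x.
Proof.
intros Hc Hlam Heps Hrate.
set (delta := Rmin (Rmin (eps / 2) (eps * d)) (mu + c * lam - lin_rate D r g0 beta c lam N)).
assert (Hdelta : 0 < delta) by (repeat apply Rmin_pos; nra).
assert (Hd1 : delta <= eps / 2) by (eapply Rle_trans; [apply Rmin_l|apply Rmin_l]).
assert (Hd2 : delta <= eps * d) by (eapply Rle_trans; [apply Rmin_l|apply Rmin_r]).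
assert (Hd3 : lin_rate D r g0 beta c lam N + delta <= mu + c * lam)
  by (assert (X := Rmin_r (Rmin (eps / 2) (eps * d)) (mu + c * lam - lin_rate D r g0 beta c lam N));
      fold delta in X; lra).
assert (Ht := top_pos delta Hdelta).
set (t := top delta) in *.
(* As [exp (mu * S) >= mu * S], the cutoff term, at most [exp (- (mu * S)) * (mu * t)], is below
   [delta / 2]. *)
set (S := 2 * t / delta).
assert (HS : 0 <= S) by (apply Rdiv_le_0_compat; lra).
assert (HSe : exp (- (mu * S)) * (mu * t) <= delta / 2).
{ rewrite exp_Ropp; assert (X1 := exp_ge_1_plus (mu * S)).
  assert (E : mu * S * delta = 2 * (mu * t)) by (unfold S; field; lra).
  assert (Hp := exp_pos (mu * S)).
  apply Rmult_le_reg_l with (exp (mu * S)); [exact Hp|].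
  rewrite <- Rmult_assoc, Rinv_r, Rmult_1_l by lra; nra. }
destruct (relax_map_fixpoint
  c lam N Hc delta S Hdelta HS Hd3) as [phi [Hbel Hphi]].
assert (Hex : forall x, ex_derive phi x) by (intros x; eexists; apply Hphi).
assert (Hode : forall x, c * Derive phi x + mu * phi x = source c lam N delta phi x
   - exp (- (mu * S)) * source c lam N delta phi (x - c * S)).
{ intros x; rewrite (is_derive_unique phi x _ (Hphi x)); field; exact Hc. }
assert (Hrest : forall x, 0 <= exp (- (mu * S)) * source c lam N delta phi (x - c * S) <= delta / 2).
{ intros x.
  assert (X := source_bounds c lam N delta Hdelta phi (x - c * S) Hbel).
  fold t in X; assert (Hp := exp_pos (- (mu * S))); split; [apply Rmult_le_pos; lra|].
  apply Rle_trans with (2 := HSe); apply Rmult_le_compat_l; lra. }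
assert (Htop : t <= B + eps).
{ unfold t, top; apply Rplus_le_compat_l.
  apply Rmult_le_reg_r with d; [lra|]; unfold Rdiv; rewrite Rmult_assoc, Rinv_l; lra. }
assert (Hpos : forall x, 0 <= phi x) by (intros x; apply Hbel).
assert (Hgt : forall x, 0 <= x -> rhs c N phi x + delta / 2 <= c * Derive phi x + mu * phi x).
{ intros x Hx; rewrite Hode; unfold source at 1.
  rewrite Rmin_left by (rewrite <- exp_0; apply exp_le; nra).
  specialize (Hrest x); lra. }
exists phi; split; [split|split; [|split]].
- intros x; split; [apply Hpos|].
  apply Rle_trans with (2 := Htop); apply Rle_trans with (1 := proj2 (proj2 Hbel x)), Rmin_l.
- intros x; split; [apply Hex|]; rewrite Hode; unfold source at 1.
  assert (X := bump_bounds lam delta Hdelta x); specialize (Hrest x); apply Rabs_le; lra.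
- intros x; apply Rle_trans with (1 := proj2 (proj2 Hbel x)), Rmin_r.
- intros x Hx; specialize (Hgt x Hx); lra.
- set (K := delta / (2 * mu)).
  assert (HK : 0 < K) by (apply Rdiv_lt_0_compat; lra).
  destruct (relax_lower c mu K 0 phi) with (e := K / 2) as [X HX]; try assumption; try lra.
  + intros x Hx; specialize (Hgt x Hx).
    assert (R0 := rhs_nonneg c N phi x Hpos).
    replace (mu * K) with (delta / 2) by (unfold K; field; lra); lra.
  + exists (K - K / 2), X; split; [lra|exact HX].
Qed.

(** * Semi-fronts at supercritical speeds *)

Lemma gain_exists : exists rho1 N0, 1 < rho1 /\
  forall N, (N0 <= N)%nat -> mu * rho1 < 2 * D + rho * d * mass N.
Proof.
set (rho1 := (2 * D + d * ((rho + 1) / 2) + mu) / (2 * mu)).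
assert (E : mu * rho1 = (2 * D + d * ((rho + 1) / 2) + mu) / 2) by (unfold rho1; field; lra).
destruct (mass_near_1 ((rho - 1) / (2 * rho))) as [N0 HN0]; [apply Rdiv_lt_0_compat; lra|].
exists rho1, N0; split.
- apply Rmult_lt_reg_l with mu; [lra|]; rewrite E; nra.
- intros N HN; specialize (HN0 N HN); rewrite E.
  assert (E2 : rho * ((rho - 1) / (2 * rho)) = (rho - 1) / 2) by (field; lra).
  assert (H : (rho + 1) / 2 < rho * mass N) by nra.
  apply (Rmult_lt_compat_l d) in H; [nra|exact Hd].
Qed.

(** The exponential bound puts [f] below [th] far to the left, so after reflection a first point
    becomes a last point on a bounded interval. *)
Lemma first_above (f : R -> R) L th lam x1 : (forall x y, Rabs (f x - f y) <= L * Rabs (x - y)) ->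
  0 < th -> 0 < lam -> (forall x, f x <= exp (lam * x)) -> th <= f x1 ->
  exists a, th <= f a /\ forall x, x < a -> f x < th.
Proof.
intros HL Hth Hlam Hexp Hx1.
set (b := Rmax (- x1) (1 - ln th / lam)).
destruct (last_above (fun x => f (- x)) L th (- x1) b) as [a [_ [Ha1 Ha2]]].
- intros x y; eapply Rle_trans; [apply HL|].
  replace (- x - - y) with (- (x - y)) by ring; rewrite Rabs_Ropp; lra.
- apply Rmax_l.
- rewrite Ropp_involutive; exact Hx1.
- exists (- a); split; [exact Ha1|]; intros x Hx.
  destruct (Rle_lt_dec (- x) b) as [Hb|Hb].
  + specialize (Ha2 (- x) ltac:(lra)); rewrite Ropp_involutive in Ha2; exact Ha2.
  + apply Rle_lt_trans with (1 := Hexp x).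
    rewrite <- (exp_ln th Hth); apply exp_increasing.
    assert (H := Rmax_r (- x1) (1 - ln th / lam)); fold b in H.
    assert (E : lam * (ln th / lam) = ln th) by (field; lra).
    assert (lam * x < lam * (ln th / lam)) by (apply Rmult_lt_compat_l; lra); lra.
Qed.

Lemma front_exists c : c <> 0 -> above_critical D d r g0 beta c ->
  exists psi, profile c psi /\ (forall x, 0 < psi x) /\
    (forall eps, 0 < eps -> exists X, forall x, x <= X -> psi x <= eps) /\
    exists eta X, zeta < eta /\ forall x, X <= x -> eta <= psi x.
Proof.
intros Hc Hcrit.
assert (Hc' := Rabs_pos_lt c Hc).
destruct gain_exists as [rho1 [N0 [Hrho1 HN0]]].
destruct (vanish_left c Hc)
  as [th0 [Hth0 Hvan]].
(* At most [th0], so that [vanish_left] applies to the limit; at most [zeta], so that every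
   approximant, eventually above [rho1 * zeta], reaches the level. *)
set (th := Rmin th0 zeta).
assert (Hth : 0 < th) by (apply Rmin_pos; assumption).
assert (Hthz : th <= zeta) by apply Rmin_r.
assert (Hth1 : th <= th0) by apply Rmin_l.
(* The factor [Rabs c / 2] keeps the speeds at least [Rabs c / 2] in absolute value, and so the
   Lipschitz constants uniform. *)
assert (Happ : forall n : nat, exists q : R * R * (R -> R) * R,
  let '(cn, lam, phi, a) := q in
  Rabs (cn - c) <= Rabs c / 2 * / (INR n + 1) /\
  approx_profile cn (N0 + n) (/ (INR n + 1)) phi /\
  th <= phi a /\ forall x, x < a -> phi x < th).
{ intros n.
  assert (Hn1 : 0 < / (INR n + 1)) by (apply Rinv_0_lt_compat; assert (X := pos_INR n); lra).
  assert (Hn2 : / (INR n + 1) <= 1).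
  { rewrite <- Rinv_1; apply Rinv_le_contravar; [lra|assert (X := pos_INR n); lra]. }
  assert (Heta : 0 < Rabs c / 2 * / (INR n + 1)) by (apply Rmult_lt_0_compat; lra).
  destruct (above_critical_strict D d r g0 beta Hd Hr Hg0 Hbeta c _ Hcrit Heta)
    as [cn [lam [Hcn [Hlam Hrate]]]].
  assert (Hcnc : Rabs (cn - c) <= Rabs c / 2 * / (INR n + 1)) by (rewrite Rabs_pos_eq; lra).
  assert (Hcna : Rabs c / 2 <= Rabs cn).
  { assert (X := Rabs_triang cn (- (cn - c))); rewrite Rabs_Ropp in X.
    replace (cn + - (cn - c)) with c in X by ring; nra. }
  assert (Hcn0 : cn <> 0) by (intros E; rewrite E, Rabs_R0 in Hcna; lra).
  destruct (approximant_exists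
    cn lam (N0 + n)%nat _ Hcn0 Hlam Hn1 (Hrate _)) as [phi [Hphi [Hexp [Hge Hev]]]].
  destruct (persist cn (N0 + n)%nat phi rho1)
    as [X HX]; try assumption.
  { intros x; apply Hphi. }
  { intros x; apply Hphi. }
  { apply HN0; lia. }
  destruct (first_above phi (lip_const / Rabs cn) th lam X) as [a [Ha1 Ha2]];
    try assumption.
  { apply (approx_profile_lip cn (Rabs cn) (N0 + n)
      (/ (INR n + 1))); [exact Hn2|split; [apply Rabs_pos_lt, Hcn0|lra]|exact Hphi]. }
  { specialize (HX X (Rle_refl X)); nra. }
  exists (cn, lam, phi, a); auto. }
destruct (functional_choice_nat _ _ Happ) as [q Hq]; clear Happ.
set (cn := fun n => fst (fst (fst (q n)))); set (phi := fun n => snd (fst (q n))).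
set (a := fun n => snd (q n)).
assert (Hn : forall n, Rabs (cn n - c) <= Rabs c / 2 * / (INR n + 1) /\
  approx_profile (cn n) (N0 + n) (/ (INR n + 1)) (phi n) /\
  th <= phi n (a n) /\ forall x, x < a n -> phi n x < th).
{ intros n; specialize (Hq n); unfold cn, phi, a; destruct (q n) as [[[? ?] ?] ?]; exact Hq. }
clearbody cn phi a; clear q Hq.
assert (Hinv : is_lim_seq (fun n => / (INR n + 1)) (Finite 0)).
{ apply is_lim_seq_spec; intros e.
  destruct (nfloor_ex (/ e)) as [m [_ Hm]]; [left; apply Rinv_0_lt_compat, cond_pos|].
  exists m; intros n Hnm; apply le_INR in Hnm; assert (X := pos_INR n).
  rewrite Rminus_0_r, Rabs_pos_eq by (left; apply Rinv_0_lt_compat; lra).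
  rewrite <- (Rinv_inv e); apply Rinv_lt_contravar; [|lra].
  apply Rmult_lt_0_compat; [apply Rinv_0_lt_compat, cond_pos|lra]. }
assert (Hinv1 : forall n, 0 < / (INR n + 1) <= 1).
{ intros n; assert (X := pos_INR n); split; [apply Rinv_0_lt_compat; lra|].
  rewrite <- Rinv_1; apply Rinv_le_contravar; lra. }
destruct ultrafilter_exists as [U HU].
destruct (limit_profile U HU c
  (fun n => (N0 + n)%nat) cn (fun n => / (INR n + 1)) (fun n x => phi n (x + a n)))
  as [psi [Hlim Hpsi]].
- exact Hc.
- apply is_lim_seq_spec; intros e.
  apply is_lim_seq_spec in Hinv.
  assert (He : 0 < e / Rabs c) by (apply Rdiv_lt_0_compat; [apply cond_pos|exact Hc']).
  destruct (Hinv (mkposreal _ He)) as [m Hm]; exists m; intros n Hnm.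
  specialize (Hm n Hnm); simpl in Hm; specialize (Hinv1 n).
  rewrite Rminus_0_r, Rabs_pos_eq in Hm by lra.
  apply Rle_lt_trans with (1 := proj1 (Hn n)).
  assert (E : Rabs c * (e / Rabs c) = e) by (field; lra).
  assert (He' := cond_pos e).
  assert (Rabs c * / (INR n + 1) < Rabs c * (e / Rabs c)) by (apply Rmult_lt_compat_l; lra); lra.
- intros n; assert (X := Rabs_triang (cn n) (- (cn n - c))); rewrite Rabs_Ropp in X.
  replace (cn n + - (cn n - c)) with c in X by ring.
  assert (Y := proj1 (Hn n)); specialize (Hinv1 n); nra.
- intros n; lia.
- intros n; apply Hinv1.
- exact Hinv.
- intros n; apply (approx_translate), Hn.
- assert (H0 : th <= psi 0).
  { apply (is_ulim_le U HU (fun _ => th) (fun n => phi n (0 + a n))).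
    - apply is_ulim_const, HU.
    - apply (is_ulim_loc_pt U HU (fun n x => phi n (x + a n)) psi 0 Hlim).
    - apply uf_all; [exact HU|]; intros n; rewrite Rplus_0_l; apply Hn. }
  assert (Hleft : forall x, x < 0 -> psi x <= th0).
  { intros x Hx; apply Rle_trans with (2 := Hth1).
    apply (is_ulim_le U HU (fun n => phi n (x + a n)) (fun _ => th)).
    - apply (is_ulim_loc_pt U HU (fun n x => phi n (x + a n)) psi x Hlim).
    - apply is_ulim_const, HU.
    - apply uf_all; [exact HU|]; intros n; left; apply Hn; lra. }
  assert (Hpos : forall x, 0 < psi x)
    by (apply (profile_positive c psi 0 Hc Hpsi); lra).
  exists psi; split; [exact Hpsi|split; [exact Hpos|split]].
  + intros eps Heps.
    (* The smallness is known for negative arguments only, whence the translation by one. *)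
    destruct (Hvan (fun x => psi (x + -1))) with (eps := eps) as [X HX]; try assumption.
    * apply profile_translate, Hpsi.
    * intros x Hx; apply Hleft; lra.
    * exists (X - 1); intros x Hx; specialize (HX (x + 1) ltac:(lra)).
      replace (x + 1 + -1) with x in HX by ring; exact HX.
  + destruct (persist c N0 psi rho1)
      as [X HX]; try assumption.
    * intros x; apply Hpsi.
    * intros x; apply Hpsi.
    * intros x _; apply (profile_rhs c psi N0 x Hpsi).
    * apply HN0; lia.
    * apply (persistence c psi Hc
        (above_critical_supercritical D d r g0 beta HD Hd Hr Hg0 Hbeta c Hcrit) Hpsi Hpos).
    * exists (rho1 * zeta), X; split; [nra|exact HX].
Qed.

End Equation.

(** * The limit at the invaded end *)

Lemma div_le_iff d y z : 0 < d -> (y / d <= z <-> y <= d * z).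
Proof.
intros Hd; split; intros H.
- apply (Rmult_le_compat_l d) in H; [|lra]; replace (d * (y / d)) with y in H by (field; lra); exact H.
- apply Rmult_le_reg_l with d; [lra|]; replace (d * (y / d)) with y by (field; lra); exact H.
Qed.

Lemma le_div_iff d y z : 0 < d -> (z <= y / d <-> d * z <= y).
Proof.
intros Hd; split; intros H.
- apply (Rmult_le_compat_l d) in H; [|lra]; replace (d * (y / d)) with y in H by (field; lra); exact H.
- apply Rmult_le_reg_l with d; [lra|]; replace (d * (y / d)) with y by (field; lra); exact H.
Qed.

Lemma lt_div_iff d y z : 0 < d -> (z < y / d <-> d * z < y).
Proof.
intros Hd; split; intros H.
- apply Rnot_le_lt; intros H'; apply (Rlt_not_le _ _ H), div_le_iff, H'; exact Hd.
- apply Rnot_le_lt; intros H'; apply (Rlt_not_le _ _ H), div_le_iff, H'; exact Hd.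
Qed.

Definition is_liminf (f : R -> R) (m : R) : Prop :=
  (forall e, 0 < e -> exists X, forall x, X <= x -> m - e <= f x) /\
  (forall e, 0 < e -> ~ exists X, forall x, X <= x -> m + e <= f x).

Lemma liminf_exists (f : R -> R) a b : (forall x, a <= f x <= b) ->
  exists m, a <= m <= b /\ is_liminf f m.
Proof.
intros Hf.
destruct (completeness (fun y => exists X, forall x, X <= x -> y <= f x)) as [m [Hub Hlub]].
- exists b; intros y [X HX]; apply Rle_trans with (1 := HX X (Rle_refl X)), Hf.
- exists a, 0; intros; apply Hf.
- exists m; split; [split|split].
  + apply Hub; exists 0; intros; apply Hf.
  + apply Hlub; intros y [X HX]; apply Rle_trans with (1 := HX X (Rle_refl X)), Hf.
  + intros e He; apply NNPP; intros H.
    assert (m <= m - e); [|lra].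
    apply Hlub; intros y [X HX]; apply Rnot_lt_le; intros Hlt; apply H.
    exists X; intros x Hx; specialize (HX x Hx); lra.
  + intros e He [X HX]; assert (m + e <= m); [|lra].
    apply Hub; exists X; exact HX.
Qed.

Section IntervalMap.

Context (G : R -> R) (B zeta K kappa : R).
Context (HG : continuity G) (Hzeta : 0 < zeta) (HK : 0 < K).
Context (HGB : forall s, 0 < s <= B -> 0 < G s <= B).
Context (Hup : forall s, 0 < s <= zeta -> s < G s).
Context (Hlin : forall s, 0 <= s -> G s <= K * s).
Context (Hkappa : 0 < kappa <= B).
Context (Hfix : forall s, 0 < s <= B -> G s = s <-> s = kappa).
Context (Hfix2 : forall s, 0 < s <= B -> G (G s) = s -> s = kappa).

Lemma above_diag s : 0 < s < kappa -> s < G s.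
Proof.
intros Hs; apply Rnot_le_lt; intros Hle.
assert (Hm1 := Rmin_l zeta s); assert (Hm2 := Rmin_r zeta s).
assert (Hm : 0 < Rmin zeta s) by (apply Rmin_pos; lra).
assert (H0 := Hup (Rmin zeta s) ltac:(lra)).
destruct (IVT_gen (fun x => G x - x) (Rmin zeta s) s 0) as [t [Ht E]].
- apply (continuity_minus G id); [exact HG|apply derivable_continuous, derivable_id].
- rewrite Rmin_right, Rmax_left by lra; lra.
- rewrite Rmin_left, Rmax_right in Ht by lra.
  assert (t = kappa) by (apply Hfix; lra); lra.
Qed.

Lemma below_diag s : kappa < s <= B -> G s < s.
Proof.
intros Hs; apply Rnot_le_lt; intros Hle.
assert (HB := proj2 (HGB B ltac:(lra))).
destruct (IVT_gen (fun x => G x - x) s B 0) as [t [Ht E]].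
- apply (continuity_minus G id); [exact HG|apply derivable_continuous, derivable_id].
- rewrite Rmin_right, Rmax_left by lra; lra.
- rewrite Rmin_left, Rmax_right in Ht by lra.
  assert (t = kappa) by (apply Hfix; lra); lra.
Qed.

(** At [s0] both [s0] and [G s0] lie in the range where [G] is above the diagonal, thanks to
    [G s0 <= K * s0 <= zeta]. A crossing between [s0] and [s] would be a fixed point of [G] iterated
    twice below [kappa]. *)
Lemma above_diag2 s : 0 < s < kappa -> s < G (G s).
Proof.
intros Hs; apply Rnot_le_lt; intros Hle.
set (s0 := Rmin s (Rmin zeta (zeta / K))).
assert (H1 : s0 <= s) by apply Rmin_l.
assert (H2 : s0 <= zeta) by (eapply Rle_trans; [apply Rmin_r|apply Rmin_l]).
assert (H3 : s0 <= zeta / K) by (eapply Rle_trans; [apply Rmin_r|apply Rmin_r]).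
assert (H0 : 0 < s0) by (repeat apply Rmin_pos; try apply Rdiv_lt_0_compat; lra).
assert (HKs : K * s0 <= zeta).
{ apply Rle_trans with (K * (zeta / K)); [apply Rmult_le_compat_l; lra|right; field; lra]. }
assert (G1 := Hup s0 ltac:(lra)); assert (G2 := Hlin s0 ltac:(lra)).
assert (G3 := Hup (G s0) ltac:(lra)).
destruct (IVT_gen (fun x => G (G x) - x) s0 s 0) as [t [Ht E]].
- apply (continuity_minus (comp G G) id); [apply continuity_comp; exact HG|].
  apply derivable_continuous, derivable_id.
- rewrite Rmin_right, Rmax_left by lra; lra.
- rewrite Rmin_left, Rmax_right in Ht by lra.
  assert (t = kappa) by (apply Hfix2; lra); lra.
Qed.

(* An interval covered by its image reduces to [kappa]: otherwise it contains [u < kappa < v]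
   with [G u >= M], [G v <= m], and the intermediate value theorem on [[u, kappa]] gives
   [s < kappa] with [G s = v], hence [G (G s) <= s]. *)
Lemma covered_interval m M u v : 0 < m <= M -> M <= B -> m <= u <= M -> m <= v <= M ->
  M <= G u -> G v <= m -> m = kappa /\ M = kappa.
Proof.
intros Hm HM Hu Hv HGu HGv.
assert (Gk : G kappa = kappa) by (apply Hfix; auto).
destruct (Rtotal_order u kappa) as [Hu1|[Hu1|Hu1]]; [|subst u|exfalso; assert (X := below_diag u ltac:(lra)); lra].
- destruct (Rtotal_order v kappa) as [Hv1|[Hv1|Hv1]];
    [exfalso; assert (X := above_diag v ltac:(lra)); lra|subst v|].
  + exfalso; assert (X := above_diag u ltac:(lra)); lra.
  + exfalso.
    destruct (IVT_gen G u kappa v HG) as [s [Hs E]].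
    { rewrite Gk, Rmin_right, Rmax_left by lra; lra. }
    rewrite Rmin_left, Rmax_right in Hs by lra.
    assert (s <> kappa) by (intros ->; lra).
    assert (X := above_diag2 s ltac:(lra)); rewrite E in X; lra.
- rewrite Gk in HGu.
  destruct (Rtotal_order v kappa) as [Hv1|[Hv1|Hv1]]; [|subst v; lra|lra].
  exfalso; assert (X := above_diag v ltac:(lra)); lra.
Qed.

End IntervalMap.

Section LimitValue.

Context (D d r B : R) (beta : Z -> R).
Context (HD : 0 < D) (Hd : 0 < d) (Hr : 0 <= r) (HB : 0 < B).
Context (Hbeta : forall k, 0 <= beta k) (Hsum : is_sumZ beta 1).

Notation mu := (d + 2 * D).
Notation Profile := (profile D d r B beta).

Definition unif (g : R -> R) : Prop := forall om, 0 < om -> exists del, 0 < del /\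
  forall s s', Rabs (s - s') <= del -> Rabs (g s - g s') <= om.

Lemma unif_continuity g : unif g -> continuity g.
Proof. intros H x; apply continuity_pt_filterlim, unif_continuous, H. Qed.

(** If [g > d * m] on all of [[m, M]], then far to the right the right-hand side exceeds [mu * m] by
    a fixed amount, and relaxation pushes the profile above [m + e], against the definition of
    [m]. *)
Lemma liminf_image g c psi m M : (forall s, 0 <= g s <= d * B) -> unif g ->
  Profile g c psi -> 0 <= m <= M -> is_liminf psi m ->
  (forall e, 0 < e -> exists X, forall x, X <= x -> psi x <= M + e) ->
  exists v, m <= v <= M /\ g v <= d * m.
Proof.
intros Hg Huc Hpsi Hm [Hm1 Hm2] HM.
destruct (continuity_ab_min g m M) as [v [Hv1 Hv2]]; [lra| |].
{ intros x _; apply unif_continuity, Huc. }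
exists v; split; [exact Hv2|]; apply Rnot_lt_le; intros Hlt.
set (om := (g v - d * m) / 3).
assert (Hom : 0 < om) by (unfold om; lra).
destruct (Huc om Hom) as [del [Hdel Hgd]].
set (e := Rmin del (om / (4 * mu))).
assert (He : 0 < e) by (apply Rmin_pos; [lra|apply Rdiv_lt_0_compat; lra]).
assert (He1 : e <= del) by apply Rmin_l.
assert (He2 : 4 * mu * e <= om).
{ apply Rle_trans with (4 * mu * (om / (4 * mu))); [|right; field; lra].
  apply Rmult_le_compat_l; [lra|apply Rmin_r]. }
destruct (Hm1 e He) as [X1 HX1]; destruct (HM e He) as [X2 HX2].
apply (Hm2 e He).
assert (Hdm : 0 <= d * m) by (apply Rmult_le_pos; lra).
apply (profile_relax D d r B beta g HD Hd Hr Hbeta Hsum Hg c psi (m - e) (g v - om) (Rmax X1 X2));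
  try assumption; try (unfold om in *; lra).
- intros x Hx; assert (H1 := HX1 x (Rle_trans _ _ _ (Rmax_l _ _) Hx)).
  assert (H2 := HX2 x (Rle_trans _ _ _ (Rmax_r _ _) Hx)); split; [exact H1|].
  set (s := Rmin M (Rmax m (psi x))).
  assert (Hs : m <= s <= M /\ Rabs (psi x - s) <= e).
  { unfold s, Rmin, Rmax; repeat destruct (Rle_dec _ _); split; try lra; apply Rabs_le; lra. }
  assert (H3 := Hgd (psi x) s ltac:(lra)); assert (H4 := Hv1 s (proj1 Hs)).
  apply Rabs_le_between in H3; lra.
- assert (D * e <= mu * e) by (apply Rmult_le_compat_r; lra); unfold om in *; lra.
Qed.

(** Turns upper limits into lower ones. The constant [B] contributes [mu * B - 2 * D * B = d * B],
    which matches the new nonlinearity because [beta] has mass 1. *)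
Lemma profile_flip g c psi : Profile g c psi ->
  Profile (fun s => d * B - g (B - s)) c (fun x => B - psi x).
Proof.
intros [Hb He]; split; [intros x; specialize (Hb x); lra|]; intros x.
destruct (He x) as [H1 H2].
assert (E : is_derive (fun x => B - psi x) x (- Derive psi x)).
{ replace (- Derive psi x) with (0 - Derive psi x) by ring.
  apply (is_derive_minus (V := R_NormedModule) (fun _ => B) psi);
    [apply (is_derive_const (V := R_NormedModule))|apply Derive_correct, H1]. }
split; [eexists; exact E|].
assert (E' : Derive (fun x : R => B - psi x) x = - Derive psi x) by (apply is_derive_unique, E).
rewrite E'.
assert (X := is_sumZ_minus _ _ _ _ (is_sumZ_scal _ _ (d * B) Hsum) H2).
replace (c * - Derive psi x + mu * (B - psi x) - D * (B - psi (x + 1) + (B - psi (x - 1))))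
  with (d * B * 1 - (c * Derive psi x + mu * psi x - D * (psi (x + 1) + psi (x - 1)))) by ring.
revert X; apply is_sumZ_ext; intros k.
replace (B - (B - psi (x - IZR k - c * r))) with (psi (x - IZR k - c * r)) by ring; ring.
Qed.

Lemma flip_unif g : unif g -> unif (fun s => d * B - g (B - s)).
Proof.
intros H om Hom; destruct (H om Hom) as [del [Hdel Hg]]; exists del; split; [exact Hdel|].
intros s s' Hs.
replace (d * B - g (B - s) - (d * B - g (B - s'))) with (- (g (B - s) - g (B - s'))) by ring.
rewrite Rabs_Ropp; apply Hg.
replace (B - s - (B - s')) with (- (s - s')) by ring; rewrite Rabs_Ropp; exact Hs.
Qed.

(** The estimate for the lower limit gives [v] with [g v / d <= m]; the same estimate for the
    flipped profile gives [u] with [g u / d >= M]. Thus [[m, M]] is covered by its image and shrinks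
    to [kappa]. *)
Lemma profile_converges g c psi zeta K kappa : (forall s, 0 <= g s <= d * B) -> unif g ->
  0 < zeta -> 0 < K ->
  (forall s, 0 < s -> 0 < g s) -> (forall s, 0 < s <= zeta -> s < g s / d) ->
  (forall s, 0 <= s -> g s / d <= K * s) -> 0 < kappa <= B ->
  (forall s, 0 < s <= B -> g s / d = s <-> s = kappa) ->
  (forall s, 0 < s <= B -> g (g s / d) / d = s -> s = kappa) ->
  Profile g c psi -> (exists eta X, 0 < eta /\ forall x, X <= x -> eta <= psi x) ->
  forall e, 0 < e -> exists X, forall x, X <= x -> Rabs (psi x - kappa) <= e.
Proof.
intros Hg Huc Hzeta HK Hpos Hup Hlin Hkappa Hfix Hfix2 Hpsi [eta [X0 [Heta HX0]]] e He.
destruct (liminf_exists psi 0 B) as [m [Hm Hinf]]; [apply Hpsi|].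
destruct (liminf_exists (fun x => B - psi x) 0 B) as [m' [Hm' Hinf']].
{ intros x; destruct Hpsi as [Hb _]; specialize (Hb x); lra. }
set (M := B - m').
assert (HMup : forall e, 0 < e -> exists X, forall x, X <= x -> psi x <= M + e).
{ intros a Ha; destruct (proj1 Hinf' a Ha) as [X HX]; exists X; intros x Hx.
  specialize (HX x Hx); unfold M; lra. }
assert (Heta_m : eta <= m).
{ apply Rnot_lt_le; intros Hlt; apply (proj2 Hinf (eta - m)); [lra|].
  exists X0; intros x Hx; specialize (HX0 x Hx); lra. }
assert (HmM : m <= M).
{ apply Rnot_lt_le; intros Hlt.
  destruct (proj1 Hinf ((m - M) / 3)) as [X1 H1]; [lra|].
  destruct (HMup ((m - M) / 3)) as [X2 H2]; [lra|].
  specialize (H1 _ (Rmax_l X1 X2)); specialize (H2 _ (Rmax_r X1 X2)); lra. }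
destruct (liminf_image g c psi m M Hg Huc Hpsi ltac:(lra) Hinf HMup) as [v [Hv1 Hv2]].
destruct (liminf_image (fun s => d * B - g (B - s)) c (fun x => B - psi x) m' (B - m))
  as [u' [Hu1 Hu2]].
- intros s; specialize (Hg (B - s)); lra.
- apply flip_unif, Huc.
- apply profile_flip, Hpsi.
- unfold M in HmM; lra.
- exact Hinf'.
- intros a Ha; destruct (proj1 Hinf a Ha) as [X HX]; exists X; intros x Hx.
  specialize (HX x Hx); lra.
- destruct (covered_interval (fun s => g s / d) B zeta K kappa) with (m := m) (M := M) (u := B - u') (v := v)
    as [E1 E2]; try assumption; try (unfold M in *; lra).
  + unfold Rdiv; apply (continuity_mult g (fun _ => / d)); [apply unif_continuity, Huc|].
    apply continuity_const; intros ? ?; reflexivity.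
  + intros s Hs; split; [apply Rdiv_lt_0_compat; [apply Hpos|]; lra|apply div_le_iff; [exact Hd|apply Hg]].
  + apply le_div_iff; [exact Hd|unfold M; lra].
  + apply div_le_iff; assumption.
  + destruct (proj1 Hinf e He) as [X1 HX1]; destruct (HMup e He) as [X2 HX2].
    exists (Rmax X1 X2); intros x Hx.
    specialize (HX1 x (Rle_trans _ _ _ (Rmax_l _ _) Hx)).
    specialize (HX2 x (Rle_trans _ _ _ (Rmax_r _ _) Hx)).
    apply Rabs_le; lra.
Qed.

End LimitValue.

(** * Semi-wavefronts *)

(** The profile equation without bounds on [phi]; reflecting [x] amounts to reflecting the kernel
    and changing the sign of [c]. *)
Definition wave (D d r : R) (beta : Z -> R) (g : R -> R) (c : R) (phi : R -> R) : Prop :=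
  forall x, exists s, is_sumZ (fun k => beta k * g (phi (x - IZR k - c * r))) s /\
    is_derive phi x ((D * (phi (x + 1) + phi (x - 1)) + s - (d + 2 * D) * phi x) / c).

Lemma wave_LE D d r beta g c phi : c <> 0 -> wave D d r beta g c phi ->
  LE_solution D d r beta g (fun j t => phi (IZR j + c * t)).
Proof.
intros Hc H j t; destruct (H (IZR j + c * t)) as [s [H1 H2]]; exists s; split.
- apply (is_sumZ_reflect _ _ j) in H1; revert H1; apply is_sumZ_ext; intros k.
  do 3 f_equal; rewrite minus_IZR; ring.
- rewrite plus_IZR, minus_IZR.
  replace (IZR j + 1 + c * t) with (IZR j + c * t + 1) by ring.
  replace (IZR j - 1 + c * t) with (IZR j + c * t - 1) by ring.
  set (x := IZR j + c * t) in *.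
  replace (D * (phi (x + 1) - 2 * phi x + phi (x - 1)) - d * phi x + s)
    with (scal c ((D * (phi (x + 1) + phi (x - 1)) + s - (d + 2 * D) * phi x) / c))
    by (unfold scal; simpl; unfold mult; simpl; field; exact Hc).
  apply (is_derive_comp phi (fun t => IZR j + c * t)); [exact H2|].
  auto_derive; [auto|ring].
Qed.

Lemma wave_reflect D d r beta g c phi : c <> 0 ->
  wave D d r (fun k => beta (- k)%Z) g (- c) phi -> wave D d r beta g c (fun x => phi (- x)).
Proof.
intros Hc H x; destruct (H (- x)) as [s [H1 H2]]; exists s; split.
- apply (is_sumZ_reflect _ _ 0) in H1; revert H1; apply is_sumZ_ext; intros k.
  f_equal; [f_equal; lia|]; do 2 f_equal; rewrite minus_IZR; ring.
- replace (- (x + 1)) with (- x - 1) by ring; replace (- (x - 1)) with (- x + 1) by ring.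
  set (l := (D * (phi (- x + 1) + phi (- x - 1)) + s - (d + 2 * D) * phi (- x)) / - c) in *.
  replace (_ / c) with (scal (-1) l)
    by (unfold scal, l; simpl; unfold mult; simpl; field; exact Hc).
  apply (is_derive_comp phi (fun x => - x)); [exact H2|].
  auto_derive; [auto|ring].
Qed.

Lemma is_sumZ_opp f l : is_sumZ f l -> is_sumZ (fun k => f (- k)%Z) l.
Proof.
intros H; apply (is_sumZ_reflect _ _ 0) in H; revert H; apply is_sumZ_ext; intros k.
f_equal; lia.
Qed.

Lemma beta_exp_opp beta lam k :
  beta_exp (fun k => beta (- k)%Z) (- lam) k = beta_exp beta lam (- k)%Z.
Proof. unfold beta_exp; rewrite opp_IZR; do 2 f_equal; ring. Qed.

Lemma ex_sumZ_opp beta lam : ex_sumZ (beta_exp beta lam) ->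
  ex_sumZ (beta_exp (fun k => beta (- k)%Z) (- lam)).
Proof.
intros [s Hs]; exists s; apply is_sumZ_opp in Hs; revert Hs; apply is_sumZ_ext; intros k.
symmetry; apply beta_exp_opp.
Qed.

Lemma chi_opp D d r g0 beta lam c : ex_sumZ (beta_exp beta lam) ->
  chi D d r g0 (fun k => beta (- k)%Z) (- lam) (- c) = chi D d r g0 beta lam c.
Proof.
intros [s Hs]; unfold chi.
assert (Hs' : is_sumZ (beta_exp (fun k => beta (- k)%Z) (- lam)) s).
{ apply is_sumZ_opp in Hs; revert Hs; apply is_sumZ_ext; intros k; symmetry; apply beta_exp_opp. }
rewrite (is_sumZ_SeriesZ _ _ Hs), (is_sumZ_SeriesZ _ _ Hs').
replace (- - c * r * - lam) with (- c * r * lam) by ring.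
rewrite Ropp_involutive; ring.
Qed.

Section Critical.

Context (D d r g0 : R) (beta : Z -> R) (gm gp : Rbar) (Habs : abscissae beta gm gp).

Lemma cstar_plus_above c : Rbar_le (cstar_plus D d r g0 beta gm gp) (Finite c) ->
  above_critical D d r g0 beta c.
Proof.
intros Hc eps Heps; apply NNPP; intros Hn.
destruct (Glb_Rbar_correct (fun c => exists z, 0 < z /\ chi_dom D d gm gp z c /\
  chi D d r g0 beta z c = 0)) as [_ Hglb].
assert (H : Rbar_le (Finite (c + eps)) (Finite c)); [|simpl in H; lra].
apply Rbar_le_trans with (2 := Hc), Hglb.
intros c' [z [Hz [[H1 [H2 _]] H3]]]; simpl; apply Rnot_lt_le; intros Hlt; apply Hn.
exists c', z; split; [exact Hlt|split; [exact Hz|split; [|exact H3]]].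
apply Habs; assumption.
Qed.

Lemma cstar_minus_above c : Rbar_le (Finite c) (cstar_minus D d r g0 beta gm gp) ->
  above_critical D d r g0 (fun k => beta (- k)%Z) (- c).
Proof.
intros Hc eps Heps; apply NNPP; intros Hn.
destruct (Lub_Rbar_correct (fun c => exists z, z < 0 /\ chi_dom D d gm gp z c /\
  chi D d r g0 beta z c = 0)) as [_ Hlub].
assert (H : Rbar_le (Finite c) (Finite (c - eps))); [|simpl in H; lra].
apply Rbar_le_trans with (1 := Hc), Hlub.
intros c' [z [Hz [[H1 [H2 _]] H3]]]; simpl; apply Rnot_lt_le; intros Hlt; apply Hn.
assert (Hs : ex_sumZ (beta_exp beta z)) by (apply Habs; assumption).
exists (- c'), (- z); split; [lra|split; [lra|split]].
- apply ex_sumZ_opp, Hs.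
- rewrite chi_opp by exact Hs; exact H3.
Qed.

End Critical.

(* By convexity of [- chi (., c)], which is positive at 0, it cannot be almost nonpositive
   on both sides of 0. *)
Lemma critical_exclusive D d r g0 beta c : 0 < D -> 0 < d -> 0 <= r -> d < g0 ->
  (forall k, 0 <= beta k) -> is_sumZ beta 1 ->
  above_critical D d r g0 beta c -> above_critical D d r g0 (fun k => beta (- k)%Z) (- c) -> False.
Proof.
intros HD Hd Hr Hg0 Hbeta Hsum H1 H2.
destruct (chi_near_zero D d r g0 beta HD Hd Hr Hg0 Hbeta c ((g0 - d) / 2) H1)
  as [l1 [Hl1 [Hs1 Hchi1]]]; [lra|].
destruct (chi_near_zero D d r g0 (fun k => beta (- k)%Z) HD Hd Hr Hg0
  (fun k => Hbeta (- k)%Z) (- c) ((g0 - d) / 2) H2) as [l2 [Hl2 [Hs2 Hchi2]]]; [lra|].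
assert (Hs2' : ex_sumZ (beta_exp beta (- l2))).
{ apply ex_sumZ_opp in Hs2; destruct Hs2 as [s Hs]; exists s; revert Hs; apply is_sumZ_ext.
  intros k; unfold beta_exp; rewrite Z.opp_involutive; reflexivity. }
assert (E : chi D d r g0 (fun k => beta (- k)%Z) l2 (- c) = chi D d r g0 beta (- l2) c).
{ rewrite <- (chi_opp D d r g0 beta (- l2) c Hs2'), Ropp_involutive; reflexivity. }
rewrite E in Hchi2.
destruct (mass_near_1 beta Hsum ((g0 - d) / (4 * g0))) as [N HN]; [apply Rdiv_lt_0_compat; lra|].
specialize (HN N (le_n _)).
assert (R1 := lin_rate_chi D d r g0 beta Hd Hg0 Hbeta c l1 N Hs1).
assert (R2 := lin_rate_chi D d r g0 beta Hd Hg0 Hbeta c (- l2) N Hs2').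
unfold lin_rate in R1, R2.
set (S1 := lsum (zl N) (fun k => beta k * exp (- l1 * (IZR k + c * r)))) in *.
set (S2 := lsum (zl N) (fun k => beta k * exp (- - l2 * (IZR k + c * r)))) in *.
assert (HS : (l1 + l2) * mass beta N <= l2 * S1 + l1 * S2).
{ unfold S1, S2, mass; rewrite <- !lsum_scal, <- lsum_plus; apply lsum_le; intros k _.
  assert (X := exp_convex l1 l2 (IZR k + c * r) Hl1 (Rlt_le _ _ Hl2)).
  rewrite Ropp_involutive; specialize (Hbeta k).
  apply (Rmult_le_compat_l _ _ _ Hbeta) in X; lra. }
assert (E1 := exp_convex l1 l2 1 Hl1 (Rlt_le _ _ Hl2)).
assert (E2 := exp_convex l1 l2 (-1) Hl1 (Rlt_le _ _ Hl2)).
replace (- l1 * 1) with (- l1) in E1 by ring; replace (- l1 * -1) with l1 in E2 by ring.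
replace (l2 * 1) with (- - l2) in E1 by ring; replace (l2 * -1) with (- l2) in E2 by ring.
assert (F1 := Rmult_le_compat_l D _ _ (Rlt_le _ _ HD) E1).
assert (F2 := Rmult_le_compat_l D _ _ (Rlt_le _ _ HD) E2).
assert (F3 := Rmult_le_compat_l l2 _ _ (Rlt_le _ _ Hl2) R1).
assert (F4 := Rmult_le_compat_l l1 _ _ (Rlt_le _ _ Hl1) R2).
assert (F5 := Rmult_le_compat_l l1 _ _ (Rlt_le _ _ Hl1) Hchi2).
assert (F6 := Rmult_le_compat_l l2 _ _ (Rlt_le _ _ Hl2) Hchi1).
assert (F7 := Rmult_le_compat_l g0 _ _ ltac:(lra) HS).
assert (E3 : g0 * ((g0 - d) / (4 * g0)) = (g0 - d) / 4) by (field; lra).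
assert (F8 : g0 - (g0 - d) / 4 < g0 * mass beta N) by nra.
assert (F9 := Rmult_lt_compat_l (l1 + l2) _ _ ltac:(lra) F8).
nra.
Qed.

Lemma is_lim_m_infty_intro f l : (forall e, 0 < e -> exists X, forall x, x <= X -> Rabs (f x - l) <= e) ->
  is_lim f m_infty (Finite l).
Proof.
intros H; apply is_lim_spec; intros e.
destruct (H (e / 2)) as [X HX]; [destruct e; simpl; lra|].
exists X; intros x Hx; specialize (HX x (Rlt_le _ _ Hx)); destruct e; simpl in *; lra.
Qed.

Lemma is_lim_p_infty_intro f l : (forall e, 0 < e -> exists X, forall x, X <= x -> Rabs (f x - l) <= e) ->
  is_lim f p_infty (Finite l).
Proof.
intros H; apply is_lim_spec; intros e.
destruct (H (e / 2)) as [X HX]; [destruct e; simpl; lra|].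
exists X; intros x Hx; specialize (HX x (Rlt_le _ _ Hx)); destruct e; simpl in *; lra.
Qed.

Lemma is_lim_opp_p f l : is_lim f m_infty l -> is_lim (fun x => f (- x)) p_infty l.
Proof.
intros H; apply (is_lim_comp f Ropp p_infty l m_infty H).
- apply (is_lim_opp (fun x => x) p_infty p_infty), is_lim_id.
- exists 0; intros x _; discriminate.
Qed.

Lemma is_lim_opp_m f l : is_lim f p_infty l -> is_lim (fun x => f (- x)) m_infty l.
Proof.
intros H; apply (is_lim_comp f Ropp m_infty l p_infty H).
- apply (is_lim_opp (fun x => x) m_infty m_infty), is_lim_id.
- exists 0; intros x _; discriminate.
Qed.

(** * The nonlinearity truncated at [zeta2] *)

Section Nonlinearity.

Context (d g0 zeta1 zeta2 : R) (g : R -> R).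
Context (Hd : 0 < d) (Hz : 0 < zeta1 < zeta2).
Context (Hg_cont : forall x, 0 <= x ->
  filterlim g (within (fun y => 0 <= y) (locally x)) (locally (g x))).
Context (Hg_zero : g 0 = 0).
Context (Hg_der : filterlim (fun s => (g s - g 0) / s) (at_right 0) (locally g0)).
Context (HG_pos : forall s, 0 < s -> 0 < g s / d).
Context (HG_der : 1 < g0 / d).
Context (HG_range : forall s, 0 <= s -> 0 <= g s / d <= zeta2).
Context (HG_min : forall s, zeta1 <= s <= zeta2 -> g zeta1 / d <= g s / d).
Context (HG_gt : forall s, 0 < s <= zeta1 -> s < g s / d).
Context (Hg_lin : forall s, 0 <= s -> g s <= g0 * s).

(** Bounded and uniformly continuous on the whole line, although [g] is controlled on the right half
    line only; it agrees with [g] on [[0, zeta2]], where all profiles take their values. *)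
Definition trunc (s : R) : R := g (clip zeta2 s).

Lemma slope_gt_d : d < g0.
Proof. apply (lt_div_iff d _ _ Hd) in HG_der; lra. Qed.

Lemma trunc_id s : 0 <= s <= zeta2 -> trunc s = g s.
Proof. intros H; unfold trunc; rewrite clip_id by exact H; reflexivity. Qed.

Lemma clip_z s : 0 <= clip zeta2 s <= zeta2.
Proof. apply clip_bounds; lra. Qed.

Lemma trunc_bounds s : 0 <= trunc s <= d * zeta2.
Proof.
destruct (HG_range (clip zeta2 s) (proj1 (clip_z s))) as [H1 H2].
apply (le_div_iff d _ _ Hd) in H1; apply (div_le_iff d _ _ Hd) in H2; unfold trunc; lra.
Qed.

Lemma trunc_continuous s : continuity_pt trunc s.
Proof.
apply continuity_pt_filterlim.
apply (filterlim_comp _ _ _ (clip zeta2) g _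
  (within (fun y => 0 <= y) (locally (clip zeta2 s)))); [|apply Hg_cont, clip_z].
assert (Hc : continuous (clip zeta2) s).
{ apply (continuous_Rmin (fun _ => zeta2)); [apply continuous_const|].
  apply (continuous_Rmax (fun _ => 0) (fun x => x)); [apply continuous_const|apply continuous_id]. }
intros P HP; specialize (Hc _ HP).
unfold filtermap in *; revert Hc; apply (filter_imp (F := locally s)).
intros x Hx; apply Hx, clip_z.
Qed.

Lemma trunc_unif : unif trunc.
Proof.
intros om Hom.
destruct (@Heine_cor2 trunc 0 zeta2 (fun x _ => trunc_continuous x) (mkposreal om Hom)) as [del Hdel].
exists (del / 2); split; [destruct del; simpl; lra|]; intros s s' Hs.
assert (E : forall x, trunc x = trunc (clip zeta2 x)).
{ intros x; unfold trunc; rewrite (clip_id zeta2 (clip zeta2 x)) by apply clip_z; reflexivity. }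
rewrite (E s), (E s'); left; apply Hdel; try apply clip_z.
apply Rle_lt_trans with (1 := clip_lip _ _ _); destruct del; simpl in *; lra.
Qed.

Lemma trunc_lin s : 0 <= s -> trunc s <= g0 * s.
Proof.
intros Hs; unfold trunc; apply Rle_trans with (1 := Hg_lin _ (proj1 (clip_z s))).
assert (X := slope_gt_d); apply Rmult_le_compat_l; [lra|].
unfold clip; rewrite (Rmax_right 0 s) by lra; apply Rmin_r.
Qed.

Lemma trunc_slope eta : 0 < eta -> exists th, 0 < th /\
  forall s, 0 <= s <= th -> (g0 - eta) * s <= trunc s.
Proof.
intros Heta.
destruct (proj1 (filterlim_locally _ _) Hg_der (mkposreal eta Heta)) as [del Hdel].
assert (Hdp := cond_pos del).
exists (Rmin (del / 2) zeta2); split; [apply Rmin_pos; lra|].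
intros s [Hs0 Hs]; assert (H1 := Rmin_l (del / 2) zeta2); assert (H2 := Rmin_r (del / 2) zeta2).
rewrite trunc_id by lra.
destruct Hs0 as [Hs0|<-]; [|rewrite Hg_zero; lra].
assert (Hb : ball 0 del s).
{ unfold ball; simpl; unfold AbsRing_ball, abs, minus, plus, opp; simpl.
  rewrite Ropp_0, Rplus_0_r, Rabs_pos_eq; lra. }
specialize (Hdel s Hb Hs0); unfold ball in Hdel; simpl in Hdel.
unfold AbsRing_ball, abs, minus, plus, opp in Hdel; simpl in Hdel.
rewrite Hg_zero, Rminus_0_r in Hdel; apply Rabs_lt_between in Hdel.
assert (E : g s / s * s = g s) by (field; lra).
assert ((g0 - eta) * s <= g s / s * s) by (apply Rmult_le_compat_r; lra); lra.
Qed.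

(** Near 0 the slope [g0 > d] gives the factor, on the compact rest of [(0, zeta1]] the minimum of
    [trunc s / s] does, and beyond [zeta1] the value at [zeta1] is a lower bound. *)
Lemma trunc_gain : exists rho, 1 < rho /\
  forall s, 0 <= s -> rho * d * Rmin s zeta1 <= trunc s.
Proof.
assert (Hs := slope_gt_d).
destruct (trunc_slope ((g0 - d) / 2)) as [th [Hth Hsl]]; [lra|].
set (a := Rmin th zeta1).
assert (Ha0 : 0 < a) by (apply Rmin_pos; lra).
assert (Ha1 : a <= th) by apply Rmin_l; assert (Ha2 : a <= zeta1) by apply Rmin_r.
destruct (continuity_ab_min (fun s => trunc s / s) a zeta1) as [sm [Hm1 Hm2]]; [lra| |].
{ intros x Hx; apply (continuity_pt_div trunc id).
  - apply trunc_continuous.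
  - apply derivable_continuous, derivable_id.
  - unfold id; lra. }
set (q := trunc sm / sm) in *.
assert (Hq : d < q).
{ assert (H := HG_gt sm ltac:(lra)); apply (lt_div_iff d _ _ Hd) in H.
  unfold q; rewrite trunc_id by lra.
  apply Rmult_lt_reg_r with sm; [lra|]; replace (g sm / sm * sm) with (g sm) by (field; lra); lra. }
set (rho := Rmin ((g0 + d) / (2 * d)) (q / d)).
assert (Hr1 : rho * d <= (g0 + d) / 2).
{ apply Rle_trans with ((g0 + d) / (2 * d) * d); [|right; field; lra].
  apply Rmult_le_compat_r; [lra|apply Rmin_l]. }
assert (Hr2 : rho * d <= q).
{ apply Rle_trans with (q / d * d); [|right; field; lra].
  apply Rmult_le_compat_r; [lra|apply Rmin_r]. }
assert (Hlow : forall s, 0 <= s <= zeta1 -> rho * d * s <= trunc s).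
{ intros s Hs'; destruct (Rle_lt_dec s a) as [H|H].
  - apply Rle_trans with ((g0 - (g0 - d) / 2) * s); [|apply Hsl; lra].
    apply Rmult_le_compat_r; lra.
  - assert (X := Hm1 s ltac:(lra)); cbv beta in X; fold q in X.
    apply Rle_trans with (trunc s / s * s); [|right; field; lra].
    apply Rmult_le_compat_r; lra. }
exists rho; split.
- apply Rmin_glb_lt; apply Rmult_lt_reg_r with d; try lra.
  + replace ((g0 + d) / (2 * d) * d) with ((g0 + d) / 2) by (field; lra); lra.
  + replace (q / d * d) with q by (field; lra); lra.
- intros s Hs0; destruct (Rle_lt_dec s zeta1) as [H|H].
  + rewrite Rmin_left by exact H; apply Hlow; lra.
  + rewrite Rmin_right by lra.
    apply Rle_trans with (1 := Hlow zeta1 ltac:(lra)).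
    rewrite trunc_id by lra; unfold trunc.
    assert (Hcl : zeta1 <= clip zeta2 s <= zeta2).
    { unfold clip; rewrite (Rmax_right 0 s) by lra; split; [apply Rmin_glb; lra|apply Rmin_l]. }
    assert (X := HG_min _ Hcl); apply (div_le_iff d _ _ Hd) in X.
    apply Rle_trans with (1 := X); right; field; lra.
Qed.

Lemma trunc_pos s : 0 < s -> 0 < trunc s.
Proof.
intros Hs; assert (H : 0 < clip zeta2 s).
{ unfold clip; rewrite (Rmax_right 0 s) by lra; apply Rmin_pos; lra. }
apply HG_pos, (lt_div_iff d _ _ Hd) in H; unfold trunc; lra.
Qed.

Lemma iter_two_cycle (G : R -> R) s n : G (G s) = s -> Nat.iter (n + n) G s = s.
Proof.
intros H; induction n as [|n IH]; [reflexivity|].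
replace (S n + S n)%nat with (S (S (n + n))) by lia; simpl; rewrite IH; exact H.
Qed.

(** Along a 2-cycle the even iterates stay at [s], yet they converge to [kappa]. *)
Lemma trunc_no_two_cycle kappa : (forall s, 0 < s <= zeta2 ->
    is_lim_seq (fun n => Nat.iter n (fun x => g x / d) s) (Finite kappa)) ->
  forall s, 0 < s <= zeta2 -> trunc (trunc s / d) / d = s -> s = kappa.
Proof.
intros Hatt s Hs E.
assert (H1 := HG_pos s ltac:(lra)); assert (H2 := HG_range s ltac:(lra)).
rewrite (trunc_id s), trunc_id in E by lra.
assert (HL := Hatt s Hs); apply is_lim_seq_spec in HL.
apply Rminus_diag_uniq, Rabs_eq_0, Rle_antisym; [|apply Rabs_pos].
apply Rabs_bound_0; intros eps Heps.
destruct (HL (mkposreal eps Heps)) as [N HN]; specialize (HN (N + N)%nat ltac:(lia)).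
rewrite (iter_two_cycle (fun x => g x / d) s N E) in HN; simpl in HN; lra.
Qed.

Lemma semi_wavefront_right D r beta c : 0 < D -> 0 <= r ->
  (forall k, 0 <= beta k) -> is_sumZ beta 1 -> c <> 0 -> above_critical D d r g0 beta c ->
  exists phi, wave D d r beta g c phi /\ (forall x, 0 < phi x <= zeta2) /\
    is_lim phi m_infty (Finite 0) /\ liminf_p_infty_gt phi zeta1 /\
    forall kappa, 0 < kappa ->
      (forall s, 0 <= s -> (g s / d = s <-> s = 0 \/ s = kappa)) ->
      (forall s, 0 < s <= zeta2 ->
         is_lim_seq (fun n => Nat.iter n (fun x => g x / d) s) (Finite kappa)) ->
      is_lim phi p_infty (Finite kappa).
Proof.
intros HD Hr Hbeta Hsum Hc Hcrit.
destruct trunc_gain as [rho [Hrho Hlow]].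
destruct (front_exists D d r zeta2 beta trunc HD Hd Hr ltac:(lra) Hbeta Hsum trunc_bounds trunc_unif
  g0 rho zeta1 trunc_lin (proj1 Hz) Hrho Hlow slope_gt_d trunc_slope c Hc Hcrit)
  as [phi [Hphi [Hphi0 [Hleft [eta [X [Heta HX]]]]]]].
exists phi; split; [|split; [|split; [|split]]].
- intros x; destruct Hphi as [Hb He]; destruct (He x) as [H1 H2].
  exists (c * Derive phi x + (d + 2 * D) * phi x - D * (phi (x + 1) + phi (x - 1))); split.
  + revert H2; apply is_sumZ_ext; intros k; rewrite trunc_id by apply Hb; reflexivity.
  + replace (_ / c) with (Derive phi x) by (field; exact Hc); apply Derive_correct, H1.
- intros x; split; [apply Hphi0|apply Hphi].
- apply is_lim_m_infty_intro; intros e He; destruct (Hleft e He) as [Y HY]; exists Y.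
  intros x Hx; rewrite Rminus_0_r, Rabs_pos_eq by (left; apply Hphi0); apply HY, Hx.
- exists eta, X; split; [exact Heta|exact HX].
- intros kappa Hk Hfix Hatt; apply is_lim_p_infty_intro.
  assert (Hk2 : 0 < kappa <= zeta2).
  { split; [exact Hk|]; rewrite <- (proj2 (Hfix kappa ltac:(lra)) (or_intror eq_refl)).
    apply HG_range; lra. }
  apply (profile_converges D d r zeta2 beta HD Hd Hr Hbeta Hsum trunc c phi zeta1 (g0 / d));
    try assumption; try lra.
  + apply trunc_bounds.
  + apply trunc_unif.
  + apply trunc_pos.
  + intros s Hs; rewrite trunc_id by lra; apply HG_gt, Hs.
  + intros s Hs; apply div_le_iff; [exact Hd|]; replace (d * (g0 / d * s)) with (g0 * s) by (field; lra).
    apply trunc_lin, Hs.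
  + intros s Hs; rewrite trunc_id by lra; rewrite (Hfix s) by lra; lra.
  + apply (trunc_no_two_cycle kappa Hatt).
  + exists eta, X; split; [lra|exact HX].
Qed.

End Nonlinearity.

Theorem theorem5p5
  (D d r : R) (beta : Z -> R) (g : R -> R) (g0 : R) (gm gp : Rbar) (zeta1 zeta2 : R)
  (HD : 0 < D) (Hd : 0 < d) (Hr : 0 <= r)
  (Hbeta_nn : forall k, 0 <= beta k) (Hbeta_sum : is_sumZ beta 1)
  (Hg_nn : forall s, 0 <= s -> 0 <= g s)
  (Hg_cont : forall x, 0 <= x ->
     filterlim g (within (fun y => 0 <= y) (locally x)) (locally (g x)))
  (Hg0 : g 0 = 0)
  (Hg_der : filterlim (fun s => (g s - g 0) / s) (at_right 0) (locally g0))
  (Habs : abscissae beta gm gp)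
  (Hgp : Rbar_lt (Finite 0) gp) (Hgm : Rbar_lt gm (Finite 0))
  (Hz : 0 < zeta1 < zeta2)
  (HG_pos : forall s, 0 < s -> 0 < g s / d)
  (HG_der : 1 < g0 / d)
  (HG_inv : forall s, zeta1 <= s <= zeta2 -> zeta1 <= g s / d <= zeta2)
  (HG_range : forall s, 0 <= s -> 0 <= g s / d <= zeta2)
  (HG_min : forall s, zeta1 <= s <= zeta2 -> g zeta1 / d <= g s / d)
  (HG_gt : forall s, 0 < s <= zeta1 -> s < g s / d)
  (Hg_lin : forall s, 0 <= s -> g s <= g0 * s)
  (c : R) (Hc0 : c <> 0)
  (Hc : Rbar_le (Finite c) (cstar_minus D d r g0 beta gm gp) \/
        Rbar_le (cstar_plus D d r g0 beta gm gp) (Finite c)) :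
  exists phi : R -> R,
    semi_wavefront D d r beta g c phi /\
    (forall x, phi x <= zeta2) /\
    (Rbar_le (Finite c) (cstar_minus D d r g0 beta gm gp) ->
       is_lim phi p_infty (Finite 0) /\ liminf_m_infty_gt phi zeta1) /\
    (Rbar_le (cstar_plus D d r g0 beta gm gp) (Finite c) ->
       is_lim phi m_infty (Finite 0) /\ liminf_p_infty_gt phi zeta1) /\
    (forall kappa : R,
       0 < kappa ->
       (forall s, 0 <= s -> (g s / d = s <-> s = 0 \/ s = kappa)) ->
       (forall s, 0 < s <= zeta2 ->
          is_lim_seq (fun n => Nat.iter n (fun x => g x / d) s) (Finite kappa)) ->
       (Rbar_le (Finite c) (cstar_minus D d r g0 beta gm gp) ->
          is_lim phi m_infty (Finite kappa)) /\
       (Rbar_le (cstar_plus D d r g0 beta gm gp) (Finite c) ->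
          is_lim phi p_infty (Finite kappa))).
Proof.
assert (Hslope := slope_gt_d d g0 Hd HG_der).
(* One and the same [phi] has to meet the claims for both ranges of speeds, so the ranges must be
   shown to be disjoint. *)
assert (Hex : Rbar_le (Finite c) (cstar_minus D d r g0 beta gm gp) ->
  Rbar_le (cstar_plus D d r g0 beta gm gp) (Finite c) -> False).
{ intros H1 H2; apply (critical_exclusive D d r g0 beta c HD Hd Hr Hslope Hbeta_nn Hbeta_sum).
  - apply (cstar_plus_above D d r g0 beta gm gp Habs c H2).
  - apply (cstar_minus_above D d r g0 beta gm gp Habs c H1). }
destruct Hc as [Hc|Hc].
- destruct (semi_wavefront_right d g0 zeta1 zeta2 g Hd Hz Hg_cont Hg0 Hg_der HG_pos HG_der
    HG_range HG_min HG_gt Hg_lin D r (fun k => beta (- k)%Z) (- c) HD Hr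
    (fun k => Hbeta_nn (- k)%Z) (is_sumZ_opp _ _ Hbeta_sum) ltac:(lra)
    (cstar_minus_above D d r g0 beta gm gp Habs c Hc))
    as [phi [Hw [Hb [Hlim [[eta [X [Heta HX]]] Hk]]]]].
  exists (fun x => phi (- x)); split; [split; [|split; [|split]]|split; [|split; [|split]]].
  + intros x; apply Hb.
  + exists zeta2; intros x; apply Hb.
  + right; apply is_lim_opp_p, Hlim.
  + apply (wave_LE D d r beta g c (fun x => phi (- x))); [exact Hc0|apply wave_reflect; assumption].
  + intros x; apply Hb.
  + intros _; split; [apply is_lim_opp_p, Hlim|].
    exists eta, (- X); split; [exact Heta|]; intros s Hs; apply HX; lra.
  + intros H; destruct (Hex Hc H).
  + intros kappa K1 K2 K3; split; [intros _; apply is_lim_opp_m, Hk; assumption|].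
    intros H; destruct (Hex Hc H).
- destruct (semi_wavefront_right d g0 zeta1 zeta2 g Hd Hz Hg_cont Hg0 Hg_der HG_pos HG_der
    HG_range HG_min HG_gt Hg_lin D r beta c HD Hr Hbeta_nn Hbeta_sum Hc0
    (cstar_plus_above D d r g0 beta gm gp Habs c Hc))
    as [phi [Hw [Hb [Hlim [Hinf Hk]]]]].
  exists phi; split; [split; [|split; [|split]]|split; [|split; [|split]]].
  + intros x; apply Hb.
  + exists zeta2; intros x; apply Hb.
  + left; exact Hlim.
  + apply (wave_LE D d r beta g c phi); assumption.
  + intros x; apply Hb.
  + intros H; destruct (Hex H Hc).
  + intros _; split; [exact Hlim|exact Hinf].
  + intros kappa K1 K2 K3; split; [intros H; destruct (Hex H Hc)|].
    intros _; apply Hk; assumption.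
Qed.
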